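(* Let $f(x)=\mathbb{E}_{\xi\sim\mathcal{D}}[f_\xi(x)]$ on $\mathbb{R}^d$, and suppose that Assumptions (A1) (unbiased, variance-bounded stochastic gradients and Hessians, with constants $\sigma_g,\sigma_H$), (A2) (lower boundedness), (A3) (symmetric $(L_0,L_1)$-Lipschitz gradient with respect to $\|\cdot\|$, $L_1>0$) and (A5) (mean-squared symmetric $(\mathcal{L}_0,\mathcal{L}_1)$-Lipschitz stochastic gradients with respect to $\|\cdot\|$, $\mathcal{L}_1>0$), all stated in the context, hold. Let $K\ge 1$ be an integer, and let $\{x_k\}$ be the iterates generated, for $k=0,1,\ldots,K$, from initial points $x_0,m_0\in\mathbb{R}^d$ by the LMO-based method with momentum variance reduction $$x_{k+1}=x_k+\mathrm{lmo}_k(m_k),\qquad \mathrm{lmo}_k(m_k)\in\operatorname*{arg\,min}_{\|x\|\le\eta_k}\langle m_k,x\rangle,\qquad \xi_{k+1}\sim\mathcal{D},$$ $$m_{k+1}=(1-\alpha_k)\bigl(m_k+\nabla f_{\xi_{k+1}}(x_{k+1})-\nabla f_{\xi_{k+1}}(x_k)\bigr)+\alpha_k\nabla f_{\xi_{k+1}}(x_{k+1}),$$ with $$\alpha_k=\alpha=\frac{1}{(K+1)^{2/3}},\qquad \eta_k=\eta=\frac{\hat\eta}{(K+1)^{2/3}},\qquad \hat\eta=\frac13\min\left\{\frac{1}{L_1},\frac{1}{11\mathcal{L}_1}\left(\frac{\bar\rho}{\underline\rho}\right)^{-1}\right\}.$$ Then, with $e_0:=m_0-\nabla f(x_0)$,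 $$\min_{k\in\{0,1,\ldots,K\}}\mathbb{E}\bigl[\|\nabla f(x_k)\|_\star\bigr]\le \frac{2(f(x_0)-f_{\inf})}{\hat\eta(K+1)^{1/3}}+\frac{4\bigl(\mathbb{E}[\|e_0\|_\star]+\bar\rho\sigma_g\bigr)}{(K+1)^{1/3}}+\frac{\hat\eta L_0\exp(L_1\hat\eta)}{(K+1)^{2/3}}$$ $$\qquad+8\,\frac{\bar\rho}{\underline\rho}\bigl(\mathcal{L}_0+2\mathcal{L}_1\bar\rho\sigma_g\bigr)\exp\bigl(6\mathcal{L}_1^2\hat\eta^2\bigr)\frac{\hat\eta}{(K+1)^{1/3}}.$$
   Context: $\|\cdot\|$ is an arbitrary norm on $\mathbb{R}^d$, $\|\cdot\|_\star$ its dual norm ($\|u\|_\star=\max_{\|v\|\le 1}\langle u,v\rangle$), $\|\cdot\|_2$ the Euclidean norm and $\langle\cdot,\cdot\rangle$ the standard inner product. The positive constants $\underline\rho,\bar\rho$ satisfy, for all $x\in\mathbb{R}^d$, $\underline\rho\|x\|_2\le\|x\|_\star\le\bar\rho\|x\|_2$. $\xi$ is a random vector with distribution $\mathcal{D}$; each $f_\xi:\mathbb{R}^d\to\mathbb{R}$ is differentiable and possibly nonconvex; $\nabla f_\xi(x)$ and $\nabla^2 f_\xi(x)$ are the stochastic gradient and stochastic Hessian. (A1) For all $x,w\in\mathbb{R}^d$: $\mathbb{E}_\xi[\nabla f_\xi(x)]=\nabla f(x)$, $\mathbb{E}_\xi[\|\nabla f_\xi(x)-\nabla f(x)\|_2^2]\le\sigma_g^2$,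 $\mathbb{E}_\xi[\nabla^2 f_\xi(x)]=\nabla^2 f(x)$, and $\mathbb{E}_\xi[\|(\nabla^2 f_\xi(x)-\nabla^2 f(x))w\|_2^2]\le\sigma_H^2\|w\|_2^2$. (A2) $f_{\inf}:=\inf_{x\in\mathbb{R}^d}f(x)>-\infty$. (A3) $f$ is differentiable and, for all $x,y\in\mathbb{R}^d$, $\|\nabla f(x)-\nabla f(y)\|_\star\le\bigl(L_0+L_1\sup_{\theta\in[0,1]}\|\nabla f(\theta x+(1-\theta)y)\|_\star\bigr)\|x-y\|$. (A5) For all $x,y\in\mathbb{R}^d$, $\mathbb{E}_\xi\bigl[\|\nabla f_\xi(x)-\nabla f_\xi(y)\|_\star^2\bigr]\le\mathbb{E}_\xi\Bigl[\bigl(\mathcal{L}_0+\mathcal{L}_1\sup_{\theta\in[0,1]}\|\nabla f_\xi(\theta x+(1-\theta)y)\|_\star\bigr)^2\Bigr]\|x-y\|^2$. The samples $\xi_1,\xi_2,\ldots$ are independent with law $\mathcal{D}$; if $m_0$ is random it is independent of them. $\mathbb{E}$ is expectation over all randomness. When the linear minimization problem has several minimizers, $\mathrm{lmo}_k$ is any (measurable) selection. *)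

(* Defs.v *)
From HB Require Import structures.
From mathcomp Require Import all_boot all_order all_algebra.
From mathcomp Require Import all_classical all_reals all_analysis.

Set Implicit Arguments.
Unset Strict Implicit.
Unset Printing Implicit Defensive.

Import Order.TTheory GRing.Theory Num.Theory.
Import numFieldNormedType.Exports.

Local Open Scope classical_set_scope.
Local Open Scope ring_scope.

(* Vectors of R^n are row vectors 'rV[R]_n. The topology and the notion of
   differentiability are those of the library's sup norm on matrices; both are
   independent of the norm chosen on a finite-dimensional space. *)

Section Vectors.
Context {R : realType} {n : nat}.
Implicit Types (u v x y : 'rV[R]_n) (N : 'rV[R]_n -> R).

Definition dot u v : R := \sum_(i < n) u ord0 i * v ord0 i.

Definition norm2 u : R := Num.sqrt (dot u u).

Record is_norm N : Prop := IsNorm {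
  is_norm_triangle : forall u v, N (u + v) <= N u + N v ;
  is_norm_scale : forall (a : R) u, N (a *: u) = `|a| * N u ;
  is_norm_eq0 : forall u, N u = 0 -> u = 0 }.

(* When N is a norm, the set is nonempty and bounded, so that the real
   supremum is meaningful (and is a maximum). *)
Definition dual_norm N u : R := sup [set dot u v | v in [set v | N v <= 1]].

Definition grad (f : 'rV[R]_n -> R) x : 'rV[R]_n :=
  \row_(j < n) 'D_(delta_mx ord0 j) f x.

(* For row vectors w *m 'J g x = 'd g x w, hence w *m hess f x is the product
   of the Hessian of f at x with the vector w. *)
Definition hess (f : 'rV[R]_n -> R) x : 'M[R]_n := 'J (grad f) x.

Definition twice_differentiable (f : 'rV[R]_n -> R) : Prop :=
  forall x, differentiable f x /\ differentiable (grad f) x.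

(* sup_{t in [0,1]} N (g (t x + (1 - t) y)), possibly +oo. *)
Definition segment_sup N (g : 'rV[R]_n -> 'rV[R]_n) x y : \bar R :=
  ereal_sup [set (N (g (t *: x + (1 - t) *: y)))%:E | t in `[0, 1]].

Definition symmetric_smooth N (L0 L1 : R) (f : 'rV[R]_n -> R) : Prop :=
  (forall x, differentiable f x) /\
  (forall x y,
    (dual_norm N (grad f x - grad f y))%:E <=
    (L0%:E + L1%:E * segment_sup (dual_norm N) (grad f) x y)
      * (N (x - y))%:E)%E.

Definition lmo_set N (eta : R) (m : 'rV[R]_n) : set 'rV[R]_n :=
  [set x | N x <= eta /\ forall y, N y <= eta -> dot m x <= dot m y].

End Vectors.

(* R^n with its Borel sigma-algebra. *)
Definition borel_rV (R : realType) (n : nat) :=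
  g_sigma_algebraType [set A : set 'rV[R]_n | open A].

Section Stochastic.
Context {R : realType} {d : measure_display} {T : measurableType d}.
Variable P : probability T R.

Definition has_expectation (m n : nat) (X : T -> 'M[R]_(m, n))
    (M : 'M[R]_(m, n)) : Prop :=
  forall i j, P.-integrable setT (fun w => (X w i j)%:E) /\
    'E_P[fun w => X w i j]%E = (M i j)%:E.

(* The product rule over finite subfamilies; applied below to a sequence of
   (sub-)sigma-algebras. *)
Definition mutually_independent (F : nat -> set_system T) : Prop :=
  forall (J : seq nat) (E : nat -> set T), uniq J ->
    (forall i, i \in J -> F i (E i)) ->
    P (\bigcap_(i in [set` J]) E i) = (\prod_(i <- J) P (E i))%E.

Context {n : nat}.
Implicit Types (F : T -> 'rV[R]_n -> R) (N : 'rV[R]_n -> R).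

(* The real number E_xi [f_xi(x)]; meaningful when f_xi(x) is integrable. *)
Definition objective F (x : 'rV[R]_n) : R := fine 'E_P[fun s => F s x]%E.

Record unbiased_bounded_variance F (sigma_g sigma_H : R) : Prop := {
  ubv_sample_diff : forall s, twice_differentiable (F s) ;
  ubv_obj_diff : twice_differentiable (objective F) ;
  ubv_grad_mean : forall x,
    has_expectation (fun s => grad (F s) x) (grad (objective F) x) ;
  ubv_grad_var : forall x,
    ('E_P[fun s => (norm2 (grad (F s) x - grad (objective F) x) ^+ 2)%R]
      <= (sigma_g ^+ 2)%:E)%E ;
  ubv_hess_mean : forall x,
    has_expectation (fun s => hess (F s) x) (hess (objective F) x) ;
  ubv_hess_var : forall x w : 'rV[R]_n,
    ('E_P[fun s =>
        (norm2 (w *m (hess (F s) x - hess (objective F) x)) ^+ 2)%R]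
      <= (sigma_H ^+ 2 * norm2 w ^+ 2)%:E)%E }.

(* The right-hand expectation is an integral in [0, +oo]. *)
Definition mean_squared_symmetric_smooth N (L0 L1 : R) F : Prop :=
  forall x y,
    ('E_P[fun s => (dual_norm N (grad (F s) x - grad (F s) y) ^+ 2)%R]
     <= (\int[P]_s
          (L0%:E + L1%:E * segment_sup (dual_norm N) (grad (F s)) x y) ^+ 2)
        * (N (x - y) ^+ 2)%:E)%E.

End Stochastic.

Section Sampling.
Context {R : realType} {dS dO : measure_display}.
Context {S : measurableType dS} {Omega : measurableType dO} {n : nat}.
Variables (D : probability S R) (P : probability Omega R).

(* Index 0 carries sigma(m0) and index k >= 1 carries sigma(xi_k); the variable
   xi 0 is not used. *)
Definition source_sigma_algebra (m0 : Omega -> 'rV[R]_n)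
    (xi : nat -> Omega -> S) (k : nat) : set_system Omega :=
  if k is 0 then
    preimage_set_system setT m0 (@measurable _ (borel_rV R n))
  else preimage_set_system setT (xi k) (@measurable _ S).

Record independent_samples (m0 : Omega -> 'rV[R]_n) (xi : nat -> Omega -> S)
    : Prop := {
  samples_init_meas : measurable_fun setT (m0 : Omega -> borel_rV R n) ;
  samples_meas : forall k, (0 < k)%N -> measurable_fun setT (xi k) ;
  samples_law : forall k, (0 < k)%N ->
    forall A, measurable A -> P (xi k @^-1` A) = D A ;
  samples_indep : mutually_independent P (source_sigma_algebra m0 xi) }.

(* lmo k is the minimizer selected at step k. *)
Record lmo_mvr_iterates (N : 'rV[R]_n -> R) (F : S -> 'rV[R]_n -> R) (K : nat)
    (alpha eta : nat -> R) (lmo : nat -> 'rV[R]_n -> 'rV[R]_n)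
    (xi : nat -> Omega -> S) (x0 : 'rV[R]_n) (m0 : Omega -> 'rV[R]_n)
    (x m : nat -> Omega -> 'rV[R]_n) : Prop := {
  mvr_lmo_meas : forall k, (k <= K)%N ->
    measurable_fun setT (lmo k : borel_rV R n -> borel_rV R n) ;
  mvr_lmo_argmin : forall k v, (k <= K)%N -> lmo_set N (eta k) v (lmo k v) ;
  mvr_x0 : forall w, x 0%N w = x0 ;
  mvr_m0 : forall w, m 0%N w = m0 w ;
  mvr_x_step : forall k w, (k <= K)%N ->
    x k.+1 w = x k w + lmo k (m k w) ;
  mvr_m_step : forall k w, (k <= K)%N ->
    m k.+1 w =
      (1 - alpha k) *: (m k w + grad (F (xi k.+1 w)) (x k.+1 w)
                          - grad (F (xi k.+1 w)) (x k w))
      + alpha k *: grad (F (xi k.+1 w)) (x k.+1 w) }.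

End Sampling.

(* Main.v *)
(* Writing e_k = m_k - grad f(x_k), the linear minimization step and the descent
   inequality give
     f(x_{k+1}) <= f(x_k) - eta ||grad f(x_k)|| + 2 eta ||e_k|| + O(eta^2),
   so it suffices to bound the errors e_k on average. One has
   e_k = (1 - alpha)^k e_0 + V_k with V_{k+1} = (1 - alpha) V_k + noise, where the
   noise is centred given the past and its conditional L2 norm is at most
   p + q ||grad f(x_k)||. Estimating E sqrt(||V_k||^2 + C) for all C >= 0 by
   induction on k, and separating q by Minkowski's inequality at each step, the
   constants p add up in the l2 sense and the slopes q in the l1 sense; the latter
   are absorbed by the descent term because hat_eta is small.

   The noise level is governed by E ||grad f_xi(x + w) - grad f_xi(x)||^2. (A5)
   bounds it through a supremum over the segment taken inside the expectation.
   Applied to the pieces of a fine subdivision of the segment, it yields a linear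
   bound by a discrete Gronwall argument, provided that the oscillation of the
   sample gradient within a piece vanishes in L2 with the mesh. This follows from
   the bounded Hessian variance of (A1), by way of a mean value inequality for
   everywhere differentiable functions. *)

Require Import Defs.
From HB Require Import structures.
From mathcomp Require Import all_boot all_order all_algebra.
From mathcomp Require Import all_classical all_reals all_analysis.
From mathcomp Require Import measurable_realfun ring lra.

Set Implicit Arguments.
Unset Strict Implicit.
Unset Printing Implicit Defensive.

Import Order.TTheory GRing.Theory Num.Theory.
Import numFieldNormedType.Exports.

Local Open Scope classical_set_scope.
Local Open Scope ring_scope.

(** * A mean value inequality with an integrable derivative *)

(** The descent inequality controls only the first moment of ||grad f(x_k)||, while the conditional
    variance of the noise grows with its square, so a recursion for E ||V_k||^2 would not close. A
    recursion for E ||V_k|| alone would close, but would add up the constants p in the l1 sense and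
    lose the factor sqrt(alpha) on which the rate depends. The constant C under the root stands for
    the variance that later steps will add, and gives both at once. With alpha and eta of order
    (K+1)^(-2/3), p has that order too, so p / sqrt(alpha) is of order (K+1)^(-1/3), while q / alpha
    stays below a fixed small number. In (A5), the point of the segment where the supremum is nearly
    reached depends on the sample, so that moment bounds at fixed points do not apply to it. Sample
    Hessians exist at every point but may be discontinuous, and their integral along a segment may
    be infinite for some samples. An inequality between an increment and a possibly infinite
    integral of the derivative is enough: Tonelli's theorem then brings in the second moment of the
    Hessian at each point. *)

Lemma right_secant_lt (R : realType) (g : R -> R) (c l r : R) :
  is_derive c 1 g l -> l < r ->
  \forall y \near c^'+, g y - g c <= r * (y - c).
Proof.
move=> [dg gl] lr.
have cv : (fun t : R => t^-1 *: (g (t + c) - g c)) @ (0 : R)^'+ --> l.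
  apply: cvg_dnbhs_at_right; rewrite -gl /derive.
  have := dg; rewrite /derivable.
  by under eq_fun do rewrite /= scaler1.
have : \forall t \near (0 : R)^'+, t^-1 *: (g (t + c) - g c) < r.
  exact: (cvgr_lt _ cv).
move=> [e /= e0 He]; exists e => //= y yc cy.
have := He (y - c).
rewrite /= sub0r normrN distrC => /(_ yc); rewrite subr_gt0 => /(_ cy).
rewrite subrK => /ltW; rewrite -[_ *: _]/(_ * _) => H.
by rewrite mulrC -ler_pdivrMl ?subr_gt0.
Qed.

(* The derivative is not assumed continuous. The level sets [E j] of [|h|] lie in
   open sets [U j] of almost the same measure, so [|h|] is dominated near each
   point by a function [u] with almost the same integral; the last point [c] up
   to which the increments of [g] are bounded by the integral of [u] is [b]. *)
Lemma derive_le_integral (R : realType) (g h : R -> R) (a b : R) :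
  a <= b -> (forall t, t \in `[a, b] -> is_derive t 1 g (h t)) ->
  measurable_fun setT h ->
  ((g b - g a)%:E <=
     \int[lebesgue_measure]_(t in `[a, b]) `|h t|%:E)%E.
Proof.
move=> ab gh mh; set I := (X in (_ <= X)%E).
have mI c d : measurable (`[c, d] : set R) by exact: measurable_itv.
have muI c d : c <= d -> lebesgue_measure `[c, d]%classic = (d - c)%:E.
  move=> cd; rewrite lebesgue_measure_itv /= lte_fin.
  move: cd; rewrite le_eqVlt => /predU1P[->|->]; last by rewrite EFinB.
  by rewrite ltxx subrr.
apply/lee_addgt0Pr => e' e'0.
(* The slack [e'] splits into [e * (b - a)], the cost of replacing [|h|] by [|h| + e], and [e], the
   cost of the sets [U j] minus [E j]. *)
set e := e' / (b - a + 1).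
have ba0 : 0 < b - a + 1 by rewrite ltr_wpDl// subr_ge0.
have e0 : 0 < e by rewrite /e divr_gt0.
pose E j := `[a, b] `&` [set t | j%:R * e <= `|h t| < j.+1%:R * e].
have mE j : measurable (E j).
  apply: measurableI => //.
  have -> : [set t | j%:R * e <= `|h t| < j.+1%:R * e] =
      setT `&` (fun t => `|h t|) @^-1` `[j%:R * e, j.+1%:R * e[.
    by rewrite setTI; apply/seteqP; split => t /=; rewrite in_itv.
  by apply: measurableT_comp => //; exact: normr_measurable.
have Efin j : (lebesgue_measure (E j) < +oo)%E.
  apply: (@le_lt_trans _ _ (lebesgue_measure `[a, b]%classic)).
    by apply: le_measure; rewrite ?inE; [exact: mE|exact: mI|exact: subIsetl].
  by rewrite muI// ltry.
(* Height [j.+1 * e] on a set of measure [dl j] costs [e / 2 ^ j.+1]; these costs add up to [e]. *)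
pose dl j : R := (j.+1%:R)^-1 / (2 ^ j.+1)%:R.
have dl0 j : 0 < dl j.
  by rewrite /dl divr_gt0// ?invr_gt0 ?ltr0n// expn_gt0.
have /choice[U HU] : forall j, exists U : set R,
    [/\ open U, E j `<=` U & (lebesgue_measure (U `\` E j) < (dl j)%:E)%E].
  by move=> j; apply: lebesgue_regularity_outer; [exact: mE|exact: Efin|exact: dl0].
have oU j : open (U j) by case: (HU j).
have EU j : E j `<=` U j by case: (HU j).
have UE j : (lebesgue_measure (U j `\` E j) < (dl j)%:E)%E by case: (HU j).
have mD j : measurable (U j `\` E j).
  by apply: measurableD; [exact: open_measurable|exact: mE].
pose r j t : \bar R := ((j.+1%:R * e) * \1_(U j `\` E j) t)%:E.
have r0 j t : (0 <= r j t)%E.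
  by rewrite /r lee_fin mulr_ge0// mulr_ge0// ltW.
have mr j : measurable_fun setT (r j).
  by apply/measurable_EFinP; apply: measurable_funM.
(* On [E j] the term [|h| + e] is at least [j.+1 * e], and on the rest of [U j] the summand [r j]
   equals it; so [u] is at least [j.+1 * e] on the whole open set [U j]. *)
pose u t := ((`|h t| + e)%:E + \sum_(0 <= j <oo) r j t)%E.
have sr0 t : (0 <= \sum_(0 <= j <oo) r j t)%E by exact: nneseries_ge0.
have u0 t : (0 <= u t)%E.
  by rewrite /u adde_ge0// lee_fin addr_ge0// ltW.
have mhe : measurable_fun setT (fun t => (`|h t| + e)%:E).
  apply/measurable_EFinP; apply: measurable_funD => //.
  by apply: measurableT_comp => //; exact: normr_measurable.
have mu_ : measurable_fun setT u.
  apply: emeasurable_funD => //.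
  exact: ge0_emeasurable_sum.
have muS (A : set R) : measurable A -> measurable_fun A u.
  by move=> mA; apply: measurable_funTS.
pose W x := (\int[lebesgue_measure]_(t in `[a, x]) u t)%E.
have W0 x : (0 <= W x)%E by exact: integral_ge0.
have Wle x y : x <= y -> (W x <= W y)%E.
  move=> xy; apply: ge0_subset_integral => //; first exact: muS.
  by apply: subset_itvl; rewrite bnd_simp.
have Wb : (W b <= I + e'%:E)%E.
  have h0 t : (0 <= `|h t|%:E)%E by rewrite lee_fin.
  have mh' : measurable_fun setT (fun t => `|h t|%:E).
    by apply/measurable_EFinP; apply: measurableT_comp => //; exact: normr_measurable.
  have he0 t : (0 <= (`|h t| + e)%:E)%E by rewrite lee_fin addr_ge0// ltW.
  have msr : measurable_fun setT (fun t => \sum_(0 <= j <oo) r j t)%E.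
    exact: ge0_emeasurable_sum.
  rewrite /W /u ge0_integralD//; [|exact: measurable_funTS|exact: measurable_funTS].
  under eq_integral do rewrite EFinD.
  rewrite ge0_integralD//; [|exact: measurable_funTS|by move=> t _; rewrite lee_fin ltW].
  rewrite -addeA leeD2l//.
  rewrite integral_cst// [X in (_ * X)%E](_ : _ = (b - a)%:E); last exact: muI.
  rewrite -EFinM.
  rewrite integral_nneseries//; last by move=> j; exact: measurable_funTS (mr j).
  have -> : e' = e * (b - a) + e.
    by rewrite -[X in _ + X]mulr1 -mulrDr /e divfK// gt_eqF.
  rewrite EFinD leeD2l//.
  apply: le_trans (epsilon_trick0 _ (ltW e0)).
  apply: lee_nneseries => [j _ _|j _]; first exact: integral_ge0.
  rewrite /r; under eq_integral do rewrite EFinM.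
  rewrite ge0_integralZl//; last 2 first.
  - by apply/measurable_EFinP; apply: measurable_funTS; apply: measurable_indic; exact: mD.
  - by rewrite lee_fin mulr_ge0// ltW.
  rewrite integral_indic; [|exact: mI|exact: mD].
  apply: (@le_trans _ _ ((j.+1%:R * e)%:E * (dl j)%:E)%E).
    apply: lee_wpmul2l; first by rewrite lee_fin mulr_ge0// ltW.
    apply: le_trans (ltW (UE j)).
    apply: le_measure; last exact: subIsetl; rewrite inE.
      by apply: measurableI; [exact: mD|exact: mI].
    exact: mD.
  rewrite -EFinM lee_fin /dl mulrA -[_ * e * _]mulrA [e * _]mulrC mulrA.
  by rewrite divff ?mul1r// pnatr_eq0.
have [Ioo|Ifin] := eqVneq I +oo%E; first by rewrite Ioo addye// leey.
have I0 : (0 <= I)%E by exact: integral_ge0.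
have Wfin x : x <= b -> W x \is a fin_num.
  move=> xb; rewrite ge0_fin_numE//.
  apply: (le_lt_trans (Wle _ _ xb)); apply: (le_lt_trans Wb).
  by rewrite lte_add_pinfty ?ltry// ltey.
apply: le_trans Wb.
pose A := [set x | a <= x <= b /\ ((g x - g a)%:E <= W x)%E].
have Aa : A a by split; rewrite ?lexx// subrr.
have sA : has_sup A.
  split; first by exists a.
  by exists b => x [/andP[]].
set c := sup A.
have ac : a <= c by exact: sup_upper_bound.
have cb : c <= b by apply: ge_sup; [exists a|move=> x [/andP[]]].
have gc : {for c, continuous g}.
  apply: differentiable_continuous; apply/derivable1_diffP.
  by have [] := gh c; rewrite ?in_itv /= ?ac.
(* The supremum belongs to [A]: [g] is continuous at [c], and on the side of [W] monotonicity is
   enough. *)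
have Ac : A c.
  split; first by rewrite ac.
  apply/lee_addgt0Pr => z z0.
  have [d /= d0 Hd] : \forall y \near c, `|g c - g y| < z.
    by move/cvgrPdist_lt : gc => /(_ _ z0).
  have [x Ax cdx] := sup_adherent d0 sA.
  have xc : x <= c by exact: sup_upper_bound.
  have := Hd x; rewrite /= => /(_ _)/ltr_normlP[|_ gcx].
    by rewrite ger0_norm ?subr_ge0// ltrBlDr -ltrBlDl.
  apply: (@le_trans _ _ ((g x - g a)%:E + z%:E)%E).
    by rewrite -EFinD lee_fin; lra.
  by rewrite leeD2r//; case: Ax => _ /le_trans; apply; exact: Wle.
have [cb'|] := ltP c b; last first.
  by move=> bc; have <- : c = b; [apply/le_anti; rewrite cb|case: Ac].
(* If [c < b], the level [j] of [|h c|] gives [h c < j.+1 * e]. Just to the right of [c], [g] grows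
   with slope at most [j.+1 * e] and [W] with slope at least that, since [U j] is a neighbourhood of
   [c]; so [A] would extend beyond its supremum. *)
exfalso.
have cI : c \in `[a, b] by rewrite in_itv /= ac.
set j := Num.truncn (`|h c| / e).
have Ejc : E j c.
  split => //=; rewrite -ler_pdivlMr// -ltr_pdivrMr//.
  by apply: truncn_itv; rewrite divr_ge0// ltW.
have hcj : h c < j.+1%:R * e.
  by apply: le_lt_trans (ler_norm _) _; case: Ejc => _ /andP[].
have [d1 /= d10 Hd1] := right_secant_lt (gh _ cI) hcj.
have [d2 /= d20 Hd2] : nbhs c (U j) by apply: open_nbhs_nbhs; split => //; exact: EU.
pose s := Num.min (Num.min d1 d2) (b - c).
have s0 : 0 < s by rewrite !lt_min d10 d20 subr_gt0.
have sd1 : s <= d1 by rewrite !ge_min lexx.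
have sd2 : s <= d2 by rewrite !ge_min lexx orbT.
have sbc : s <= b - c by rewrite ge_min lexx orbT.
pose y := c + s / 2.
have cy : c < y by rewrite /y; lra.
have yb : y <= b by rewrite /y; lra.
have yU z : c < z -> z <= y -> U j z.
  move=> cz zy; apply: Hd2 => /=; rewrite ltr0_norm ?subr_lt0//.
  by move: zy; rewrite /y; lra.
have uU z : U j z -> ((j.+1%:R * e)%:E <= u z)%E.
  move=> Uz; have [Ez|nEz] := pselect (E j z).
    rewrite /u -[leLHS]adde0 leeD// lee_fin.
    by case: Ez => _ /andP[+ _]; rewrite -natr1 mulrDl mul1r lerD2r.
  rewrite /u -[leLHS]add0e leeD//; first by rewrite lee_fin addr_ge0// ltW.
  apply: le_trans (nneseries_lim_ge j.+1 _) => //.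
  rewrite big_nat_recr//= -[leLHS]add0e leeD//; first exact: sume_ge0.
  by rewrite /r indicE mem_set ?mulr1.
have WcD : W y = (W c + \int[lebesgue_measure]_(t in `]c, y]) u t)%E.
  rewrite /W -ge0_integral_setU//.
  - by congr integral; rewrite -itv_bndbnd_setU// bnd_simp; exact: ltW.
  - by apply: muS; apply: measurableU; exact: measurable_itv.
  - apply/disj_setPS => z /= []; rewrite !in_itv /= => /andP[_ zc] /andP[+ _].
    by rewrite ltNge zc.
have mucy : lebesgue_measure `]c, y]%classic = (y - c)%:E.
  by rewrite lebesgue_measure_itv /= lte_fin cy EFinB.
have Wy : (W c + ((j.+1%:R * e) * (y - c))%:E <= W y)%E.
  rewrite WcD leeD2l// EFinM -mucy -integral_cst//.
  apply: ge0_le_integral => //.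
  - by move=> t _; rewrite lee_fin mulr_ge0// ltW.
  - by apply: muS; exact: measurable_itv.
  - move=> t /=; rewrite in_itv /= => /andP[ct ty]; exact/uU/yU.
have : A y.
  split; first by rewrite (le_trans ac (ltW cy)).
  apply: le_trans Wy; case: Ac => _ gW.
  apply: le_trans (leeD2r _ gW).
  rewrite -EFinD lee_fin.
  have := Hd1 y; rewrite /= => /(_ _ cy); rewrite ltr0_norm ?subr_lt0//.
  rewrite opprB.
  have -> : (y - c < d1) by rewrite /y; lra.
  by move=> /(_ isT); lra.
move=> /(sup_upper_bound sA); rewrite -/c => yc.
by move: cy; rewrite ltNge yc.
Qed.

Lemma mxBE (R : zmodType) (m n : nat) (A B : 'M[R]_(m, n)) i j :
  (A - B) i j = A i j - B i j.
Proof. by rewrite !mxE. Qed.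

(** * Euclidean and dual norms *)

Section EuclideanNorm.
Context {R : realType} {n : nat}.
Implicit Types (u v w : 'rV[R]_n) (a : R).

Lemma dotC u v : dot u v = dot v u.
Proof. by apply: eq_bigr => i _; rewrite mulrC. Qed.

Lemma dotDl u v w : dot (u + v) w = dot u w + dot v w.
Proof.
by rewrite /dot -big_split; apply: eq_bigr => i _; rewrite mxE mulrDl.
Qed.

Lemma dotZl a u w : dot (a *: u) w = a * dot u w.
Proof. by rewrite /dot mulr_sumr; apply: eq_bigr => i _; rewrite mxE mulrA. Qed.

Lemma dotNl u w : dot (- u) w = - dot u w.
Proof. by rewrite -scaleN1r dotZl mulN1r. Qed.

Lemma dot0l w : dot 0 w = 0.
Proof. by rewrite -(scale0r 0) dotZl mul0r. Qed.

Lemma dotBl u v w : dot (u - v) w = dot u w - dot v w.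
Proof. by rewrite dotDl dotNl. Qed.

Lemma dotDr u v w : dot u (v + w) = dot u v + dot u w.
Proof. by rewrite dotC dotDl dotC [dot w u]dotC. Qed.

Lemma dotZr a u w : dot u (a *: w) = a * dot u w.
Proof. by rewrite dotC dotZl dotC. Qed.

Lemma dotNr u w : dot u (- w) = - dot u w.
Proof. by rewrite dotC dotNl dotC. Qed.

Lemma dot_ge0 u : 0 <= dot u u.
Proof. by apply: sumr_ge0 => i _; rewrite -expr2 sqr_ge0. Qed.

Lemma norm2_ge0 u : 0 <= norm2 u.
Proof. exact: sqrtr_ge0. Qed.

Lemma norm2_sqr u : norm2 u ^+ 2 = dot u u.
Proof. by rewrite sqr_sqrtr// dot_ge0. Qed.

Lemma norm2Z a u : norm2 (a *: u) = `|a| * norm2 u.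
Proof.
by rewrite /norm2 dotZl dotZr mulrA -expr2 sqrtrM ?sqr_ge0// sqrtr_sqr.
Qed.

Lemma norm2N u : norm2 (- u) = norm2 u.
Proof. by rewrite -scaleN1r norm2Z normrN1 mul1r. Qed.

Lemma norm20 : norm2 (0 : 'rV[R]_n) = 0.
Proof. by rewrite /norm2 dot0l sqrtr0. Qed.

Lemma coord_le_norm2 u i : `|u ord0 i| <= norm2 u.
Proof.
rewrite -sqrtr_sqr ler_sqrt ?dot_ge0// /dot (bigD1 i)//= -expr2 lerDl.
by apply: sumr_ge0 => j _; rewrite -expr2 sqr_ge0.
Qed.

Lemma norm2_eq0 u : norm2 u = 0 -> u = 0.
Proof.
move=> u0; apply/rowP => i; rewrite !mxE; apply/eqP.
by rewrite -normr_le0 -u0 coord_le_norm2.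
Qed.

Lemma norm2D_sqr u v :
  norm2 (u + v) ^+ 2 = norm2 u ^+ 2 + 2 * dot u v + norm2 v ^+ 2.
Proof. by rewrite !norm2_sqr dotDl !dotDr [dot v u]dotC; ring. Qed.

Lemma dot_le_norm2 u v : dot u v <= norm2 u * norm2 v.
Proof.
have [v0|v0] := eqVneq (norm2 v) 0.
  by rewrite (norm2_eq0 v0) dotC dot0l norm20 mulr0.
have [u0|u0] := eqVneq (norm2 u) 0.
  by rewrite (norm2_eq0 u0) dot0l norm20 mul0r.
have up : 0 < norm2 u by rewrite lt_neqAle eq_sym u0 norm2_ge0.
have vp : 0 < norm2 v by rewrite lt_neqAle eq_sym v0 norm2_ge0.
have := sqr_ge0 (norm2 (norm2 v *: u - norm2 u *: v)).
rewrite norm2D_sqr norm2N !norm2Z !ger0_norm ?norm2_ge0// dotNr dotZl dotZr.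
have := mulr_gt0 up vp; set p := norm2 u * norm2 v => p0.
have -> : norm2 v * norm2 u = p by rewrite /p mulrC.
rewrite mulrA [norm2 v * norm2 u]mulrC -/p => H.
have : 0 <= p * (p - dot u v) by nra.
by rewrite pmulr_rge0// subr_ge0.
Qed.

Lemma norm2D u v : norm2 (u + v) <= norm2 u + norm2 v.
Proof.
rewrite -(@ler_pXn2r _ 2)// ?nnegrE ?addr_ge0 ?norm2_ge0//.
rewrite norm2D_sqr sqrrD; have := dot_le_norm2 u v.
by rewrite -mulr_natl; nra.
Qed.

End EuclideanNorm.

Section DualNorm.
Context {R : realType} {n : nat}.
Variables (N : 'rV[R]_n -> R) (rho_lo rho_hi : R).
Hypotheses (normN : is_norm N) (lo0 : 0 < rho_lo) (hi0 : 0 < rho_hi).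
Hypothesis rho : forall v : 'rV[R]_n,
  rho_lo * norm2 v <= dual_norm N v /\ dual_norm N v <= rho_hi * norm2 v.
Implicit Types (u v w : 'rV[R]_n) (a : R).

Lemma is_norm0 : N 0 = 0.
Proof. by rewrite -(scale0r 0) (is_norm_scale normN) normr0 mul0r. Qed.

Lemma is_normN u : N (- u) = N u.
Proof. by rewrite -scaleN1r (is_norm_scale normN) normrN1 mul1r. Qed.

Lemma is_norm_ge0 u : 0 <= N u.
Proof.
have := is_norm_triangle normN u (- u).
by rewrite subrr is_norm0 is_normN; lra.
Qed.

(* By convention the supremum of an unbounded set is 0, which the lower bound
   by the Euclidean norm excludes. *)
Lemma dual_norm_has_sup u : has_sup [set dot u v | v in [set v | N v <= 1]].
Proof.
have H0 : [set dot u v | v in [set v | N v <= 1]] !=set0.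
  by exists (dot u 0); exists 0 => //=; rewrite is_norm0.
have [//|nsup] := pselect (has_sup [set dot u v | v in [set v | N v <= 1]]).
have [] := rho u; rewrite /dual_norm sup_out// => H _.
have u0 : u = 0.
  apply: norm2_eq0; apply/le_anti; rewrite norm2_ge0 andbT.
  by rewrite -(pmulr_rle0 _ lo0).
by split => //; exists 0 => _ [v _ <-]; rewrite u0 dot0l.
Qed.

Lemma dual_norm_ge0 u : 0 <= dual_norm N u.
Proof. by apply: le_trans (rho u).1; rewrite mulr_ge0 ?norm2_ge0// ltW. Qed.

Lemma dual_normP u M :
  (forall v, N v <= 1 -> dot u v <= M) -> dual_norm N u <= M.
Proof.
move=> H; apply: ge_sup; first by case: (dual_norm_has_sup u).
by move=> _ [v /= Nv <-]; exact: H.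
Qed.

Lemma dot_le_dual u v : dot u v <= dual_norm N u * N v.
Proof.
have [Nv0|Nv0] := eqVneq (N v) 0.
  by rewrite (is_norm_eq0 normN Nv0) dotC dot0l is_norm0 mulr0.
have Nvp : 0 < N v by rewrite lt_neqAle eq_sym Nv0 is_norm_ge0.
rewrite -ler_pdivrMr// mulrC -dotZr.
apply: sup_upper_bound; first exact: dual_norm_has_sup.
exists ((N v)^-1 *: v) => //=; rewrite (is_norm_scale normN) ger0_norm.
  by rewrite mulVf.
by rewrite invr_ge0 ltW.
Qed.

Lemma dual_normD u v : dual_norm N (u + v) <= dual_norm N u + dual_norm N v.
Proof.
apply: dual_normP => w Nw; rewrite dotDl.
by apply: lerD; (apply: le_trans (dot_le_dual _ _) _);
  rewrite ler_piMr ?dual_norm_ge0.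
Qed.

Lemma dual_normZ_le a u : 0 <= a -> dual_norm N (a *: u) <= a * dual_norm N u.
Proof.
move=> a0; apply: dual_normP => w Nw; rewrite dotZl ler_wpM2l//.
by apply: le_trans (dot_le_dual _ _) _; rewrite ler_piMr ?dual_norm_ge0.
Qed.

Lemma dual_normN u : dual_norm N (- u) = dual_norm N u.
Proof.
have H w : dual_norm N (- w) <= dual_norm N w.
  apply: dual_normP => v Nv; rewrite dotNl -dotNr.
  apply: le_trans (dot_le_dual _ _) _.
  by rewrite is_normN ler_piMr ?dual_norm_ge0.
by apply/le_anti; rewrite H -{1}[u]opprK H.
Qed.

Lemma dual_normB u v : dual_norm N (u - v) = dual_norm N (v - u).
Proof. by rewrite -opprB dual_normN. Qed.

Lemma dual_norm0 : dual_norm N 0 = 0.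
Proof.
apply/le_anti; rewrite dual_norm_ge0 andbT.
by apply: le_trans (rho 0).2 _; rewrite norm20 mulr0.
Qed.

(** Each [v] in the unit ball yields the competitor [- (eta *: v)] in the linear minimization; the
    supremum over [v] is then the dual norm. The argument divides by [eta], so [eta = 0] is treated
    apart. *)
Lemma lmo_dual eta m x : 0 <= eta -> lmo_set N eta m x ->
  eta * dual_norm N m <= - dot m x.
Proof.
move=> eta0 [Nx mx]; have [->|etan0] := eqVneq eta 0.
  rewrite mul0r; have := mx 0; rewrite is_norm0 => /(_ eta0).
  by rewrite [dot m 0]dotC dot0l; lra.
have etap : 0 < eta by rewrite lt_neqAle eq_sym etan0.
rewrite mulrC -ler_pdivlMr//; apply: dual_normP => v Nv.
rewrite ler_pdivlMr// mulrC -dotZr.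
have := mx (- (eta *: v)); rewrite is_normN (is_norm_scale normN) ger0_norm//.
by rewrite ler_piMr// => /(_ isT); rewrite dotNr dotZr; lra.
Qed.

End DualNorm.

(** * Second moments *)

Section L2.
Context d (T : measurableType d) (R : realType).
Local Open Scope ereal_scope.

(** The integral of a nonnegative function is a supremum over the simple functions below it, so
    monotonicity holds for arbitrary integrands. This covers integrands containing [segment_sup],
    whose measurability is never established. *)
Lemma integral_mono (mu : {measure set T -> \bar R}) (f1 f2 : T -> \bar R) :
  (forall x, 0 <= f1 x) -> (forall x, f1 x <= f2 x) ->
  \int[mu]_x f1 x <= \int[mu]_x f2 x.
Proof.
move=> f10 f12; have f20 x : 0 <= f2 x by exact: le_trans (f12 x).
rewrite !ge0_integralTE//; apply: le_ereal_sup => _ [h /= hf <-].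
by exists h => // x; exact: le_trans (f12 x).
Qed.

Lemma le_sqr_addgt0 (x : \bar R) (s : R) : (0 <= s)%R ->
  (forall e : R, (0 < e)%R -> x <= ((s + e) ^+ 2)%:E) -> x <= (s ^+ 2)%:E.
Proof.
move=> s0 H; case: x H => [r||] H; last 2 first.
- by have := H _ ltr01; rewrite leye_eq.
- by rewrite leNye.
rewrite lee_fin leNgt; apply/negP => sr.
(* For [e <= 1] one has [(s + e) ^+ 2 <= s ^+ 2 + (2 * s + 1) * e], and this [e] uses at most half
   of the gap [r - s ^+ 2]. *)
set e := Num.min 1%R ((r - s ^+ 2) / (2 * (2 * s + 1)))%R.
have e0 : (0 < e)%R by rewrite lt_min ltr01 divr_gt0//; lra.
have e1 : (e <= 1)%R by rewrite ge_min lexx.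
have : (e <= (r - s ^+ 2) / (2 * (2 * s + 1)))%R by rewrite ge_min lexx orbT.
rewrite ler_pdivlMr; last by lra.
by have := H _ e0; rewrite lee_fin; nra.
Qed.

(** Minkowski's inequality for functions that may take the value +oo. It follows from the pointwise
    bound (f + g)^2 <= (1 + q/p) f^2 + (1 + p/q) g^2, whose weights turn the bounds p^2 and q^2 into
    exactly (p + q)^2; vanishing p or q is reached by perturbation. *)
Lemma L2_triangle (mu : {measure set T -> \bar R}) (f g : T -> \bar R) (p q : R) :
  (forall x, 0 <= f x) -> (forall x, 0 <= g x) ->
  measurable_fun setT f -> measurable_fun setT g ->
  (0 <= p)%R -> (0 <= q)%R ->
  \int[mu]_x (f x ^+ 2) <= (p ^+ 2)%:E ->
  \int[mu]_x (g x ^+ 2) <= (q ^+ 2)%:E ->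
  \int[mu]_x ((f x + g x) ^+ 2) <= ((p + q) ^+ 2)%:E.
Proof.
move=> f0 g0 mf mg.
have mf2 : measurable_fun setT (fun x => f x ^+ 2).
  by under eq_fun do rewrite expe2; exact: emeasurable_funM.
have mg2 : measurable_fun setT (fun x => g x ^+ 2).
  by under eq_fun do rewrite expe2; exact: emeasurable_funM.
have sq0 (y : \bar R) : 0 <= y -> 0 <= y ^+ 2.
  by move=> y0; rewrite expe2 mule_ge0.
have H (p' q' : R) : (0 < p')%R -> (0 < q')%R ->
  \int[mu]_x (f x ^+ 2) <= (p' ^+ 2)%:E ->
  \int[mu]_x (g x ^+ 2) <= (q' ^+ 2)%:E ->
  \int[mu]_x ((f x + g x) ^+ 2) <= ((p' + q') ^+ 2)%:E.
  move=> p0 q0 fp gq.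
  set c1 := (1 + q' / p')%R; set c2 := (1 + p' / q')%R.
  have c10 : (0 < c1)%R by rewrite addr_gt0// divr_gt0.
  have c20 : (0 < c2)%R by rewrite addr_gt0// divr_gt0.
  have -> : (((p' + q') ^+ 2) = c1 * p' ^+ 2 + c2 * q' ^+ 2)%R.
    by rewrite /c1 /c2; field; rewrite !gt_eqF.
  apply: (@le_trans _ _ (\int[mu]_x (c1%:E * f x ^+ 2 + c2%:E * g x ^+ 2))).
    apply: integral_mono => x; first by rewrite sq0// adde_ge0.
    have := f0 x; have := g0 x; case: (f x) => [a||]; case: (g x) => [b||]//.
    - rewrite -EFinD -!EFin_expe -!EFinM -EFinD !lee_fin => b0 a0.
      rewrite -subr_ge0.
      have -> : (c1 * a ^+ 2 + c2 * b ^+ 2 - (a + b) ^+ 2 =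
        (q' * a - p' * b) ^+ 2 / (p' * q'))%R.
        by rewrite /c1 /c2; field; rewrite !gt_eqF.
      by rewrite divr_ge0 ?sqr_ge0// mulr_ge0// ltW.
    - by move=> _ a0; rewrite (_ : +oo ^+ 2 = +oo)// gt0_muley ?lte_fin.
    - by move=> b0 _; rewrite (_ : +oo ^+ 2 = +oo)// gt0_muley ?lte_fin.
    - by move=> _ _; rewrite (_ : +oo ^+ 2 = +oo)// !gt0_muley ?lte_fin// leey.
  rewrite ge0_integralD//; last 4 first.
  - by move=> x _; rewrite mule_ge0 ?lee_fin ?sq0// ltW.
  - exact: measurable_funeM.
  - by move=> x _; rewrite mule_ge0 ?lee_fin ?sq0// ltW.
  - exact: measurable_funeM.
  rewrite !ge0_integralZl//; last 4 first.
  - by move=> x _; rewrite sq0.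
  - by rewrite lee_fin ltW.
  - by move=> x _; rewrite sq0.
  - by rewrite lee_fin ltW.
  rewrite (EFinD (c1 * p' ^+ 2)%R) !EFinM.
  by apply: leeD; apply: lee_wpmul2l => //; rewrite lee_fin ltW.
move=> p0 q0 fp gq; apply: le_sqr_addgt0; first exact: addr_ge0.
move=> e e0.
have -> : (p + q + e = (p + e / 2) + (q + e / 2))%R by field.
apply: H.
- by rewrite ltr_wpDl// divr_gt0.
- by rewrite ltr_wpDl// divr_gt0.
- by apply: le_trans fp _; rewrite lee_fin; nra.
- by apply: le_trans gq _; rewrite lee_fin; nra.
Qed.

Lemma L2_scale (mu : {measure set T -> \bar R}) (f : T -> \bar R) (c p : R) :
  measurable_fun setT f -> \int[mu]_x (f x ^+ 2) <= (p ^+ 2)%:E ->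
  \int[mu]_x ((c%:E * f x) ^+ 2) <= ((c * p) ^+ 2)%:E.
Proof.
move=> mf fp.
have mf2 : measurable_fun setT (fun x => f x ^+ 2).
  by under eq_fun do rewrite expe2; exact: emeasurable_funM.
under eq_integral do rewrite expe2 muleACA -!expe2 -EFin_expe.
rewrite ge0_integralZl//; last 2 first.
- by move=> x _; exact: sqre_ge0.
- by rewrite lee_fin sqr_ge0.
by rewrite exprMn [leRHS]EFinM lee_wpmul2l// lee_fin sqr_ge0.
Qed.

Lemma integral_cst_probability (P : probability T R) (t : R) :
  \int[P]__ t%:E = t%:E.
Proof.
rewrite integral_cst// [X in _ * X](_ : _ = 1) ?mule1//; exact: probability_setT.
Qed.

(** Jensen's inequality for the square root, through its tangents: sqrt h <= h / (2 t) + t / 2, with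
    t slightly above sqrt q so that q = 0 is included. *)
Lemma integral_sqrt_le (P : probability T R) (h : T -> R) (q : R) :
  (forall x, 0 <= h x)%R -> measurable_fun setT h -> (0 <= q)%R ->
  \int[P]_x (h x)%:E <= q%:E ->
  \int[P]_x (Num.sqrt (h x))%:E <= (Num.sqrt q)%:E.
Proof.
move=> h0 mh q0 hq.
have H (t : R) : (0 < t)%R -> (q <= t ^+ 2)%R ->
    \int[P]_x (Num.sqrt (h x))%:E <= t%:E.
  move=> t0 qt.
  apply: (@le_trans _ _ (\int[P]_x ((t^-1 / 2)%:E * (h x)%:E + (t / 2)%:E))).
    apply: integral_mono => x; first by rewrite lee_fin sqrtr_ge0.
    rewrite -EFinM -EFinD lee_fin -{2}(sqr_sqrtr (h0 x)).
    set s := Num.sqrt _; rewrite -subr_ge0.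
    have -> : (t^-1 / 2 * s ^+ 2 + t / 2 - s = (s - t) ^+ 2 / (2 * t))%R.
      by field; rewrite gt_eqF.
    by rewrite divr_ge0 ?sqr_ge0// mulr_ge0// ltW.
  have mhE : measurable_fun setT (fun x => (h x)%:E) by exact/measurable_EFinP.
  have t20 : (0 <= t^-1 / 2)%R by rewrite divr_ge0// invr_ge0 ltW.
  rewrite ge0_integralD//; last 3 first.
  - by move=> x _; rewrite mule_ge0 ?lee_fin.
  - exact: measurable_funeM.
  - by move=> x _; rewrite lee_fin divr_ge0// ltW.
  rewrite ge0_integralZl//; last by move=> x _; rewrite lee_fin.
  rewrite integral_cst_probability.
  apply: (@le_trans _ _ ((t^-1 / 2)%:E * q%:E + (t / 2)%:E)).
    by rewrite leeD2r// lee_wpmul2l.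
  rewrite -EFinM -EFinD lee_fin.
  have : (t^-1 / 2 * q <= t / 2)%R.
    by rewrite mulrAC ler_pM2r// mulrC ler_pdivrMr// -expr2.
  by lra.
apply/lee_addgt0Pr => e e0; rewrite -EFinD; apply: H.
  by rewrite ltr_wpDl// sqrtr_ge0.
rewrite -{1}(sqr_sqrtr q0); have := sqrtr_ge0 q; nra.
Qed.

End L2.

(** The cross term is linear in [Y], so only the mean of [Y] enters. For [M = 0] this is Pythagoras
    for a centred noise; for [v = - M] it bounds the variance by the second moment. *)
Lemma integral_norm2D d (T : measurableType d) (R : realType)
    (P : probability T R) (n : nat) (Y : T -> 'rV[R]_n) (M v : 'rV[R]_n) :
  has_expectation P Y M ->
  (\int[P]_s (norm2 (Y s) ^+ 2)%:E < +oo)%E ->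
  (\int[P]_s (norm2 (Y s + v) ^+ 2)%:E =
   \int[P]_s (norm2 (Y s) ^+ 2)%:E + (2 * dot M v + norm2 v ^+ 2)%:E)%E.
Proof.
move=> YM Yfin.
have iY i : P.-integrable setT (fun s => (Y s ord0 i)%:E) by case: (YM ord0 i).
have mY i : measurable_fun setT (fun s => Y s ord0 i).
  by apply/measurable_EFinP; exact: measurable_int (iY i).
have mn : measurable_fun setT (fun s => norm2 (Y s) ^+ 2).
  under eq_fun do rewrite norm2_sqr.
  by apply: measurable_sum => i; apply: measurable_funM.
have in2 : P.-integrable setT (fun s => (norm2 (Y s) ^+ 2)%:E).
  apply/integrableP; split; first exact/measurable_EFinP.
  under eq_integral do rewrite gee0_abs ?lee_fin ?sqr_ge0//.
  by [].
have idot : P.-integrable setT (fun s => (2 * dot (Y s) v)%:E).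
  under eq_fun do rewrite EFinM.
  apply: integrableZl => //.
  under eq_fun do rewrite /dot -sumEFin.
  apply: integrable_sum => // i _.
  under eq_fun do rewrite mulrC EFinM.
  exact: integrableZl.
under eq_integral do rewrite norm2D_sqr EFinD EFinD.
rewrite integralD//; last 2 first.
- exact: integrableD.
- exact: finite_measure_integrable_cst.
rewrite integralD// integral_cst_probability -addeA EFinD.
congr (_ + (_ + _))%E.
under eq_integral do rewrite EFinM.
rewrite integralZl//; last first.
  under eq_fun do rewrite /dot -sumEFin.
  apply: integrable_sum => // i _.
  under eq_fun do rewrite mulrC EFinM.
  exact: integrableZl.
rewrite EFinM; congr (_ * _)%E.
under eq_integral do rewrite /dot -sumEFin.
rewrite integral_sum//; last first.
  move=> i; under eq_fun do rewrite mulrC EFinM.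
  exact: integrableZl.
rewrite /dot -sumEFin; apply: eq_bigr => i _.
under eq_integral do rewrite mulrC EFinM.
rewrite integralZl//.
have [_] := YM ord0 i; rewrite unlock => ->.
by rewrite -EFinM mulrC.
Qed.

(** * Gradients along segments *)

Section Calculus.
Context {R : realType} {n : nat}.
Implicit Types (f : 'rV[R]_n -> R) (y w : 'rV[R]_n) (t : R).

Lemma is_derive_line (W : normedModType R) (g : 'rV[R]_n -> W) y w t :
  derivable g (y + t *: w) w ->
  is_derive t (1 : R) (fun s : R => g (y + s *: w)) ('D_w g (y + t *: w)).
Proof.
have E : (fun h : R => h^-1 *: (((fun s : R => g (y + s *: w)) \o shift t)
      (h *: (1 : R)) - g (y + t *: w))) =
    (fun h : R => h^-1 *: ((g \o shift (y + t *: w)) (h *: w)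
      - g (y + t *: w))).
  apply/funext => h /=; congr (_ *: (g _ - _)).
  by rewrite -[h *: 1]/(h * 1) mulr1 scalerDl addrCA.
by move=> dg; split; [rewrite /derivable E|rewrite /derive E].
Qed.

Lemma derive_dot_grad f y w : differentiable f y ->
  'D_w f y = dot (grad f y) w.
Proof.
move=> df; rewrite (deriveE w df) {1}(row_sum_delta w) linear_sum.
rewrite dotC; apply: eq_bigr => j _; rewrite linearZ mxE deriveE//.
Qed.

Lemma is_derive_line_dot f y w t : differentiable f (y + t *: w) ->
  is_derive t (1 : R) (fun s : R => f (y + s *: w))
    (dot (grad f (y + t *: w)) w).
Proof.
move=> df; rewrite -derive_dot_grad//; apply: is_derive_line.
exact: diff_derivable.
Qed.

Lemma is_derive_line_hess f y w t i :
  differentiable (grad f) (y + t *: w) ->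
  is_derive t (1 : R) (fun s : R => grad f (y + s *: w) ord0 i)
    ((w *m hess f (y + t *: w)) ord0 i).
Proof.
move=> df; have dg : derivable (grad f) (y + t *: w) w by exact: diff_derivable.
have -> : (w *m hess f (y + t *: w)) ord0 i =
    'D_w (fun z => grad f z ord0 i) (y + t *: w).
  by rewrite /hess -deriveEjacobian// derive_mx// mxE.
by apply: is_derive_line; move/derivable_mxP : dg.
Qed.

Lemma is_derive_quadratic (a b t : R) :
  is_derive t (1 : R) (a *: id + b *: (id ^+ 2)) (a + 2 * b * t).
Proof.
apply: is_derive_eq; rewrite expr1 -![_ *: _]/(_ * _) !mulr1; ring.
Qed.

Lemma norm2_continuous : continuous (@norm2 R n).
Proof.
have dotc : continuous (fun v : 'rV[R]_n => dot v v).
  apply: continuous_big; first exact: add_continuous.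
  move=> i _ v; have c := @coord_continuous R 1 n ord0 i v.
  exact: (cvgM c c).
move=> u; apply: (@continuous_comp _ _ _ (fun v : 'rV[R]_n => dot v v) Num.sqrt).
  exact: dotc.
exact: sqrt_continuous.
Qed.

Lemma right_lipschitz_derive (g : R -> R) t b l C :
  is_derive t 1 g l -> t < b ->
  (forall s, t <= s -> s <= b -> `|g s - g t| <= C * (s - t)) -> `|l| <= C.
Proof.
move=> gl tb gC; rewrite leNgt; apply/negP => Cl.
wlog l0 : g l gl gC Cl / l <= 0.
  move=> H; have [l0|/ltW l0] := leP l 0; first exact: (H g l).
  have gl' : is_derive t 1 (- g) (- l) by exact: is_deriveN.
  apply: (H (- g) (- l)) => //; last 2 first.
  - by rewrite normrN.
  - by rewrite oppr_le0.
  move=> s ts sb; rewrite -[(- g) s]/(- g s) -[(- g) t]/(- g t).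
  by rewrite -opprD normrN; exact: gC.
move: Cl; rewrite ler0_norm// ltrNr => lC.
(* The midpoint of [l] and [- C]: secants to the right of [t] have a slope below it, which
   contradicts the lower bound [- C]. *)
have lr : l < (l - C) / 2 by lra.
have [d /= d0 Hd] := right_secant_lt gl lr.
set s := t + Num.min d (b - t) / 2.
have m0 : 0 < Num.min d (b - t) by rewrite lt_min d0 subr_gt0.
have md : Num.min d (b - t) <= d by rewrite ge_min lexx.
have mb : Num.min d (b - t) <= b - t by rewrite ge_min lexx orbT.
have ts : t < s by rewrite /s; lra.
have := Hd s; rewrite /= ltr0_norm; last by rewrite subr_lt0.
rewrite opprB => /(_ _ ts); have -> : s - t < d by rewrite /s; lra.
move=> /(_ isT) H.
have := gC s (ltW ts); have -> : s <= b by rewrite /s; lra.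
move=> /(_ isT); rewrite ler_norml => /andP[H2 _].
have : 0 < (s - t) * (- C - l) by rewrite mulr_gt0// subr_gt0// ltrNr.
by nra.
Qed.

Variables (N : 'rV[R]_n -> R) (rho_lo rho_hi : R).
Hypotheses (normN : is_norm N) (lo0 : 0 < rho_lo) (hi0 : 0 < rho_hi).
Hypothesis rho : forall v : 'rV[R]_n,
  rho_lo * norm2 v <= dual_norm N v /\ dual_norm N v <= rho_hi * norm2 v.

Lemma dual_norm_continuous : continuous (dual_norm N).
Proof.
move=> u; have Fu : Filter (nbhs u) by exact: nbhs_filter.
apply/cvgrPdist_lt => e e0.
have : \forall v \near u, norm2 (u - v) < e / rho_hi.
  have c1 : continuous (fun v : 'rV[R]_n => u - v).
    move=> v; have Fv : Filter (nbhs v) by exact: nbhs_filter.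
    by apply: cvgB; [exact: cvg_cst|exact: cvg_id].
  have c : (fun v => norm2 (u - v)) @ u --> norm2 (u - u).
    apply: (@continuous_comp _ _ _ (fun v : 'rV[R]_n => u - v) (@norm2 R n)).
      exact: c1.
    exact: norm2_continuous.
  have cu : norm2 (u - u) < e / rho_hi by rewrite subrr norm20 divr_gt0.
  exact: (cvgr_lt _ c _ cu).
apply: (@filterS _ (nbhs u)) => v uv.
have H a b : dual_norm N a - dual_norm N b <= dual_norm N (a - b).
  by rewrite lerBlDr -{1}(subrK b a); exact: (dual_normD normN lo0 rho).
have K : dual_norm N (u - v) < e.
  apply: le_lt_trans (rho _).2 _.
  by move: uv; rewrite ltr_pdivlMr// mulrC.
rewrite ltr_norml; apply/andP; split; last exact: le_lt_trans (H _ _) K.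
rewrite ltrNl opprB; apply: le_lt_trans (H _ _) _.
by rewrite (dual_normB normN lo0 rho).
Qed.

Lemma grad_continuous f : twice_differentiable f -> continuous (grad f).
Proof. by move=> df u; apply: differentiable_continuous; case: (df u). Qed.

Lemma line_continuous y w : continuous (fun t => y + t *: w).
Proof.
move=> t; apply: cvgD; first exact: cvg_cst.
by apply: cvgZr_tmp; exact: cvg_id.
Qed.

Lemma dual_grad_line_max f y w : twice_differentiable f ->
  exists2 c, 0 <= c <= 1 & forall t, 0 <= t <= 1 ->
    dual_norm N (grad f (y + t *: w)) <= dual_norm N (grad f (y + c *: w)).
Proof.
move=> df.
have [|c c01 H] := @EVT_max R (fun t => dual_norm N (grad f (y + t *: w))) 0 1 ler01.
  apply: continuous_subspaceT => t.
  apply: (@continuous_comp _ _ _ (fun t => grad f (y + t *: w)) (dual_norm N)).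
    apply: (@continuous_comp _ _ _ (fun t => y + t *: w) (grad f)).
      exact: line_continuous.
    exact: grad_continuous.
  exact: dual_norm_continuous.
exists c; first by move: c01; rewrite in_itv.
by move=> t t01; apply: H; rewrite in_itv.
Qed.

(* Evaluating the Lipschitz estimate at a maximizer of the gradient norm bounds
   the local Lipschitz constant [c] by itself, with a factor [L1 * N w < 1]. *)
Lemma symmetric_smooth_line (L0 L1 : R) f y w :
  0 <= L0 -> 0 <= L1 -> twice_differentiable f -> symmetric_smooth N L0 L1 f ->
  L1 * N w < 1 ->
  exists c, [/\ 0 <= c,
    c <= (L0 + L1 * dual_norm N (grad f y)) / (1 - L1 * N w) &
    forall s t, 0 <= s -> s <= t -> t <= 1 ->
      dual_norm N (grad f (y + t *: w) - grad f (y + s *: w))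
        <= c * (t - s) * N w].
Proof.
move=> L00 L10 df [_ smf] Lw.
have [k k01 kmax] := dual_grad_line_max y w df.
set M := dual_norm N (grad f (y + k *: w)) in kmax.
have M0 : 0 <= M by exact: (dual_norm_ge0 lo0 rho).
have lip s t : 0 <= s -> s <= t -> t <= 1 ->
    dual_norm N (grad f (y + t *: w) - grad f (y + s *: w))
      <= (L0 + L1 * M) * (t - s) * N w.
  move=> s0 st t1; rewrite -lee_fin; apply: (le_trans (smf _ _)).
  have -> : (y + t *: w) - (y + s *: w) = (t - s) *: w.
    by rewrite opprD addrACA subrr add0r scalerBl.
  rewrite (is_norm_scale normN) ger0_norm ?subr_ge0// -mulrA [leRHS]EFinM.
  apply: lee_wpmul2r.
    by rewrite lee_fin mulr_ge0 ?(is_norm_ge0 normN)// subr_ge0.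
  rewrite [leRHS]EFinD leeD2l// [leRHS]EFinM; apply: lee_wpmul2l; first by rewrite lee_fin.
  apply: ge_ereal_sup => z [r /=]; rewrite in_itv/= => /andP[r0 r1] <- {z}.
  rewrite lee_fin.
  have -> : r *: (y + t *: w) + (1 - r) *: (y + s *: w) =
      y + (r * t + (1 - r) * s) *: w.
    rewrite !scalerDr !scalerA addrACA -scalerDl [_ + (1 - r)]addrC subrK.
    by rewrite scale1r -scalerDl.
  by apply: kmax; apply/andP; split; nra.
exists (L0 + L1 * M); split => //.
- by rewrite addr_ge0// mulr_ge0.
- rewrite ler_pdivlMr ?subr_gt0//.
  have /andP[k0 k1] := k01.
  have := lip 0 k (lexx _) k0 k1; rewrite scale0r addr0 subr0 => H.
  have Mg : M <= dual_norm N (grad f y) + (L0 + L1 * M) * N w.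
    rewrite /M -{1}(subrK (grad f y) (grad f (y + k *: w))).
    apply: (le_trans (dual_normD normN lo0 rho _ _)); rewrite addrC lerD2l.
    apply: (le_trans H); rewrite -mulrA ler_wpM2l ?addr_ge0 ?mulr_ge0//.
    by rewrite ler_piMl// (is_norm_ge0 normN).
  have := ler_wpM2l L10 Mg; rewrite -/M; lra.
Qed.

Lemma descent (L0 L1 : R) f y w :
  0 <= L0 -> 0 <= L1 -> twice_differentiable f -> symmetric_smooth N L0 L1 f ->
  L1 * N w < 1 ->
  f (y + w) <= f y + dot (grad f y) w +
    (L0 + L1 * dual_norm N (grad f y)) / (1 - L1 * N w) * N w ^+ 2 / 2.
Proof.
move=> L00 L10 df smf Lw.
have [c [c0 cle lip]] := symmetric_smooth_line y L00 L10 df smf Lw.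
apply: (@le_trans _ _ (f y + dot (grad f y) w + c * N w ^+ 2 / 2)); last first.
  by rewrite lerD2l ler_wpM2r// ler_wpM2r// sqr_ge0.
(* The excess of [f] over the quadratic model along the segment. The Lipschitz estimate makes its
   derivative nonpositive, so the mean value theorem replaces an integration of the gradient. *)
pose psi t := f (y + t *: w) - (t * dot (grad f y) w + c * N w ^+ 2 / 2 * t ^+ 2).
pose dpsi t := dot (grad f (y + t *: w)) w
  - (dot (grad f y) w + c * N w ^+ 2 * t).
have dp t : is_derive t (1 : R) psi (dpsi t).
  have -> : psi = (fun s => f (y + s *: w)) - ((dot (grad f y) w) *: id
      + (c * N w ^+ 2 / 2) *: (id ^+ 2)).
    apply/funext => s; rewrite /psi; congr (_ - (_ + _)).
    by rewrite mulrC.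
  have d1 : is_derive t (1 : R) (fun s => f (y + s *: w))
      (dot (grad f (y + t *: w)) w).
    by apply: is_derive_line_dot; case: (df (y + t *: w)).
  have d2 : is_derive t (1 : R) (dot (grad f y) w *: id
      + (c * N w ^+ 2 / 2) *: (id ^+ 2)) (dot (grad f y) w + c * N w ^+ 2 * t).
    have -> : c * N w ^+ 2 * t = 2 * (c * N w ^+ 2 / 2) * t by field.
    exact: is_derive_quadratic.
  exact: (is_deriveB d1 d2).
have [|t] := @MVT R psi dpsi 0 1 ltr01 (fun t _ => dp t).
  by apply: derivable_within_continuous => t _; case: (dp t).
rewrite in_itv /= => /andP[t0 t1]; rewrite subr0 mulr1 /psi scale1r scale0r.
rewrite addr0 => H.
suff : dpsi t <= 0 by move: H; set X := dpsi t; lra.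
rewrite /dpsi.
have := dot_le_dual normN lo0 rho (grad f (y + t *: w) - grad f y) w.
rewrite dotBl => H1.
have := lip 0 t (lexx _) (ltW t0) (ltW t1); rewrite scale0r addr0 subr0 => H2.
have := ler_wpM2r (is_norm_ge0 normN w) H2; nra.
Qed.

(** Applied to the objective, this bounds the mean of the sample Hessians along the segment;
    together with the Hessian variance it bounds their second moments uniformly in [t]. The endpoint
    [t = 1] is left out because the derivative is estimated from the right. *)
Lemma hess_line_le (L0 L1 : R) f y w :
  0 <= L0 -> 0 <= L1 -> twice_differentiable f -> symmetric_smooth N L0 L1 f ->
  L1 * N w < 1 ->
  exists C, forall t i, 0 <= t -> t < 1 ->
    `|(w *m hess f (y + t *: w)) ord0 i| <= C.
Proof.
move=> L00 L10 df smf Lw.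
have [c [c0 _ lip]] := symmetric_smooth_line y L00 L10 df smf Lw.
exists (c * N w / rho_lo) => t i t0 t1.
have dg : differentiable (grad f) (y + t *: w) by case: (df (y + t *: w)).
apply: (right_lipschitz_derive (is_derive_line_hess i dg) t1) => s ts s1.
have := coord_le_norm2 (grad f (y + s *: w) - grad f (y + t *: w)) i.
rewrite !mxE => /le_trans; apply.
rewrite mulrAC ler_pdivlMr// mulrC.
apply: (le_trans (rho _).1); apply: (le_trans (lip _ _ t0 ts s1)).
by rewrite mulrAC.
Qed.

End Calculus.

(** * Borel measurability of row-vector valued maps *)

Section BorelRowVectors.
Context {R : realType} {n : nat}.

(** The grid is indexed by integer vectors, a countable type, so that measurability questions reduce
    to countable unions over cells. *)
Definition grid_point (m : nat) (k : 'rV[int]_n) : 'rV[R]_n :=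
  \row_i ((k ord0 i)%:~R / m.+1%:R).

Definition grid_floor (m : nat) (v : 'rV[R]_n) : 'rV[int]_n :=
  \row_i Num.floor (m.+1%:R * v ord0 i).

Lemma grid_floor_dist m (v : 'rV[R]_n) i :
  `|v ord0 i - grid_point m (grid_floor m v) ord0 i| < m.+1%:R^-1.
Proof.
rewrite !mxE; have m0 : 0 < m.+1%:R :> R by [].
have /andP[fl lf] := floor_itv (m.+1%:R * v ord0 i).
set z := (Num.floor _)%:~R in fl *; move: lf; rewrite intrD -/z => lf.
rewrite ger0_norm; last by rewrite subr_ge0 ler_pdivrMr// mulrC.
by rewrite ltrBlDr -[X in X + _]mul1r -mulrDl ltr_pdivlMr// mulrC addrC.
Qed.

Lemma ball_rV (v u : 'rV[R]_n) (e : R) :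
  (forall i, `|v ord0 i - u ord0 i| < e) -> 0 < e -> ball v e u.
Proof. by move=> H e0; split => // i j; rewrite ord1; exact: H. Qed.

Lemma cvg_grid_floor (v : 'rV[R]_n) : grid_point m (grid_floor m v) @[m --> \oo] --> v.
Proof.
apply/cvg_ballP => e e0.
near=> m; apply: ball_rV => // i; apply: (lt_le_trans (grid_floor_dist _ _ _)).
apply/ltW; near: m; exact: (near_infty_natSinv_lt (PosNum e0)).
Unshelve. all: by end_near. Qed.

(** The Borel sets are generated by the open sets, and an open set is the countable union of the
    grid boxes that it contains; the preimage of a box is a finite intersection of conditions on
    coordinates. *)
Lemma measurable_fun_rV d (T : measurableType d) (g : T -> 'rV[R]_n) :
  (forall i, measurable_fun setT (fun t => g t ord0 i)) ->
  measurable_fun setT (g : T -> borel_rV R n).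
Proof.
move=> mg.
apply: (@measurability _ _ T (borel_rV R n) setT g [set A : set 'rV[R]_n | open A]) => //.
move=> _ [A oA <-]; rewrite setTI.
pose box (km : 'rV[int]_n * nat) := [set v : 'rV[R]_n |
  forall i, `|grid_point km.2 km.1 ord0 i - v ord0 i| < km.2.+1%:R^-1].
pose B km := if `[< box km `<=` A >] then g @^-1` box km else set0.
have -> : g @^-1` A = \bigcup_km B km.
  apply/seteqP; split => t; last first.
    by move=> [km _]; rewrite /B; case: ifPn => // /asboolP + bt; apply.
  move=> At; have [e /= e0 eA] : nbhs_ball (g t) A.
    by apply/nbhs_ballP; apply: open_nbhs_nbhs.
  (* Two mesh widths fit into [e]: one from [g t] to the centre of its box, one from the centre to
     another point of the box. *)
  have [m me] : exists m, m.+1%:R^-1 < e / 2.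
    have e20 : 0 < e / 2 by rewrite divr_gt0.
    by have [m _ H] := near_infty_natSinv_lt (PosNum e20); exists m; exact: H m (leqnn _).
  exists (grid_floor m (g t), m) => //; rewrite /B; case: ifPn => [_ i|/asboolPn[]].
    by rewrite /= distrC; exact: grid_floor_dist.
  move=> v /= bv; apply: eA; apply: ball_rV => // i.
  have /= := bv i; have := grid_floor_dist m (g t) i.
  set x := g t ord0 i; set y := grid_point _ _ _ _; set z := v ord0 i => xy yz.
  apply: (le_lt_trans (ler_distD y x z)); apply: (lt_trans (ltrD xy yz)).
  by rewrite (splitr e); exact: (ltrD me me).
apply: countable_bigcupT_measurable => //.
move=> km; rewrite /B; case: ifPn => _; last exact: measurable0.
have -> : g @^-1` box km = \bigcap_(i in [set: 'I_n])
    [set t | `|grid_point km.2 km.1 ord0 i - g t ord0 i| < km.2.+1%:R^-1].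
  by apply/seteqP; split => t /= H i; [move=> _|]; exact: H.
apply: fin_bigcap_measurable => [|i _]; first exact: finite_finset.
rewrite -[X in measurable X]setTI.
apply: (@measurable_fun_ltr _ _ _ setT
  (fun t => `|grid_point km.2 km.1 ord0 i - g t ord0 i|)
  (fun=> km.2.+1%:R^-1)) => //.
by apply: measurableT_comp => //; exact: measurable_funB.
Qed.

Lemma continuous_measurable_rV (f : 'rV[R]_n -> R) :
  continuous f -> measurable_fun setT (f : borel_rV R n -> R).
Proof.
move=> cf; apply: (measurability _ (RGenOpens.measurableE R)).
move=> _ [_ [a [b ->]] <-]; rewrite setTI.
by apply: sub_sigma_algebra; move/continuousP : cf; apply; exact: interval_open.
Qed.

Lemma measurable_coord_rV d (T : measurableType d) (g : T -> 'rV[R]_n) i :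
  measurable_fun setT (g : T -> borel_rV R n) ->
  measurable_fun setT (fun t => g t ord0 i).
Proof.
move=> mg; apply: (@measurableT_comp _ _ _ _ _ _
  ((fun v : 'rV[R]_n => v ord0 i) : borel_rV R n -> R)) => //.
by apply: continuous_measurable_rV; exact: coord_continuous.
Qed.

(** Once [Z] is rounded to the grid, the composite is measurable on each of countably many cells;
    continuity in the second argument passes to the limit of vanishing mesh. *)
Lemma caratheodory_measurable d d' (T : measurableType d) (S : measurableType d')
    (G : S -> 'rV[R]_n -> R) (xi : T -> S) (Z : T -> 'rV[R]_n) :
  (forall z, measurable_fun setT (G ^~ z)) -> (forall s, continuous (G s)) ->
  measurable_fun setT xi -> measurable_fun setT (Z : T -> borel_rV R n) ->
  measurable_fun setT (fun t => G (xi t) (Z t)).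
Proof.
move=> mG cG mxi mZ.
apply: (@measurable_fun_cvg _ _ _ _
  (fun m t => G (xi t) (grid_point m (grid_floor m (Z t))))); last first.
  move=> t _; apply: (@cvg_comp _ _ _
    (fun m => grid_point m (grid_floor m (Z t))) (G (xi t)) _ (nbhs (Z t))).
    exact: cvg_grid_floor.
  exact: cG.
move=> m _ Y mY; rewrite setTI.
have -> : (fun t => G (xi t) (grid_point m (grid_floor m (Z t)))) @^-1` Y =
  \bigcup_(k : 'rV[int]_n) ([set t | grid_floor m (Z t) = k] `&`
    xi @^-1` (G ^~ (grid_point m k) @^-1` Y)).
  apply/seteqP; split => [t Yt|t [k _ [<-]]//].
  by exists (grid_floor m (Z t)).
apply: countable_bigcupT_measurable => // k; apply: measurableI; last first.
  rewrite -[X in measurable X]setTI; apply: mxi => //.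
  by rewrite -[X in measurable X]setTI; exact: mG.
have -> : [set t | grid_floor m (Z t) = k] = \bigcap_(i in [set: 'I_n])
   [set t | (k ord0 i)%:~R <= m.+1%:R * Z t ord0 i < (k ord0 i + 1)%:~R].
  apply/seteqP; split => t /=.
    by move=> <- i _; rewrite mxE; exact: floor_itv.
  move=> H; apply/rowP => i; rewrite mxE; apply/floor_def; exact: H.
apply: fin_bigcap_measurable => [|i _]; first exact: finite_finset.
have mc : measurable_fun setT (fun t => m.+1%:R * Z t ord0 i).
  by apply: measurable_funM => //; exact: measurable_coord_rV.
have -> : [set t | (k ord0 i)%:~R <= m.+1%:R * Z t ord0 i < (k ord0 i + 1)%:~R]
   = setT `&` (fun t => m.+1%:R * Z t ord0 i) @^-1` `[(k ord0 i)%:~R, (k ord0 i + 1)%:~R[.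
  by rewrite setTI; apply/seteqP; split => t /=; rewrite in_itv.
by apply: mc => //; exact: measurable_itv.
Qed.

End BorelRowVectors.

(** * Expectations under a centred perturbation *)

Section Expectation.
Context {R : realType} {d : measure_display} {T : measurableType d}.
Variable P : probability T R.

Lemma has_expectation_cst (m n : nat) (M : 'M[R]_(m, n)) :
  has_expectation P (fun=> M) M.
Proof.
move=> i j; split; first exact: finite_measure_integrable_cst.
by rewrite unlock integral_cst_probability.
Qed.

Lemma has_expectation_lin (m n : nat) (a b : R) (X Y : T -> 'M[R]_(m, n)) M M' :
  has_expectation P X M -> has_expectation P Y M' ->
  has_expectation P (fun s => a *: X s + b *: Y s) (a *: M + b *: M').
Proof.
move=> XM YM i j; have [iX EX] := XM i j; have [iY EY] := YM i j.
have E s : ((a *: X s + b *: Y s) i j)%:E =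
    (a%:E * (X s i j)%:E + b%:E * (Y s i j)%:E)%E by rewrite !mxE.
have iaX := integrableZl measurableT a iX.
have ibY := integrableZl measurableT b iY.
split; first by rewrite (funext E); exact: integrableD.
move: EX EY; rewrite !unlock => EX EY.
under eq_integral do rewrite E.
by rewrite integralD// !integralZl// EX EY !mxE.
Qed.

(* Minkowski's inequality in the plane, for the vectors (sqrt X, p) and (0, q),
   separates the part [q] of the conditional deviation that is proportional to
   the gradient norm from the constant part [p]. *)
Lemma integral_sqrt_norm2D (n : nat) (Y : T -> 'rV[R]_n) (v : 'rV[R]_n) (p q c : R) :
  has_expectation P Y 0 -> 0 <= p -> 0 <= q -> 0 <= c ->
  (\int[P]_s (norm2 (Y s) ^+ 2)%:E <= ((p + q) ^+ 2)%:E)%E ->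
  (\int[P]_s (Num.sqrt (norm2 (v + Y s) ^+ 2 + c))%:E <=
     (Num.sqrt (norm2 v ^+ 2 + p ^+ 2 + c) + q)%:E)%E.
Proof.
move=> Y0 p0 q0 c0 HY.
have mY i : measurable_fun setT (fun s => Y s ord0 i).
  by have [/measurable_int/measurable_EFinP mg _] := Y0 ord0 i.
have mh : measurable_fun setT (fun s => norm2 (v + Y s) ^+ 2 + c).
  apply: measurable_funD => //; under eq_fun do rewrite norm2_sqr.
  apply: measurable_sum => i.
  have mvY : measurable_fun setT (fun s => (v + Y s) ord0 i).
    by under eq_fun do rewrite mxE; exact: measurable_funD.
  exact: measurable_funM.
have h0 s : 0 <= norm2 (v + Y s) ^+ 2 + c by rewrite addr_ge0// sqr_ge0.
apply: (@le_trans _ _ (Num.sqrt (norm2 v ^+ 2 + (p + q) ^+ 2 + c))%:E).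
  apply: integral_sqrt_le => //; first by rewrite !addr_ge0// sqr_ge0.
  under eq_integral do rewrite EFinD.
  rewrite ge0_integralD//; last 2 first.
  - by move=> s _; rewrite lee_fin sqr_ge0.
  - apply/measurable_EFinP; have := measurable_funB mh (measurable_cst c).
    by apply: eq_measurable_fun => s _; rewrite /= addrK.
  rewrite integral_cst_probability [leRHS]EFinD leeD2r//.
  under eq_integral do rewrite addrC.
  rewrite (integral_norm2D _ Y0) ?(le_lt_trans HY) ?ltry//.
  by rewrite dot0l mulr0 add0r addeC [leRHS]EFinD leeD2l.
rewrite lee_fin.
set X := norm2 v ^+ 2 + p ^+ 2 + c.
have X0 : 0 <= X by rewrite !addr_ge0// sqr_ge0.
(* This puts the cross term [2 * p * q] of [(p + q) ^+ 2] below the cross term [2 * sqrt X * q] of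
   the squared right-hand side. *)
have pX : p <= Num.sqrt X.
  rewrite -[p](ger0_norm p0) -sqrtr_sqr ler_sqrt// /X.
  by rewrite -addrA addrC -addrA lerDl addr_ge0// sqr_ge0.
rewrite -(@ger0_norm _ (Num.sqrt X + q)) ?addr_ge0 ?sqrtr_ge0//.
rewrite -sqrtr_sqr ler_sqrt ?sqr_ge0// [leRHS]sqrrD (sqr_sqrtr X0).
have := ler_wpM2r q0 pX; set r := Num.sqrt X; rewrite mulr2n /X; lra.
Qed.

End Expectation.

(** The Cauchy-Schwarz inequality on top of [derive_le_integral]; replacing [g] by [- g] gives the
    absolute value of the increment. The integral may be infinite. *)
Lemma derive_sqr_le_integral (R : realType) (g h : R -> R) (a b : R) :
  a <= b -> (forall t, t \in `[a, b] -> is_derive t 1 g (h t)) ->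
  measurable_fun setT h ->
  (((g b - g a) ^+ 2)%:E <=
     (b - a)%:E * \int[lebesgue_measure]_(t in `[a, b]) (h t ^+ 2)%:E)%E.
Proof.
move=> ab gh mh.
have mI : measurable (`[a, b]%classic : set R) by exact: measurable_itv.
have [abE|nab] := eqVneq a b.
  by rewrite -abE !subrr expr0n/= mul0e.
have L0 : 0 < b - a by rewrite subr_gt0 lt_neqAle nab.
have muI : lebesgue_measure (`[a, b]%classic : set R) = (b - a)%:E.
  by rewrite lebesgue_measure_itv /= lte_fin -subr_gt0 L0 EFinB.
set J := (X in (_ * X)%E).
have J0 : (0 <= J)%E by apply: integral_ge0 => t _; rewrite lee_fin sqr_ge0.
set X := `|g b - g a|.
have XI : (X%:E <= \int[lebesgue_measure]_(t in `[a, b]) `|h t|%:E)%E.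
  rewrite /X; have [g0|g0] := leP 0 (g b - g a).
    by rewrite ger0_norm//; exact: derive_le_integral.
  rewrite ltr0_norm// opprB.
  have := @derive_le_integral _ (- g) (- h) a b ab.
  rewrite -[(- g) b]/(- g b) -[(- g) a]/(- g a) opprK addrC => H.
  apply: le_trans (H _ _) _.
  - by move=> t tab; apply: is_deriveN; exact: gh.
  - exact: measurable_funN.
  - by under eq_integral do rewrite -[(- h) _]/(- h _) normrN.
rewrite -real_normK ?num_real// -/X.
have [X0|Xn0] := eqVneq X 0.
  by rewrite X0 expr0n /= mule_ge0// lee_fin ltW.
have Xp : 0 < X by rewrite lt_neqAle eq_sym Xn0 normr_ge0.
have [Joo|Jfin] := eqVneq J +oo%E.
  by rewrite Joo gt0_muley ?lte_fin// leey.
have JE : J = (fine J)%:E by rewrite fineK// ge0_fin_numE// ltey.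
rewrite JE -EFinM lee_fin.
(* The mean slope, at which |h| <= c / 2 + h^2 / (2 c) integrates to the Cauchy-Schwarz bound
   without loss. *)
set c := X / (b - a); have c0 : 0 < c by rewrite divr_gt0.
have mh2 : measurable_fun setT (fun t => (h t ^+ 2)%:E).
  by apply/measurable_EFinP; exact: measurable_funX.
have : (X%:E <= (c / 2 * (b - a) + (2 * c)^-1 * fine J)%:E)%E.
  apply: (le_trans XI).
  have -> : ((c / 2 * (b - a) + (2 * c)^-1 * fine J)%:E =
     \int[lebesgue_measure]_(t in `[a, b]) ((c / 2)%:E + (2 * c)^-1%:E * (h t ^+ 2)%:E))%E.
    rewrite ge0_integralD//; last 3 first.
    - by move=> t _; rewrite lee_fin divr_ge0// ltW.
    - by move=> t _; rewrite -EFinM lee_fin mulr_ge0 ?sqr_ge0// invr_ge0 mulr_ge0// ltW.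
    - by apply: measurable_funTS; exact: measurable_funeM.
    rewrite ge0_integralZl//; last 3 first.
    - exact: measurable_funTS.
    - by move=> t _; rewrite lee_fin sqr_ge0.
    - by rewrite lee_fin invr_ge0 mulr_ge0// ltW.
    rewrite integral_cst// [X in (_ * X + _)%E](_ : _ = (b - a)%:E); last exact: muI.
    by rewrite -/J {2}JE -!EFinM -EFinD.
  apply: ge0_le_integral => //.
  - apply/measurable_EFinP; apply: measurable_funTS.
    by apply: measurableT_comp => //; exact: normr_measurable.
  - apply: measurable_funTS; apply: emeasurable_funD; first exact: measurable_cst.
    exact: measurable_funeM.
  - move=> t _; rewrite -EFinM -EFinD lee_fin -[h t ^+ 2]real_normK ?num_real//.
    rewrite -subr_ge0.
    have -> : c / 2 + (2 * c)^-1 * `|h t| ^+ 2 - `|h t| = (`|h t| - c) ^+ 2 / (2 * c).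
      by field; rewrite gt_eqF.
    by rewrite divr_ge0 ?sqr_ge0// mulr_ge0// ltW.
rewrite lee_fin {1}/c => H.
have : X * (2 * X) <= X * (2 * X) / 2 + (b - a) * fine J.
  have := ler_wpM2r (ltW (mulr_gt0 (ltr0n R 2) Xp)) H.
  have -> : (X / (b - a) / 2 * (b - a) + (2 * c)^-1 * fine J) * (2 * X) =
     X * (2 * X) / 2 + (b - a) * fine J.
    by rewrite /c; field; rewrite !gt_eqF.
  by [].
by nra.
Qed.

(** * Mean-square smoothness of the sample gradients *)

Section StochasticSmoothness.
Context {R : realType} {n : nat} {d : measure_display} {S : measurableType d}.
Variables (D : probability S R) (F : S -> 'rV[R]_n -> R).
Variables (N : 'rV[R]_n -> R) (rho_lo rho_hi sigma_g sigma_H L0 L1 LL0 LL1 : R).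
Hypotheses (normN : is_norm N) (lo0 : 0 < rho_lo) (hi0 : 0 < rho_hi).
Hypothesis rho : forall v : 'rV[R]_n,
  rho_lo * norm2 v <= dual_norm N v /\ dual_norm N v <= rho_hi * norm2 v.
Hypothesis ubv : unbiased_bounded_variance D F sigma_g sigma_H.
Let f := objective D F.

Lemma measurable_grad_sample z i : measurable_fun setT (fun s => grad (F s) z ord0 i).
Proof.
have [/measurable_int/measurable_EFinP mg _] := ubv_grad_mean ubv z ord0 i.
exact: mg.
Qed.

Lemma measurable_grad d' (T : measurableType d') (xi : T -> S) (Z : T -> 'rV[R]_n) :
  measurable_fun setT xi -> measurable_fun setT (Z : T -> borel_rV R n) ->
  measurable_fun setT ((fun t => grad (F (xi t)) (Z t)) : T -> borel_rV R n).
Proof.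
move=> mxi mZ; apply: measurable_fun_rV => i.
apply: (@caratheodory_measurable _ _ _ _ _ _ (fun s z => grad (F s) z ord0 i)) => //.
  by move=> z; exact: measurable_grad_sample.
move=> s z.
apply: (@continuous_comp _ _ _ (grad (F s)) (fun v : 'rV[R]_n => v ord0 i)).
  exact: (grad_continuous (ubv_sample_diff ubv s)).
exact: coord_continuous.
Qed.

(** Joint measurability in the sample and the parameter, as Tonelli's theorem requires: the Hessian
    applied to [w] is the pointwise limit of difference quotients, with steps [m.+1%:R^-1], of
    gradients that are jointly measurable by [caratheodory_measurable]. *)
Lemma measurable_hess_line (y w : 'rV[R]_n) i :
  measurable_fun setT
    (fun p : S * R => (w *m hess (F p.1) (y + p.2 *: w)) ord0 i).
Proof.
pose G c (p : S * R) := grad (F p.1) (y + (p.2 + c) *: w) ord0 i.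
have mG c : measurable_fun setT (G c).
  apply: measurable_coord_rV; apply: measurable_grad; first exact: measurable_fst.
  apply: measurable_fun_rV => j.
  under eq_fun do rewrite !mxE.
  apply: measurable_funD => //; apply: measurable_funM => //.
  by apply: measurable_funD => //; exact: measurable_snd.
apply: (@measurable_fun_cvg _ _ _ _
  (fun m p => m.+1%:R * (G (m.+1%:R^-1) p - G 0 p))).
  by move=> m; apply: measurable_funM => //; exact: measurable_funB.
move=> [s t] _ /=.
have dg : differentiable (grad (F s)) (y + t *: w).
  by have [] := ubv_sample_diff ubv s (y + t *: w).
have [dl <-] := is_derive_line_hess i dg.
have cv : (fun h : R => h^-1 *: (grad (F s) (y + (h + t) *: w) ord0 i
   - grad (F s) (y + t *: w) ord0 i)) @ (0 : R)^'+ -->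
   'D_1 (fun s0 : R => grad (F s) (y + s0 *: w) ord0 i) t.
  apply: cvg_dnbhs_at_right; rewrite /derive.
  by move: dl; rewrite /derivable; under eq_fun do rewrite /= scaler1.
have := (cvg_at_rightP _ _ _).1 cv (fun m => m.+1%:R^-1).
rewrite /G /= addr0.
have -> : (fun m => m.+1%:R * (grad (F s) (y + (t + m.+1%:R^-1) *: w) ord0 i -
     grad (F s) (y + t *: w) ord0 i)) =
  (fun m : nat => (m.+1%:R^-1)^-1 *: (grad (F s) (y + (m.+1%:R^-1 + t) *: w) ord0 i -
     grad (F s) (y + t *: w) ord0 i)).
  by apply/funext => m; rewrite invrK [t + _]addrC.
by apply; split => //; exact: cvg_harmonic.
Qed.
Lemma integral_hess_line (y w : 'rV[R]_n) (C : R) t i :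
  `|(w *m hess f (y + t *: w)) ord0 i| <= C ->
  (\int[D]_s (((w *m hess (F s) (y + t *: w)) ord0 i) ^+ 2)%:E
     <= (2 * (sigma_H ^+ 2 * norm2 w ^+ 2) + 2 * C ^+ 2)%:E)%E.
Proof.
move=> hC; set z := y + t *: w.
have key (a b c C' : R) : `|b| <= C' -> `|a - b| <= c ->
    a ^+ 2 <= 2 * c ^+ 2 + 2 * C' ^+ 2.
  move=> bC ac.
  have := lerXn2r 2 (normr_ge0 _) (le_trans (normr_ge0 _) ac) ac.
  have := lerXn2r 2 (normr_ge0 _) (le_trans (normr_ge0 _) bC) bC.
  by rewrite !real_normK ?num_real//; have := sqr_ge0 (a - 2 * b); nra.
pose e s := w *m (hess (F s) z - hess f z).
have me : measurable_fun setT (fun s => norm2 (e s) ^+ 2).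
  under eq_fun do rewrite norm2_sqr.
  have mej j : measurable_fun setT (fun s => e s ord0 j).
    have eE s : e s ord0 j = \sum_k w ord0 k * (hess (F s) z k j - hess f z k j).
      rewrite /e mxE; apply: eq_bigr => k _.
      by rewrite mxBE.
    rewrite (funext eE); apply: measurable_sum => k.
    apply: measurable_funM => //; apply: measurable_funB => //.
    by have [/measurable_int/measurable_EFinP mg _] := ubv_hess_mean ubv z k j.
  by apply: measurable_sum => j; exact: measurable_funM.
apply: (@le_trans _ _ (\int[D]_s (2%:E * (norm2 (e s) ^+ 2)%:E + (2 * C ^+ 2)%:E))%E).
  apply: integral_mono => s; first by rewrite lee_fin sqr_ge0.
  rewrite -EFinM -EFinD lee_fin; apply: key hC _.
  by rewrite -mxBE -mulmxBr; exact: coord_le_norm2.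
rewrite ge0_integralD//; last 3 first.
- by move=> s _; rewrite -EFinM lee_fin mulr_ge0// sqr_ge0.
- by apply: measurable_funeM; exact/measurable_EFinP.
- by move=> s _; rewrite lee_fin mulr_ge0// sqr_ge0.
rewrite ge0_integralZl//; last 2 first.
- exact/measurable_EFinP.
- by move=> s _; rewrite lee_fin sqr_ge0.
rewrite integral_cst_probability [leRHS]EFinD leeD2r// [leRHS]EFinM lee_wpmul2l//.
by have := ubv_hess_var ubv z w; rewrite unlock.
Qed.

(* The second-moment bound on Hessians makes the increments of the sample
   gradients on a segment square-integrable uniformly in the point, which is
   what allows the supremum in (A5) to be localised. *)
Lemma grad_increment_bound (y w : 'rV[R]_n) (C : R) (a b : R) :
  (forall t i, 0 <= t -> t < 1 -> `|(w *m hess f (y + t *: w)) ord0 i| <= C) ->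
  0 <= a -> a <= b -> b <= 1 ->
  exists V : S -> \bar R, [/\ measurable_fun setT V, (forall s, 0 <= V s)%E,
    (\int[D]_s V s <= (n%:R * (2 * (sigma_H ^+ 2 * norm2 w ^+ 2) + 2 * C ^+ 2)
        * (b - a) ^+ 2)%:E)%E &
    forall s t, a <= t -> t <= b ->
      ((norm2 (grad (F s) (y + t *: w) - grad (F s) (y + a *: w)) ^+ 2)%:E
         <= V s)%E].
Proof.
move=> hC a0 ab b1; set H2 := 2 * _ + 2 * _.
have H20 : 0 <= H2 by rewrite addr_ge0// mulr_ge0// ?sqr_ge0// mulr_ge0 ?sqr_ge0.
pose h i s t := (w *m hess (F s) (y + t *: w)) ord0 i.
(* Half-open because [hC] excludes the parameter 1 and [b] may equal 1; the missing endpoint is a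
   null set. *)
pose I : set R := `[a, b[%classic.
have mI : measurable I by exact: measurable_itv.
have muI : lebesgue_measure I = (b - a)%:E.
  rewrite /I lebesgue_measure_itv /= lte_fin.
  move: ab; rewrite le_eqVlt => /predU1P[->|->]; last by rewrite EFinB.
  by rewrite ltxx subrr.
pose phi i (p : S * R) : \bar R := (h i p.1 p.2 ^+ 2 * \1_I p.2)%:E.
have mphi i : measurable_fun setT (phi i).
  apply/measurable_EFinP; apply: measurable_funM.
    by apply: measurable_funX; exact: measurable_hess_line.
  apply: (@measurableT_comp _ _ _ _ _ _ (\1_I : R -> R)); last exact: measurable_snd.
  exact: measurable_indic.
have phi0 i p : (0 <= phi i p)%E by rewrite lee_fin mulr_ge0// sqr_ge0.
pose U i s := (\int[lebesgue_measure]_t phi i (s, t))%E.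
have mU i : measurable_fun setT (U i).
  exact: (@measurable_fun_fubini_tonelli_F _ _ _ _ _ lebesgue_measure (phi i)
    (mphi i) (phi0 i)).
have U0 i s : (0 <= U i s)%E by exact: integral_ge0.
have intU i : (\int[D]_s U i s <= (H2 * (b - a))%:E)%E.
  rewrite /U (@fubini_tonelli _ _ _ _ _ D lebesgue_measure (phi i) (mphi i) (phi0 i)).
  apply: (@le_trans _ _ (\int[lebesgue_measure]_t (H2%:E * (\1_I t)%:E))%E).
    apply: integral_mono => t; first exact: integral_ge0.
    rewrite /phi /=; under eq_integral do rewrite mulrC EFinM.
    rewrite ge0_integralZl//; last 2 first.
    - apply/measurable_EFinP; apply: measurable_funX.
      have mh := measurable_hess_line y w i.
      exact: (measurableT_comp mh (measurable_pair2 t)).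
    - by move=> s _; rewrite lee_fin sqr_ge0.
    rewrite muleC indicE; case: (boolP (t \in I)) => [|_]; last by rewrite !mule0.
    rewrite inE /I /= in_itv/= => /andP[at_ tb]; rewrite !mule1.
    apply: integral_hess_line; apply: hC; first exact: le_trans at_.
    exact: lt_le_trans b1.
  rewrite ge0_integralZl//; last first.
    by apply/measurable_EFinP; exact: measurable_indic.
  rewrite integral_indic// setIT EFinM.
  by rewrite [X in (_ * X)%E](_ : _ = (b - a)%:E).
(* One factor [b - a] comes from the Cauchy-Schwarz inequality, the other from integrating a bounded
   second moment over [I]. [V s] does not depend on [t], so the square of the oscillation is
   dominated before taking the expectation. *)
exists (fun s => (b - a)%:E * \sum_(i < n) U i s)%E; split.
- by apply: measurable_funeM; exact: emeasurable_sum.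
- by move=> s; rewrite mule_ge0 ?lee_fin ?subr_ge0// sume_ge0.
- rewrite ge0_integralZl//; last 3 first.
  + exact: emeasurable_sum.
  + by move=> s _; exact: sume_ge0.
  + by rewrite lee_fin subr_ge0.
  rewrite ge0_integral_sum//.
  have -> : n%:R * H2 * (b - a) ^+ 2 = (b - a) * (\sum_(i < n) (H2 * (b - a))).
    by rewrite sumr_const card_ord -mulr_natl; ring.
  rewrite EFinM; apply: lee_wpmul2l; first by rewrite lee_fin subr_ge0.
  by rewrite -sumEFin; exact: lee_sum.
- move=> s t at_ tb; rewrite norm2_sqr /dot -sumEFin.
  rewrite ge0_sume_distrr//; apply: lee_sum => i _.
  rewrite -expr2 mxBE.
  have mh : measurable_fun setT (h i s).
    exact: (measurableT_comp (measurable_hess_line y w i) (measurable_pair1 s)).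
  have mhE : measurable_fun setT (fun r => (h i s r ^+ 2)%:E).
    by apply/measurable_EFinP; exact: measurable_funX.
  have gh r : r \in `[a, t] ->
      is_derive r (1 : R) (fun r => grad (F s) (y + r *: w) ord0 i) (h i s r).
    move=> _; apply: is_derive_line_hess.
    by have [] := ubv_sample_diff ubv s (y + r *: w).
  apply: (le_trans (derive_sqr_le_integral at_ gh mh)).
  apply: lee_pmul.
  + by rewrite lee_fin subr_ge0.
  + by apply: integral_ge0 => r _; rewrite lee_fin sqr_ge0.
  + by rewrite lee_fin lerD2r.
  rewrite -integral_itv_bndo_bndc; last exact: measurable_funTS.
  rewrite /U integral_mkcond.
  apply: integral_mono => r; rewrite /patch.
    by case: ifP => // _; rewrite lee_fin sqr_ge0.
  rewrite /phi /= indicE.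
  case: ifP => [|_]; last by rewrite lee_fin mulr_ge0// sqr_ge0.
  rewrite inE /= in_itv /= => /andP[ar rt].
  have rI : r \in I by rewrite inE /I /= in_itv /= ar (lt_le_trans rt tb).
  by rewrite rI mulr1.
Qed.

Lemma measurable_dual_diff z z' :
  measurable_fun setT (fun s => dual_norm N (grad (F s) z - grad (F s) z')).
Proof.
apply: (@measurableT_comp _ _ _ _ (borel_rV R n) _ (dual_norm N) _
  (fun s => grad (F s) z - grad (F s) z')).
  apply: continuous_measurable_rV.
  exact: (dual_norm_continuous normN lo0 hi0 rho).
apply: measurable_fun_rV => i; under eq_fun do rewrite mxBE.
by apply: measurable_funB => //; exact: measurable_grad_sample.
Qed.

Lemma measurable_norm2_sample z v :
  measurable_fun setT (fun s => norm2 (grad (F s) z - v)).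
Proof.
apply: (@measurableT_comp _ _ _ _ (borel_rV R n) _ (@norm2 R n) _
  (fun s => grad (F s) z - v)).
  by apply: continuous_measurable_rV; exact: norm2_continuous.
apply: measurable_fun_rV => i; under eq_fun do rewrite mxBE.
by apply: measurable_funB => //; exact: measurable_grad_sample.
Qed.

Hypotheses (sg0 : 0 <= sigma_g) (LL00 : 0 <= LL0) (LL10 : 0 <= LL1).
Hypothesis mss : mean_squared_symmetric_smooth D N LL0 LL1 F.

(** A bound for the L2 norm of [LL0 + LL1 * dual_norm N (grad (F s) y)], from the mean gradient and
    its standard deviation. *)
Let A y := LL0 + LL1 * (dual_norm N (grad f y) + rho_hi * sigma_g).

(** On the piece from [a] to [b], the sample gradient at any point is the one at [y], plus the
    increment up to [a], of L2 norm at most [p], plus an oscillation dominated by [sqrte (V s)]. The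
    supremum inside the expectation is thus below a sum of measurable functions of the sample, to
    which Minkowski's inequality applies: [B1] collects what belongs to [y], [B2] the
    displacement. *)
Lemma mss_step (y w : 'rV[R]_n) (C a b p Q : R) :
  (forall t i, 0 <= t -> t < 1 -> `|(w *m hess f (y + t *: w)) ord0 i| <= C) ->
  0 <= a -> a <= b -> b <= 1 -> 0 <= p -> 0 <= Q ->
  n%:R * (2 * (sigma_H ^+ 2 * norm2 w ^+ 2) + 2 * C ^+ 2) * (b - a) ^+ 2
    <= Q ^+ 2 ->
  (\int[D]_s (dual_norm N (grad (F s) (y + a *: w) - grad (F s) y) ^+ 2)%:E
     <= (p ^+ 2)%:E)%E ->
  (\int[D]_s (dual_norm N (grad (F s) (y + b *: w) - grad (F s) y) ^+ 2)%:E
     <= ((p + (b - a) * N w * (A y + LL1 * p + LL1 * rho_hi * Q)) ^+ 2)%:E)%E.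
Proof.
move=> hC a0 ab b1 p0 Q0 HQ Hp.
have [V [mV V0 intV incV]] := grad_increment_bound hC a0 ab b1.
pose g := dual_norm N (grad f y).
have g0 : 0 <= g by exact: (dual_norm_ge0 lo0 rho).
have ba0 : 0 <= b - a by rewrite subr_ge0.
have Nw0 : 0 <= N w by exact: (is_norm_ge0 normN).
have dn0 u : 0 <= dual_norm N u by exact: (dual_norm_ge0 lo0 rho).
have dnD u v : dual_norm N (u + v) <= dual_norm N u + dual_norm N v.
  exact: (dual_normD normN lo0 rho).
have E4 (k1 k2 k3 k4 : R) :
  ((k1 + k2 + (k3 + k4))%:E = k1%:E + k2%:E + (k3%:E + k4%:E))%E by [].
pose X1 s := (dual_norm N (grad (F s) (y + a *: w) - grad (F s) y))%:E.
pose X2 s := (dual_norm N (grad (F s) (y + b *: w) - grad (F s) (y + a *: w)))%:E.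
pose G s := (norm2 (grad (F s) y - grad f y))%:E.
have mX1 : measurable_fun setT X1 by exact/measurable_EFinP/measurable_dual_diff.
have mX2 : measurable_fun setT X2 by exact/measurable_EFinP/measurable_dual_diff.
have mG : measurable_fun setT G by exact/measurable_EFinP/measurable_norm2_sample.
have mr : measurable_fun setT (fun s => sqrte (V s)).
  have E s : sqrte (V s) = (V s `^ 2^-1)%E by rewrite poweR12_sqrt.
  rewrite (funext E).
  exact: (measurableT_comp (measurable_poweR _) mV).
pose B1 s := ((LL0 + LL1 * g)%:E + (LL1 * rho_hi)%:E * G s)%E.
pose B2 s := (LL1%:E * X1 s + (LL1 * rho_hi)%:E * sqrte (V s))%E.
have lr0 : 0 <= LL1 * rho_hi by rewrite mulr_ge0// ltW.
have mB1 : measurable_fun setT B1.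
  by apply: emeasurable_funD; [exact: measurable_cst|exact: measurable_funeM].
have mB2 : measurable_fun setT B2.
  by apply: emeasurable_funD; exact: measurable_funeM.
have G0 s : (0 <= G s)%E by rewrite lee_fin norm2_ge0.
have B10 s : (0 <= B1 s)%E.
  rewrite /B1 adde_ge0//; first by rewrite lee_fin addr_ge0// mulr_ge0.
  by rewrite mule_ge0// lee_fin.
have B20 s : (0 <= B2 s)%E.
  by rewrite /B2 adde_ge0// mule_ge0 ?lee_fin ?sqrte_ge0.
have intB1 : (\int[D]_s (B1 s ^+ 2) <= (A y ^+ 2)%:E)%E.
  have -> : A y = (LL0 + LL1 * g) + LL1 * rho_hi * sigma_g.
    by rewrite /A -/g; ring.
  apply: L2_triangle => //.
  - by move=> s; rewrite lee_fin addr_ge0// mulr_ge0.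
  - by move=> s; rewrite mule_ge0// lee_fin.
  - exact: measurable_funeM.
  - by rewrite addr_ge0// mulr_ge0.
  - by rewrite mulr_ge0.
  - by rewrite -EFin_expe integral_cst_probability.
  - apply: L2_scale => //.
    under eq_integral do rewrite -EFin_expe.
    by have := ubv_grad_var ubv y; rewrite unlock.
have intB2 : (\int[D]_s (B2 s ^+ 2) <= ((LL1 * p + LL1 * rho_hi * Q) ^+ 2)%:E)%E.
  apply: L2_triangle => //.
  - by move=> s; rewrite mule_ge0// lee_fin.
  - by move=> s; rewrite mule_ge0 ?lee_fin ?sqrte_ge0.
  - exact: measurable_funeM.
  - exact: measurable_funeM.
  - by rewrite mulr_ge0.
  - by rewrite mulr_ge0.
  - by apply: L2_scale => //; under eq_integral do rewrite -EFin_expe.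
  - apply: L2_scale => //; under eq_integral do rewrite sqr_sqrte//.
    by apply: (le_trans intV); rewrite lee_fin.
have intB : (\int[D]_s ((B1 s + B2 s) ^+ 2) <=
    ((A y + (LL1 * p + LL1 * rho_hi * Q)) ^+ 2)%:E)%E.
  apply: L2_triangle => //.
    by rewrite /A addr_ge0// mulr_ge0// addr_ge0// mulr_ge0// ltW.
  by rewrite addr_ge0// mulr_ge0.
set A' := A y + (LL1 * p + _) in intB.
have seg s : (segment_sup (dual_norm N) (grad (F s)) (y + b *: w) (y + a *: w)
    <= g%:E + rho_hi%:E * G s + (X1 s + rho_hi%:E * sqrte (V s)))%E.
  apply: ge_ereal_sup => z [t /=]; rewrite in_itv/= => /andP[t0 t1] <- {z}.
  have -> : t *: (y + b *: w) + (1 - t) *: (y + a *: w) =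
      y + (t * b + (1 - t) * a) *: w.
    rewrite !scalerDr !scalerA addrACA -scalerDl [_ + (1 - t)]addrC subrK.
    by rewrite scale1r -scalerDl.
  set r := t * b + _.
  have ar : a <= r by rewrite /r; nra.
  have rb : r <= b by rewrite /r; nra.
  have E : grad (F s) (y + r *: w) = (grad f y + (grad (F s) y - grad f y)) +
     ((grad (F s) (y + a *: w) - grad (F s) y) +
      (grad (F s) (y + r *: w) - grad (F s) (y + a *: w))).
    by rewrite [grad f y + _]addrC subrK addrA [grad (F s) y + _]addrC subrK addrC subrK.
  rewrite E; apply: (@le_trans _ _ ((g + rho_hi * norm2 (grad (F s) y - grad f y)) +
      (dual_norm N (grad (F s) (y + a *: w) - grad (F s) y) +
       rho_hi * norm2 (grad (F s) (y + r *: w) - grad (F s) (y + a *: w))))%:E).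
    rewrite lee_fin; apply: (le_trans (dnD _ _)); apply: lerD;
      apply: (le_trans (dnD _ _)); rewrite lerD2l; exact: (rho _).2.
  rewrite E4; apply: leeD; first by rewrite EFinM.
  apply: leeD => //; rewrite EFinM lee_wpmul2l//; first by rewrite lee_fin ltW.
  rewrite -(lee_sqr _ (sqrte_ge0 _)) ?lee_fin ?norm2_ge0//.
  by rewrite sqr_sqrte// -EFin_expe; exact: incV.
have seg0 s : (0 <= segment_sup (dual_norm N) (grad (F s)) (y + b *: w) (y + a *: w))%E.
  apply: le_trans (ereal_sup_ubound _); last first.
    by exists 0; rewrite //= in_itv /= lexx ler01.
  by rewrite lee_fin; exact: dn0.
have intX2 : (\int[D]_s (X2 s ^+ 2) <= (((b - a) * N w * A') ^+ 2)%:E)%E.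
  have := mss (y + b *: w) (y + a *: w); rewrite unlock.
  have -> : (y + b *: w) - (y + a *: w) = (b - a) *: w.
    by rewrite opprD addrACA subrr add0r scalerBl.
  rewrite (is_norm_scale normN) ger0_norm// => H.
  rewrite /X2; under eq_integral do rewrite -EFin_expe.
  apply: (le_trans H); rewrite [leRHS](_ : _ = (A' ^+ 2)%:E * (((b - a) * N w) ^+ 2)%:E)%E.
    apply: lee_wpmul2r; first by rewrite lee_fin sqr_ge0.
    apply: le_trans intB; apply: integral_mono => s; first exact: sqre_ge0.
    rewrite lee_sqr.
    - rewrite /B1 /B2 [(LL0 + _)%:E]EFinD -!addeA leeD2l// !EFinM.
      apply: (@le_trans _ _ (LL1%:E *
        (g%:E + rho_hi%:E * G s + (X1 s + rho_hi%:E * sqrte (V s))))%E).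
        by rewrite lee_wpmul2l// lee_fin.
      have h0 : (0 <= rho_hi%:E * G s)%E by rewrite mule_ge0// lee_fin ltW.
      have h1 : (0 <= rho_hi%:E * sqrte (V s))%E by rewrite mule_ge0 ?lee_fin ?sqrte_ge0// ltW.
      rewrite ge0_muleDr ?adde_ge0 ?lee_fin// ge0_muleDr ?lee_fin//.
      by rewrite ge0_muleDr ?lee_fin// !muleA addeA.
    - by rewrite adde_ge0 ?lee_fin// mule_ge0// lee_fin.
    - by rewrite adde_ge0.
  by rewrite -EFinM -exprMn [A' * _]mulrC.
have := @L2_triangle _ _ _ D X1 X2 p ((b - a) * N w * A') _ _ mX1 mX2 p0 _ _ intX2.
rewrite /A' addrA => H.
apply: le_trans (H _ _ _ _).
- apply: integral_mono => s; first by rewrite lee_fin sqr_ge0.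
  rewrite EFin_expe lee_sqr ?lee_fin ?addr_ge0//.
  apply: le_trans (dnD _ _); rewrite [X in dual_norm N X <= _](_ : _ =
    grad (F s) (y + a *: w) - grad (F s) y
    + (grad (F s) (y + b *: w) - grad (F s) (y + a *: w)))//.
  by rewrite [RHS]addrC addrA subrK.
- by move=> s; rewrite lee_fin.
- by move=> s; rewrite lee_fin.
- rewrite !mulr_ge0// !addr_ge0// ?mulr_ge0// ?addr_ge0 ?mulr_ge0// ltW//.
- by rewrite /X1; under eq_integral do rewrite -EFin_expe.
Qed.

(* Discrete Gronwall argument over a subdivision into [m.+1] equal pieces; [e]
   bounds the oscillation of the sample gradients within a piece. *)
Lemma mss_chain (y w : 'rV[R]_n) (C H c e : R) (m i : nat) :
  (forall t j, 0 <= t -> t < 1 -> `|(w *m hess f (y + t *: w)) ord0 j| <= C) ->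
  0 <= H -> n%:R * (2 * (sigma_H ^+ 2 * norm2 w ^+ 2) + 2 * C ^+ 2) <= H ^+ 2 ->
  1 + LL1 * N w * c <= c -> 0 <= c -> 0 <= e ->
  LL1 * rho_hi * (H / m.+1%:R) <= e -> (i <= m.+1)%N ->
  (\int[D]_s (dual_norm N (grad (F s) (y + (i%:R / m.+1%:R) *: w)
      - grad (F s) y) ^+ 2)%:E
     <= ((c * (i%:R / m.+1%:R) * N w * (A y + e)) ^+ 2)%:E)%E.
Proof.
move=> hC H0 HC cc c0 e0 He.
have Nw0 : 0 <= N w by exact: (is_norm_ge0 normN).
have g0 : 0 <= dual_norm N (grad f y) by exact: (dual_norm_ge0 lo0 rho).
have Ay0 : 0 <= A y by rewrite /A addr_ge0// mulr_ge0// addr_ge0// mulr_ge0// ltW.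
have m0 : 0 < m.+1%:R :> R by [].
have lr0 : 0 <= LL1 * rho_hi by rewrite mulr_ge0// ltW.
elim: i => [_|i IH im].
  under eq_integral => s _.
    rewrite mul0r scale0r addr0 subrr (dual_norm0 lo0 rho) expr0n /=.
    over.
  by rewrite integral0 lee_fin sqr_ge0.
set a := i%:R / m.+1%:R in IH *; set b := i.+1%:R / m.+1%:R.
have a0 : 0 <= a by rewrite divr_ge0.
have ba : b - a = m.+1%:R^-1 by rewrite /a /b -mulrBl -natr1 addrC addKr mul1r.
have ab : a <= b by rewrite -subr_ge0 ba invr_ge0.
have b1 : b <= 1 by rewrite ler_pdivrMr// mul1r ler_nat.
have p0 : 0 <= c * a * N w * (A y + e).
  apply: mulr_ge0; last exact: addr_ge0.
  by apply: mulr_ge0 => //; exact: mulr_ge0.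
have Q0 : 0 <= H / m.+1%:R by rewrite divr_ge0.
have HQ : n%:R * (2 * (sigma_H ^+ 2 * norm2 w ^+ 2) + 2 * C ^+ 2) * (b - a) ^+ 2
    <= (H / m.+1%:R) ^+ 2.
  by rewrite ba exprMn ler_wpM2r// sqr_ge0.
apply: (le_trans (mss_step hC a0 ab b1 p0 Q0 HQ (IH (ltnW im)))).
rewrite lee_fin; apply: lerXn2r; rewrite ?nnegrE.
- rewrite addr_ge0// mulr_ge0//; first by rewrite mulr_ge0// subr_ge0.
  apply: addr_ge0; last exact: mulr_ge0.
  by apply: addr_ge0 => //; exact: mulr_ge0.
- apply: mulr_ge0; last exact: addr_ge0.
  by apply: mulr_ge0 => //; apply: mulr_ge0 => //; rewrite divr_ge0.
have -> : b = a + (b - a) by rewrite addrC subrK.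
have ba0 : 0 <= b - a by rewrite subr_ge0.
rewrite [a + (b - a) - a]addrAC subrr add0r.
have -> : c * (a + (b - a)) * N w * (A y + e) =
  c * a * N w * (A y + e) + (b - a) * N w * (c * (A y + e)) by ring.
rewrite lerD2l ler_wpM2l ?mulr_ge0//.
(* The slope on the new piece is [A y + e] plus [LL1] times the increment so far, which is at most
   [c * N w * (A y + e)] since [a <= 1]; the condition on [c] keeps this slope below
   [c * (A y + e)]. *)
apply: (@le_trans _ _ ((1 + LL1 * N w * c) * (A y + e))); last first.
  by rewrite ler_wpM2r// addr_ge0.
have a1 : a <= 1 by exact: le_trans b1.
have K0 : 0 <= LL1 * N w * c * (A y + e) by rewrite !mulr_ge0// addr_ge0.
have -> : LL1 * (c * a * N w * (A y + e)) = LL1 * N w * c * (A y + e) * a by ring.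
rewrite [leRHS]mulrDl mul1r addrAC; apply: lerD; first by rewrite lerD2l.
by rewrite -[leRHS]mulr1; exact: ler_wpM2l.
Qed.

(** The oscillation within a piece is of order [m.+1%:R^-1], so a fine subdivision leaves only
    [A y]. The constant [c] solves the self-bounding inequality that takes the place of a Gronwall
    exponential. *)
Lemma grad_mean_square_lipschitz (y w : 'rV[R]_n) (c : R) :
  0 <= L0 -> 0 <= L1 -> symmetric_smooth N L0 L1 f -> L1 * N w < 1 ->
  0 <= c -> 1 + LL1 * N w * c <= c ->
  (\int[D]_s (dual_norm N (grad (F s) (y + w) - grad (F s) y) ^+ 2)%:E
     <= ((c * N w * (LL0 + LL1 * (dual_norm N (grad f y) + rho_hi * sigma_g)))
          ^+ 2)%:E)%E.
Proof.
move=> L00 L10 smf Lw c0 cc.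
have Nw0 : 0 <= N w by exact: (is_norm_ge0 normN).
have g0 : 0 <= dual_norm N (grad f y) by exact: (dual_norm_ge0 lo0 rho).
have Ay0 : 0 <= A y by rewrite /A addr_ge0// mulr_ge0// addr_ge0// mulr_ge0// ltW.
have [C hC] := hess_line_le normN lo0 hi0 rho y L00 L10 (ubv_obj_diff ubv) smf Lw.
set H2 := n%:R * (2 * (sigma_H ^+ 2 * norm2 w ^+ 2) + 2 * C ^+ 2).
have H20 : 0 <= H2.
  apply: mulr_ge0 => //; apply: addr_ge0; last by rewrite mulr_ge0 ?sqr_ge0.
  by apply: mulr_ge0 => //; rewrite mulr_ge0 ?sqr_ge0.
have cw0 : 0 <= c * N w by exact: mulr_ge0.
rewrite -/(A y); apply: le_sqr_addgt0; first exact: mulr_ge0.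
(* The oscillation enters the final bound multiplied by [c * N w], so [e'] contributes at most
   [e]. *)
move=> e e0; set e' := e / (c * N w + 1).
have e'0 : 0 < e' by rewrite divr_gt0// ltr_wpDl.
set q := LL1 * rho_hi * Num.sqrt H2.
have q0 : 0 <= q by rewrite !mulr_ge0 ?sqrtr_ge0// ltW.
set m := Num.truncn (q / e').
have qm : q <= m.+1%:R * e'.
  rewrite -ler_pdivrMr//; apply/ltW.
  by have /andP[] := truncn_itv (divr_ge0 q0 (ltW e'0)).
have := @mss_chain y w C (Num.sqrt H2) c e' m m.+1 hC (sqrtr_ge0 _) _ cc c0
  (ltW e'0) _ (leqnn _).
rewrite divff ?pnatr_eq0// scale1r mulr1 => H.
apply: (le_trans (H _ _)).
- by rewrite (sqr_sqrtr H20).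
- by rewrite mulrA -/q ler_pdivrMr// mulrC.
rewrite lee_fin; apply: lerXn2r; rewrite ?nnegrE.
- by rewrite mulr_ge0// addr_ge0// ltW.
- by rewrite addr_ge0 ?mulr_ge0// ltW.
rewrite mulrDr lerD2l /e' mulrA ler_pdivrMr; last by rewrite ltr_wpDl.
by rewrite mulrC ler_wpM2l ?ltW//; lra.
Qed.

(* The fresh randomness in the recursion of the error [m_k - grad f x_k]. *)
Definition noise (alpha : R) (x w : 'rV[R]_n) (s : S) : 'rV[R]_n :=
  (1 - alpha) *: ((grad (F s) (x + w) - grad (F s) x)
                    - (grad f (x + w) - grad f x))
  + alpha *: (grad (F s) (x + w) - grad f (x + w)).

Lemma has_expectation_grad x : has_expectation D (fun s => grad (F s) x) (grad f x).
Proof. exact: (ubv_grad_mean ubv). Qed.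

Lemma has_expectation_centered (Y : S -> 'rV[R]_n) M :
  has_expectation D Y M -> has_expectation D (fun s => Y s - M) 0.
Proof.
move=> YM; have -> : (fun s => Y s - M) = (fun s => 1 *: Y s + -1 *: M).
  by apply/funext => s; rewrite scaleN1r scale1r.
have := has_expectation_lin 1 (-1) YM (has_expectation_cst D M).
by rewrite scaleN1r scale1r subrr.
Qed.

Lemma has_expectation_grad_diff x y :
  has_expectation D (fun s => grad (F s) x - grad (F s) y) (grad f x - grad f y).
Proof.
have -> : (fun s => grad (F s) x - grad (F s) y) =
    (fun s => 1 *: grad (F s) x + -1 *: grad (F s) y).
  by apply/funext => s; rewrite scaleN1r scale1r.
have := has_expectation_lin 1 (-1) (has_expectation_grad x) (has_expectation_grad y).
by rewrite scaleN1r scale1r.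
Qed.

Lemma has_expectation_noise alpha x w : has_expectation D (noise alpha x w) 0.
Proof.
have H1 := has_expectation_centered (has_expectation_grad_diff (x + w) x).
have H2 := has_expectation_centered (has_expectation_grad (x + w)).
have := has_expectation_lin (1 - alpha) alpha H1 H2.
by rewrite !scaler0 addr0.
Qed.

(** Centring the increment does not increase its second moment, and Minkowski's inequality adds the
    sampling error. Orthogonality lives in the Euclidean norm: passing to it costs [rho_lo^-1], and
    passing back will cost [rho_hi]. *)
Lemma integral_noise (alpha : R) (x w : 'rV[R]_n) (q : R) :
  0 <= alpha -> alpha <= 1 -> 0 <= q ->
  (\int[D]_s (dual_norm N (grad (F s) (x + w) - grad (F s) x) ^+ 2)%:E
     <= (q ^+ 2)%:E)%E ->
  (\int[D]_s (norm2 (noise alpha x w s) ^+ 2)%:E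
     <= (((1 - alpha) * (q / rho_lo) + alpha * sigma_g) ^+ 2)%:E)%E.
Proof.
move=> a0 a1 q0 Hq; have b0 : 0 <= 1 - alpha by rewrite subr_ge0.
pose Y s := grad (F s) (x + w) - grad (F s) x.
have YM : has_expectation D Y (grad f (x + w) - grad f x).
  exact: has_expectation_grad_diff.
have HY : (\int[D]_s (norm2 (Y s) ^+ 2)%:E <= ((q / rho_lo) ^+ 2)%:E)%E.
  apply: (@le_trans _ _ (\int[D]_s ((rho_lo^-1)%:E * (dual_norm N (Y s))%:E) ^+ 2)%E).
    apply: integral_mono => s; first by rewrite lee_fin sqr_ge0.
    rewrite -EFinM -EFin_expe lee_fin; apply: lerXn2r; rewrite ?nnegrE ?norm2_ge0//.
      by rewrite mulr_ge0 ?invr_ge0 ?(dual_norm_ge0 lo0 rho)// ltW.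
    by rewrite mulrC ler_pdivlMr// mulrC; exact: (rho _).1.
  rewrite [q / _]mulrC; apply: L2_scale.
    exact/measurable_EFinP/measurable_dual_diff.
  by under eq_integral do rewrite -EFin_expe.
have mn (v : 'rV[R]_n) : measurable_fun setT (fun s => norm2 (Y s - v)).
  apply: (@measurableT_comp _ _ _ _ (borel_rV R n) _ (@norm2 R n) _
    (fun s => Y s - v)).
    by apply: continuous_measurable_rV; exact: norm2_continuous.
  apply: measurable_fun_rV => i; under eq_fun do rewrite !mxBE.
  by apply: measurable_funB => //; apply: measurable_funB; exact: measurable_grad_sample.
have HYc : (\int[D]_s (norm2 (Y s - (grad f (x + w) - grad f x)) ^+ 2)%:E
    <= ((q / rho_lo) ^+ 2)%:E)%E.
  rewrite (integral_norm2D _ YM) ?(le_lt_trans HY) ?ltry//.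
  apply: le_trans HY; rewrite -[leRHS]adde0 leeD2l// lee_fin.
  by rewrite dotNr norm2N norm2_sqr; have := dot_ge0 (grad f (x + w) - grad f x); lra.
pose f1 s := ((1 - alpha)%:E * (norm2 (Y s - (grad f (x + w) - grad f x)))%:E)%E.
pose f2 s := (alpha%:E * (norm2 (grad (F s) (x + w) - grad f (x + w)))%:E)%E.
have mf1 : measurable_fun setT f1.
  by apply: measurable_funeM; exact/measurable_EFinP/mn.
have mf2 : measurable_fun setT f2.
  by apply: measurable_funeM; exact/measurable_EFinP/measurable_norm2_sample.
have f10 s : (0 <= f1 s)%E by rewrite mule_ge0// lee_fin norm2_ge0.
have f20 s : (0 <= f2 s)%E by rewrite mule_ge0// lee_fin norm2_ge0.
apply: (@le_trans _ _ (\int[D]_s (f1 s + f2 s) ^+ 2)%E).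
  apply: integral_mono => s; first by rewrite lee_fin sqr_ge0.
  rewrite EFin_expe lee_sqr; [|by rewrite lee_fin norm2_ge0|exact: adde_ge0].
  rewrite /f1 /f2 -!EFinM -EFinD lee_fin.
  apply: (le_trans (norm2D _ _)); rewrite !norm2Z !ger0_norm//.
apply: L2_triangle => //.
- by rewrite mulr_ge0// divr_ge0// ltW.
- by rewrite mulr_ge0.
- apply: L2_scale; first exact/measurable_EFinP/mn.
  by under eq_integral do rewrite -EFin_expe.
- apply: L2_scale; first exact/measurable_EFinP/measurable_norm2_sample.
  under eq_integral do rewrite -EFin_expe.
  by have := ubv_grad_var ubv (x + w); rewrite unlock.
Qed.

(** The L2 bound on the noise is affine in [dual_norm N (grad f x)]; its constant term and its
    linear term are the [p] and the [q] of [integral_sqrt_norm2D]. *)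
Lemma integral_sqrt_noise (alpha eta c C : R) (x w v : 'rV[R]_n) :
  0 <= alpha -> alpha <= 1 -> 0 <= L0 -> 0 <= L1 -> symmetric_smooth N L0 L1 f ->
  L1 * eta < 1 -> 0 <= c -> 1 + LL1 * eta * c <= c -> N w <= eta -> 0 <= C ->
  (\int[D]_s (Num.sqrt (norm2 (v + noise alpha x w s) ^+ 2 + C))%:E <=
    (Num.sqrt (norm2 v ^+ 2
       + (alpha * sigma_g
          + (1 - alpha) * (c * eta * (LL0 + LL1 * rho_hi * sigma_g) / rho_lo)) ^+ 2 + C)
     + (1 - alpha) * (c * eta * LL1 / rho_lo) * dual_norm N (grad f x))%:E)%E.
Proof.
move=> a0 a1 L00 L10 smf Le c0 cc Nw C0.
have b0 : 0 <= 1 - alpha by rewrite subr_ge0.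
have Nw0 : 0 <= N w by exact: (is_norm_ge0 normN).
have eta0 : 0 <= eta by exact: le_trans Nw.
have g0 : 0 <= dual_norm N (grad f x) by exact: (dual_norm_ge0 lo0 rho).
have lr0 : 0 <= LL1 * rho_hi * sigma_g by rewrite !mulr_ge0// ltW.
have ce0 : 0 <= c * eta by exact: mulr_ge0.
apply: integral_sqrt_norm2D => //.
- exact: has_expectation_noise.
- apply: addr_ge0; first exact: mulr_ge0.
  apply: mulr_ge0 => //; apply: divr_ge0; last exact: ltW.
  by apply: mulr_ge0 => //; exact: addr_ge0.
- apply: mulr_ge0 => //; apply: mulr_ge0 => //; apply: divr_ge0; last exact: ltW.
  exact: mulr_ge0.
set q := c * eta * (LL0 + LL1 * (dual_norm N (grad f x) + rho_hi * sigma_g)).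
have q0 : 0 <= q.
  rewrite /q; apply: mulr_ge0 => //; apply: addr_ge0 => //.
  by rewrite mulrDr mulrA addr_ge0// mulr_ge0.
rewrite [X in (_ <= (X ^+ 2)%:E)%E](_ : _ = (1 - alpha) * (q / rho_lo) + alpha * sigma_g).
  apply: integral_noise => //.
  have Lw : L1 * N w < 1 by apply: le_lt_trans Le; exact: ler_wpM2l.
  have cw : 1 + LL1 * N w * c <= c.
    apply: le_trans cc; rewrite lerD2l; apply: ler_wpM2r => //.
    exact: ler_wpM2l.
  apply: (le_trans (grad_mean_square_lipschitz x L00 L10 smf Lw c0 cw)).
  have A0 : 0 <= LL0 + LL1 * (dual_norm N (grad f x) + rho_hi * sigma_g).
    by apply: addr_ge0 => //; rewrite mulrDr mulrA addr_ge0// mulr_ge0.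
  rewrite lee_fin; apply: lerXn2r; rewrite ?nnegrE//.
    by rewrite !mulr_ge0.
  by apply: ler_wpM2r => //; exact: ler_wpM2l.
rewrite /q; ring.
Qed.

End StochasticSmoothness.

(** * Independence of the current state and future samples *)

Section Independence.
Context {dO dS dU : measure_display} {Omega : measurableType dO}
  {S : measurableType dS} {U : measurableType dU} {R : realType}.
Variable P : probability Omega R.
Local Open Scope ereal_scope.

(** The joint law is the product measure, as both agree on rectangles. Tonelli's theorem then
    integrates the fresh sample with the state frozen, which replaces conditioning on the past. *)
Lemma integral_independent_pair (D : probability S R) (Z : Omega -> U)
    (X : Omega -> S) (h : U * S -> \bar R) :
  measurable_fun setT Z -> measurable_fun setT X ->
  (forall A B, measurable A -> measurable B ->
    P (Z @^-1` A `&` X @^-1` B) = P (Z @^-1` A) * D B) ->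
  measurable_fun setT h -> (forall z, 0 <= h z) ->
  \int[P]_w h (Z w, X w) = \int[P]_w \int[D]_s h (Z w, s).
Proof.
move=> mZ mX ZX mh h0.
have mZX : measurable_fun setT (fun w => (Z w, X w)).
  exact: measurable_fun_pair.
pose Z' : {mfun Omega >-> U} := mfun_Sub (mem_set mZ).
pose ZX' : {mfun Omega >-> (U * S)%type} := mfun_Sub (mem_set mZX).
have ZE : Z' =1 Z by [].
have E1 : \int[P]_w h (Z w, X w) = \int[distribution P ZX']_z h z.
  by rewrite ge0_integral_distribution.
have E2 : \int[distribution P ZX']_z h z =
    \int[distribution P Z' \x D]_z h z.
  apply: eq_measure_integral => A mA _; apply/esym.
  by apply: product_measure_unique => // B C mB mC; exact: ZX.
rewrite E1 E2 fubini_tonelli1// ge0_integral_distribution//.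
- exact: measurable_fun_fubini_tonelli_F.
- by move=> z; exact: integral_ge0.
Qed.

(** Both sides are finite measures in [C], and rectangles form a generating class stable under
    intersection. *)
Lemma independent_pair_event (Z : Omega -> U) (X : Omega -> S) (E : set Omega) :
  measurable_fun setT Z -> measurable_fun setT X -> measurable E ->
  (forall A B, measurable A -> measurable B ->
    P (Z @^-1` A `&` X @^-1` B `&` E) = P (Z @^-1` A `&` X @^-1` B) * P E) ->
  forall C, measurable C ->
    P ((fun w => (Z w, X w)) @^-1` C `&` E) =
    P ((fun w => (Z w, X w)) @^-1` C) * P E.
Proof.
move=> mZ mX mE H C mC.
have mZX : measurable_fun setT (fun w => (Z w, X w)).
  exact: measurable_fun_pair.
have PEfin : P E \is a fin_num by exact: fin_num_measure.
pose c := NngNum (fine_ge0 (measure_ge0 P E)).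
pose ZX' : {mfun Omega >-> (U * S)%type} := mfun_Sub (mem_set mZX).
pose m1 : {measure set (U * S) -> \bar R} :=
  pushforward (mrestr P mE) ZX'.
pose m2 : {measure set (U * S) -> \bar R} := mscale c (distribution P ZX').
suff /(_ C mC) : forall A, measurable A -> m1 mZX A = m2 A.
  by rewrite /m1 /m2 /= /pushforward /mrestr /mscale /= fineK// muleC.
apply: (measure_unique [set A `*` B | A in measurable & B in measurable]
  (fun=> setT)).
- exact: measurable_prod_measurableType.
- move=> _ _ [A mA [B mB <-]] [A' mA' [B' mB' <-]].
  exists (A `&` A'); first exact: measurableI.
  exists (B `&` B'); first exact: measurableI.
  by rewrite -setXI.
- by move=> _; exists setT => //; exists setT => //; rewrite setXTT.
- by rewrite bigcup_const.
- move=> _ [A mA [B mB <-]].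
  by rewrite /m1 /m2 /= /pushforward /mrestr /mscale /= fineK// muleC; exact: H.
- move=> _; rewrite /m1 /= /pushforward /mrestr /=.
  by rewrite preimage_setT setTI (le_lt_trans (probability_le1 _ _)) ?ltry.
Qed.

End Independence.

(** The induction carries independence from every finite family of later samples: a step moves one
    sample into the state and still needs independence from the remaining ones. *)
Lemma markov_chain_independent (R : realType) (dO dS dU : measure_display)
    (Omega : measurableType dO) (S : measurableType dS) (U : measurableType dU)
    (P : probability Omega R) (F : nat -> set_system Omega)
    (xi : nat -> Omega -> S) (Z : nat -> Omega -> U) (Phi : nat -> U * S -> U)
    (K : nat) :
  mutually_independent P F ->
  (forall k, (0 < k)%N -> measurable_fun setT (xi k)) ->
  (forall k B, (0 < k)%N -> measurable B -> F k (xi k @^-1` B)) ->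
  (forall A, measurable A -> F 0%N (Z 0%N @^-1` A)) ->
  measurable_fun setT (Z 0%N) ->
  (forall k, (k <= K)%N -> measurable_fun setT (Phi k)) ->
  (forall k w, (k <= K)%N -> Z k.+1 w = Phi k (Z k w, xi k.+1 w)) ->
  forall k, (k <= K.+1)%N -> measurable_fun setT (Z k) /\
    forall (J : seq nat) (B : nat -> set S) A, uniq J ->
      (forall i, i \in J -> (k < i)%N) -> (forall i, measurable (B i)) ->
      measurable A ->
      P (Z k @^-1` A `&` \bigcap_(i in [set` J]) (xi i @^-1` B i)) =
      (P (Z k @^-1` A) * P (\bigcap_(i in [set` J]) (xi i @^-1` B i)))%E.
Proof.
move=> indF mxi Fxi FZ mZ0 mPhi ZS.
have mpre i B : (0 < i)%N -> measurable B -> measurable (xi i @^-1` B).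
  by move=> i0 mB; rewrite -[X in measurable X]setTI; exact: mxi.
have Pcap (J : seq nat) (B : nat -> set S) : uniq J ->
    (forall i, i \in J -> (0 < i)%N) -> (forall i, measurable (B i)) ->
    P (\bigcap_(i in [set` J]) (xi i @^-1` B i)) =
    (\prod_(i <- J) P (xi i @^-1` B i))%E.
  by move=> uJ J0 mB; apply: indF => // i iJ; apply: Fxi => //; exact: J0.
elim=> [_|k IH kK].
  split=> // J B A uJ J0 mB mA.
  pose E i := if i is 0%N then Z 0%N @^-1` A else xi i @^-1` B i.
  have n0 : 0%N \notin J by apply/negP => /J0.
  have := indF (0%N :: J) E; rewrite /= n0 uJ => /(_ isT) H.
  have EJ i : i \in J -> E i = xi i @^-1` B i.
    by move=> /J0; case: i.
  rewrite Pcap//; transitivity (P (\bigcap_(i in [set` 0%N :: J]) E i)).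
    congr (P _); apply/seteqP; split => w /=.
      move=> [Zw Hw] i; rewrite /= inE => /orP[/eqP->//|iJ].
      by rewrite EJ//; exact: Hw.
    move=> Hw; split; first by apply: (Hw 0%N); rewrite /= inE eqxx.
    by move=> i /= iJ; have := Hw i; rewrite EJ//; apply; rewrite /= inE iJ orbT.
  rewrite H ?big_cons; last first.
    move=> i; rewrite inE => /orP[/eqP->|iJ]; first exact: FZ.
    by rewrite EJ//; apply: Fxi => //; exact: J0.
  congr (_ * _)%E; rewrite big_seq [RHS]big_seq.
  by apply: eq_bigr => i iJ; rewrite EJ.
have [mZk {}IH] := IH (ltnW kK).
have mZX : measurable_fun setT (fun w => (Z k w, xi k.+1 w)).
  by apply: measurable_fun_pair => //; exact: mxi.
have ZSE : Z k.+1 = (fun w => Phi k (Z k w, xi k.+1 w)).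
  by apply/funext => w; exact: ZS.
split.
  by rewrite ZSE; apply: (measurableT_comp (mPhi _ _) mZX).
move=> J B A uJ Jk mB mA.
have kJ : k.+1 \notin J by apply/negP => /Jk; rewrite ltnn.
set E := \bigcap_(i in _) _.
have mE : measurable E.
  apply: fin_bigcap_measurable; first exact: finite_seq.
  by move=> i /= iJ; apply: mpre => //; exact: leq_ltn_trans (Jk i iJ).
rewrite ZSE.
have -> : (fun w => Phi k (Z k w, xi k.+1 w)) @^-1` A =
   (fun w => (Z k w, xi k.+1 w)) @^-1` (Phi k @^-1` A) by [].
apply: independent_pair_event => //; first exact: mxi.
- move=> A' B' mA' mB'.
  (* Adds [xi k.+1], which enters the new state, to the family [J], so that the induction hypothesis
     can be applied to both. *)
  pose B2 i := if i == k.+1 then B' else B i.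
  have mB2 i : measurable (B2 i) by rewrite /B2; case: ifP.
  have B2J i : i \in J -> B2 i = B i.
    by move=> iJ; rewrite /B2; case: eqP => // ik; rewrite -ik iJ in kJ.
  have B2k : B2 k.+1 = B' by rewrite /B2 eqxx.
  have capE : \bigcap_(i in [set` k.+1 :: J]) (xi i @^-1` B2 i) =
      xi k.+1 @^-1` B' `&` E.
    apply/seteqP; split => w /=.
      move=> Hw; split; first by have := Hw k.+1; rewrite B2k; apply; rewrite /= inE eqxx.
      by move=> i /= iJ; have := Hw i; rewrite B2J//; apply; rewrite /= inE iJ orbT.
    move=> [Xw Ew] i /=; rewrite inE => /orP[/eqP->|iJ]; first by rewrite B2k.
    by rewrite B2J//; exact: Ew.
  have cap1 : \bigcap_(i in [set` [:: k.+1]]) (xi i @^-1` B2 i) =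
      xi k.+1 @^-1` B'.
    apply/seteqP; split => w /=.
      by move=> Hw; have := Hw k.+1; rewrite B2k; apply; rewrite /= inE eqxx.
    by move=> Xw i /=; rewrite inE => /eqP->; rewrite B2k.
  have H1 := IH (k.+1 :: J) B2 A'; rewrite capE /= kJ uJ in H1.
  have H2 := IH [:: k.+1] B2 A'; rewrite cap1 in H2.
  rewrite -setIA H1//; last first.
    by move=> i; rewrite inE => /orP[/eqP->//|/Jk]; exact: ltnW.
  rewrite H2//; last by move=> i; rewrite inE => /eqP->.
  rewrite -muleA; congr (_ * _)%E.
  rewrite -capE -cap1 Pcap//=; last 2 first.
  - by rewrite kJ.
  - by move=> i; rewrite inE => /orP[/eqP->//|/Jk]; exact: leq_ltn_trans.
  rewrite big_cons cap1 B2k; congr (_ * _)%E.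
  rewrite /E Pcap//; last by move=> i /Jk; exact: leq_ltn_trans.
  by rewrite big_seq [RHS]big_seq; apply: eq_bigr => i iJ; rewrite B2J.
- by rewrite -[X in measurable X]setTI; exact: mPhi.
Qed.

(** * Geometrically weighted sums *)

Section GeometricAccumulation.
Context {R : realFieldType}.
Implicit Types (b : R) (u : nat -> R).

(** In closed form, the sum of b^(k-1-i) u_i over i < k. *)
Fixpoint geo_acc b u k : R :=
  if k is k'.+1 then b * geo_acc b u k' + u k' else 0.

Lemma geo_acc_ge0 b u k : 0 <= b -> (forall i, 0 <= u i) -> 0 <= geo_acc b u k.
Proof. by move=> b0 u0; elim: k => //= k IH; rewrite addr_ge0// mulr_ge0. Qed.

(** Summing the recursion gives an identity with the extra term [geo_acc b u k], which is
    nonnegative. *)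
Lemma sum_geo_acc_le b u k : 0 <= b -> (forall i, 0 <= u i) ->
  (1 - b) * \sum_(i < k) geo_acc b u i <= \sum_(i < k) u i.
Proof.
move=> b0 u0; have <- : (1 - b) * \sum_(i < k) geo_acc b u i + geo_acc b u k =
    \sum_(i < k) u i.
  elim: k => [|k IH]; first by rewrite !big_ord0 mulr0 addr0.
  by rewrite !big_ord_recr /= -IH; ring.
by rewrite lerDl geo_acc_ge0.
Qed.

Lemma sum_exp_le b k : 0 <= b -> (1 - b) * \sum_(i < k) b ^+ i <= 1.
Proof.
move=> b0; have -> : (1 - b) * \sum_(i < k) b ^+ i = 1 - b ^+ k.
  elim: k => [|k IH]; first by rewrite big_ord0 expr0 mulr0 subrr.
  by rewrite big_ord_recr /= mulrDr IH exprS; ring.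
by rewrite gerBl exprn_ge0.
Qed.

(** The geometric sum of ratio b^2 is at most 1 / (1 - b^2), hence at most 1 / (1 - b). *)
Lemma geo_acc_sqr_le b k : 0 <= b -> b <= 1 ->
  (1 - b) * geo_acc (b ^+ 2) (fun=> 1) k <= 1.
Proof.
move=> b0 b1; elim: k => [|k IH] /=; first by rewrite mulr0.
have := ler_wpM2l (sqr_ge0 b) IH; nra.
Qed.

End GeometricAccumulation.

(** * The momentum recursion *)

Section Algorithm.
Context {R : realType} {n : nat} {dS dO : measure_display}
  {S : measurableType dS} {Omega : measurableType dO}.
Variables (N : 'rV[R]_n -> R) (rho_lo rho_hi : R).
Variables (D : probability S R) (P : probability Omega R) (F : S -> 'rV[R]_n -> R).
Variables (sigma_g sigma_H L0 L1 LL0 LL1 : R) (K : nat).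
Variables (lmo : nat -> 'rV[R]_n -> 'rV[R]_n) (xi : nat -> Omega -> S).
Variables (x0 : 'rV[R]_n) (m0 : Omega -> 'rV[R]_n) (x m : nat -> Omega -> 'rV[R]_n).
Variables (alpha eta : R).
Let f := objective D F.
Let beta := 1 - alpha.
Hypotheses (normN : is_norm N) (lo0 : 0 < rho_lo) (hi0 : 0 < rho_hi).
Hypothesis rho : forall v : 'rV[R]_n,
  rho_lo * norm2 v <= dual_norm N v /\ dual_norm N v <= rho_hi * norm2 v.
Hypothesis ubv : unbiased_bounded_variance D F sigma_g sigma_H.
Hypotheses (sg0 : 0 <= sigma_g) (L00 : 0 <= L0) (L10 : 0 <= L1).
Hypotheses (LL00 : 0 <= LL0) (LL10 : 0 <= LL1).
Hypothesis smf : symmetric_smooth N L0 L1 f.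
Hypothesis mss : mean_squared_symmetric_smooth D N LL0 LL1 F.
Hypothesis indep : independent_samples D P m0 xi.
Hypothesis iter :
  lmo_mvr_iterates N F K (fun=> alpha) (fun=> eta) lmo xi x0 m0 x m.
Hypotheses (alpha0 : 0 <= alpha) (alpha1 : alpha < 1).
Hypotheses (eta0 : 0 <= eta) (Leta : L1 * eta < 1).

Let X : measurableType _ := borel_rV R n.
Let U : measurableType _ := (X * X * X)%type.

(** The initial momentum stays in the state because the error without its contribution has to be a
    function of the state. *)
Let state k w : U := (x k w, m k w, m0 w).

Let step k (p : U * S) : U :=
  let: (y, v, v0, s) := p in
  let y' := y + lmo k v in
  (y', (1 - alpha) *: (v + grad (F s) y' - grad (F s) y)
         + alpha *: grad (F s) y', v0).

Lemma measurable_rVD d (T : measurableType d) (g h : T -> 'rV[R]_n) :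
  measurable_fun setT (g : T -> X) -> measurable_fun setT (h : T -> X) ->
  measurable_fun setT ((fun t => g t + h t) : T -> X).
Proof.
move=> mg mh; apply: measurable_fun_rV => i; under eq_fun do rewrite mxE.
by apply: measurable_funD; exact: measurable_coord_rV.
Qed.

Lemma measurable_rVZ d (T : measurableType d) (a : R) (g : T -> 'rV[R]_n) :
  measurable_fun setT (g : T -> X) ->
  measurable_fun setT ((fun t => a *: g t) : T -> X).
Proof.
move=> mg; apply: measurable_fun_rV => i; under eq_fun do rewrite mxE.
by apply: measurable_funM => //; exact: measurable_coord_rV.
Qed.

Lemma measurable_rVB d (T : measurableType d) (g h : T -> 'rV[R]_n) :
  measurable_fun setT (g : T -> X) -> measurable_fun setT (h : T -> X) ->
  measurable_fun setT ((fun t => g t - h t) : T -> X).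
Proof.
move=> mg mh; apply: measurable_fun_rV => i; under eq_fun do rewrite mxBE.
by apply: measurable_funB; exact: measurable_coord_rV.
Qed.

Lemma measurable_grad_objective d (T : measurableType d) (g : T -> 'rV[R]_n) :
  measurable_fun setT (g : T -> X) ->
  measurable_fun setT ((fun t => grad f (g t)) : T -> X).
Proof.
move=> mg; apply: measurable_fun_rV => i.
apply: (@measurableT_comp _ _ _ _ X _ (fun z : 'rV[R]_n => grad f z ord0 i) _ g) => //.
apply: continuous_measurable_rV => z.
apply: (@continuous_comp _ _ _ (grad f) (fun v : 'rV[R]_n => v ord0 i)).
  exact: (grad_continuous (ubv_obj_diff ubv)).
exact: coord_continuous.
Qed.

Lemma measurable_dual_norm d (T : measurableType d) (g : T -> 'rV[R]_n) :
  measurable_fun setT (g : T -> X) ->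
  measurable_fun setT (fun t => dual_norm N (g t)).
Proof.
move=> mg; apply: (@measurableT_comp _ _ _ _ X _ (dual_norm N) _ g) => //.
by apply: continuous_measurable_rV; exact: (dual_norm_continuous normN lo0 hi0 rho).
Qed.

Lemma measurable_norm2 d (T : measurableType d) (g : T -> 'rV[R]_n) :
  measurable_fun setT (g : T -> X) -> measurable_fun setT (fun t => norm2 (g t)).
Proof.
move=> mg; apply: (@measurableT_comp _ _ _ _ X _ (@norm2 R n) _ g) => //.
by apply: continuous_measurable_rV; exact: norm2_continuous.
Qed.

Let mU1 d (T : measurableType d) (g : T -> U) : measurable_fun setT g ->
  measurable_fun setT ((fun t => (g t).1.1) : T -> X).
Proof.
move=> mg; apply: (measurableT_comp (@measurable_fst _ _ X X)).
exact: (measurableT_comp (@measurable_fst _ _ (X * X)%type X) mg).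
Qed.

Let mU2 d (T : measurableType d) (g : T -> U) : measurable_fun setT g ->
  measurable_fun setT ((fun t => (g t).1.2) : T -> X).
Proof.
move=> mg; apply: (measurableT_comp (@measurable_snd _ _ X X)).
exact: (measurableT_comp (@measurable_fst _ _ (X * X)%type X) mg).
Qed.

Let mU3 d (T : measurableType d) (g : T -> U) : measurable_fun setT g ->
  measurable_fun setT ((fun t => (g t).2) : T -> X).
Proof. exact: (measurableT_comp (@measurable_snd _ _ (X * X)%type X)). Qed.

Let mlmo d (T : measurableType d) k (g : T -> 'rV[R]_n) : (k <= K)%N ->
  measurable_fun setT (g : T -> X) ->
  measurable_fun setT ((fun t => lmo k (g t)) : T -> X).
Proof. by move=> kK mg; exact: (measurableT_comp (mvr_lmo_meas iter kK) mg). Qed.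

Let measurable_step k : (k <= K)%N -> measurable_fun setT (step k).
Proof.
move=> kK.
have m1 : measurable_fun setT (fun p : U * S => p.1) by exact: measurable_fst.
have m2 : measurable_fun setT (fun p : U * S => p.2) by exact: measurable_snd.
have -> : step k = (fun p : U * S =>
   (p.1.1.1 + lmo k p.1.1.2,
    (1 - alpha) *: (p.1.1.2 + grad (F p.2) (p.1.1.1 + lmo k p.1.1.2)
       - grad (F p.2) p.1.1.1) + alpha *: grad (F p.2) (p.1.1.1 + lmo k p.1.1.2),
    p.1.2)).
  by apply/funext => -[[[y v] v0] s].
have my := mU1 m1; have mv := mU2 m1; have mv0 := mU3 m1.
have my' := measurable_rVD my (mlmo kK mv).
have mg' := measurable_grad ubv m2 my'.
have mg := measurable_grad ubv m2 my.
apply: (@measurable_fun_pair _ _ _ _ (X * X)%type X) => //.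
apply: (@measurable_fun_pair _ _ _ _ X X) => //.
apply: measurable_rVD; last exact: measurable_rVZ.
by apply: measurable_rVZ; apply: measurable_rVB => //; exact: measurable_rVD.
Qed.

Let measurable_state0 : measurable_fun setT (state 0).
Proof.
have m00 := samples_init_meas indep.
have E : state 0 = (fun w => (x0, m0 w, m0 w)).
  by apply/funext => w; rewrite /state (mvr_x0 iter) (mvr_m0 iter).
rewrite E.
exact: (@measurable_fun_pair _ _ _ Omega (X * X)%type X (fun w => (x0, m0 w)) m0
  (@measurable_fun_pair _ _ _ Omega X X (fun=> x0) m0 (measurable_cst _) m00) m00).
Qed.

Let state_independent k : (k <= K.+1)%N -> measurable_fun setT (state k) /\
  forall (J : seq nat) (B : nat -> set S) A, uniq J ->
    (forall i, i \in J -> (k < i)%N) -> (forall i, measurable (B i)) ->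
    measurable A ->
    P (state k @^-1` A `&` \bigcap_(i in [set` J]) (xi i @^-1` B i)) =
    (P (state k @^-1` A) * P (\bigcap_(i in [set` J]) (xi i @^-1` B i)))%E.
Proof.
apply: (@markov_chain_independent _ _ _ _ _ _ _ P (source_sigma_algebra m0 xi)
  xi state step K) => //.
- exact: (samples_indep indep).
- exact: (samples_meas indep).
- move=> [//|i] B _ mB; exists B => //; by rewrite setTI.
- move=> A mA.
  have md : measurable_fun setT ((fun v => (x0, v, v)) : X -> U).
    have mid : measurable_fun setT (id : X -> X) by exact: measurable_id.
    exact: (@measurable_fun_pair _ _ _ X (X * X)%type X (fun w => (x0, w)) id
      (@measurable_fun_pair _ _ _ X X X (fun=> x0) id (measurable_cst _) mid) mid).
  exists ((fun v : X => (x0, v, v)) @^-1` A).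
    by rewrite -[X in measurable X]setTI; exact: md.
  rewrite setTI; apply/seteqP; split => w /=;
    by rewrite /state (mvr_x0 iter) (mvr_m0 iter).
- by move=> i w iK; rewrite /state /= (mvr_m_step iter _ iK) (mvr_x_step iter _ iK).
Qed.

Lemma measurable_iterate k : (k <= K.+1)%N ->
  measurable_fun setT (x k : Omega -> X) /\ measurable_fun setT (m k : Omega -> X).
Proof.
by move=> kK; have [ms _] := state_independent kK; split; [exact: mU1 ms|exact: mU2 ms].
Qed.

Let state_pair k A B : (k <= K)%N -> measurable A -> measurable B ->
  P (state k @^-1` A `&` xi k.+1 @^-1` B) = (P (state k @^-1` A) * D B)%E.
Proof.
move=> kK mA mB; have [_] := state_independent (leqW kK).
move=> /(_ [:: k.+1] (fun=> B) A isT).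
have -> : \bigcap_(i in [set` [:: k.+1]]) (xi i @^-1` B) = xi k.+1 @^-1` B.
  apply/seteqP; split => w /=; first by apply; rewrite /= inE eqxx.
  by move=> Bw i /=; rewrite inE => /eqP->.
move=> -> //; first by congr (_ * _)%E; exact: (samples_law indep).
by move=> i; rewrite inE => /eqP->.
Qed.

(* The error [m_k - grad f x_k] without the decaying contribution of [m0]. *)
Let V k w : 'rV[R]_n :=
  m k w - grad f (x k w) - beta ^+ k *: (m0 w - grad f x0).

Let V0 w : V 0 w = 0.
Proof. by rewrite /V (mvr_x0 iter) (mvr_m0 iter) expr0 scale1r subrr. Qed.

Let V_step k w : (k <= K)%N ->
  V k.+1 w = beta *: V k w + noise D F alpha (x k w) (lmo k (m k w)) (xi k.+1 w).
Proof.
move=> kK; rewrite /V /noise (mvr_m_step iter _ kK) (mvr_x_step iter _ kK).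
rewrite -/f exprS; move: (m0 w - grad f x0) (beta ^+ k) => e b.
move: (grad f _) (grad f _) (grad (F _) _) (grad (F _) _) => f1 f0 g1 g0.
by rewrite /beta; apply/rowP => i; rewrite !mxE; ring.
Qed.

Let A0 c := alpha * sigma_g
  + (1 - alpha) * (c * eta * (LL0 + LL1 * rho_hi * sigma_g) / rho_lo).
Let B0 c := (1 - alpha) * (c * eta * LL1 / rho_lo).

Lemma expectation_V_step c C k : 0 <= c -> 1 + LL1 * eta * c <= c -> 0 <= C ->
  (k <= K)%N ->
  (\int[P]_w (Num.sqrt (norm2 (V k.+1 w) ^+ 2 + C))%:E <=
   \int[P]_w (Num.sqrt (norm2 (beta *: V k w) ^+ 2 + (A0 c) ^+ 2 + C)
     + B0 c * dual_norm N (grad f (x k w)))%:E)%E.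
Proof.
move=> c0 cc C0 kK.
(* [V k] read off the state, so that independence of the state and the next sample applies. *)
pose Vu (u : U) : 'rV[R]_n :=
  u.1.2 - grad f u.1.1 - beta ^+ k *: (u.2 - grad f x0).
pose h (p : U * S) : \bar R := (Num.sqrt (norm2 (beta *: Vu p.1 +
  noise D F alpha p.1.1.1 (lmo k p.1.1.2) p.2) ^+ 2 + C))%:E.
have mh : measurable_fun setT h.
  have m1 : measurable_fun setT (fun p : U * S => p.1) by exact: measurable_fst.
  have m2 : measurable_fun setT (fun p : U * S => p.2) by exact: measurable_snd.
  have my := mU1 m1; have mv := mU2 m1; have mv0 := mU3 m1.
  have my' := measurable_rVD my (mlmo kK mv).
  have mg' := measurable_grad ubv m2 my'.
  have mg := measurable_grad ubv m2 my.
  have mf := measurable_grad_objective my.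
  have mf' := measurable_grad_objective my'.
  apply/measurable_EFinP.
  apply: (@measurableT_comp _ _ _ _ _ _ (Num.sqrt : R -> R)).
    by apply: continuous_measurable_fun; exact: sqrt_continuous.
  apply: measurable_funD => //; apply: measurable_funX; apply: measurable_norm2.
  apply: measurable_rVD.
    apply: measurable_rVZ; apply: measurable_rVB; first exact: measurable_rVB.
    by apply: measurable_rVZ; apply: measurable_rVB.
  apply: measurable_rVD; apply: measurable_rVZ; last exact: measurable_rVB.
  by apply: measurable_rVB; exact: measurable_rVB.
have E : (\int[P]_w (Num.sqrt (norm2 (V k.+1 w) ^+ 2 + C))%:E =
    \int[P]_w h (state k w, xi k.+1 w))%E.
  by apply: eq_integral => w _; rewrite (V_step w kK).
have h0 z : (0 <= h z)%E by rewrite lee_fin sqrtr_ge0.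
have [ms _] := state_independent (leqW kK).
rewrite E (integral_independent_pair ms (samples_meas indep (ltn0Sn k))
  (fun A B mA mB => state_pair kK mA mB) mh h0).
apply: integral_mono => w; first exact: integral_ge0.
have [Nw _] := mvr_lmo_argmin iter (m k w) kK.
have := @integral_sqrt_noise _ _ _ _ _ _ _ _ _ _ _ _ _ _ _ normN lo0 hi0 rho
  ubv sg0 LL00 LL10 mss alpha eta c C (x k w) (lmo k (m k w)) (beta *: V k w)
  alpha0 (ltW alpha1) L00 L10 smf Leta c0 cc Nw C0.
by [].
Qed.

Let g k w := dual_norm N (grad f (x k w)).

Let g_ge0 k w : 0 <= g k w.
Proof. exact: (dual_norm_ge0 lo0 rho). Qed.

Lemma measurable_grad_iterate k : (k <= K.+1)%N -> measurable_fun setT (g k).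
Proof.
move=> kK; apply: measurable_dual_norm; apply: measurable_grad_objective.
by have [] := measurable_iterate kK.
Qed.

Let Nstep k w : (k <= K)%N -> N (lmo k (m k w)) <= eta.
Proof. by move=> kK; have [] := mvr_lmo_argmin iter (m k w) kK. Qed.

Let LNstep k w : (k <= K)%N -> L1 * N (lmo k (m k w)) <= L1 * eta.
Proof. by move=> kK; apply: ler_wpM2l => //; exact: Nstep. Qed.

(** The starting point is deterministic and every step has norm at most [eta], so smoothness gives a
    bound uniform in [w]. It serves only to make the expectations [G k] finite, hence real numbers
    that can be moved across inequalities. *)
Lemma grad_iterate_bounded k : (k <= K.+1)%N -> exists M, forall w, g k w <= M.
Proof.
elim: k => [_|k IH kK].
  by exists (dual_norm N (grad f x0)) => w; rewrite /g (mvr_x0 iter).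
have [M HM] := IH (ltnW kK).
exists (M + (L0 + L1 * M) / (1 - L1 * eta) * eta) => w.
have kK' : (k <= K)%N by [].
have Lw := le_lt_trans (LNstep w kK') Leta.
have [c [c0 cle lip]] := symmetric_smooth_line normN lo0 hi0 rho (x k w) L00 L10
  (ubv_obj_diff ubv) smf Lw.
have := lip 0 1 (lexx _) ler01 (lexx _).
rewrite scale0r scale1r addr0 subr0 mulr1 -(mvr_x_step iter w kK') => H.
have M0 : 0 <= M by exact: le_trans (HM w).
apply: (@le_trans _ _ (g k w + c * eta)).
  rewrite /g -{1}(subrK (grad f (x k w)) (grad f (x k.+1 w))) addrC.
  apply: (le_trans (dual_normD normN lo0 rho _ _)); rewrite lerD2l.
  by apply: (le_trans H); apply: ler_wpM2l => //; exact: Nstep.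
apply: lerD => //; apply: ler_wpM2r => //; apply: (le_trans cle).
apply: ler_pM.
- by rewrite addr_ge0// mulr_ge0// g_ge0.
- by rewrite invr_ge0 subr_ge0; exact: ltW.
- by rewrite lerD2l; apply: ler_wpM2l => //; exact: HM.
- by rewrite lef_pV2 ?posrE ?subr_gt0// lerD2l lerN2 LNstep.
Qed.

Let G k : R := fine (\int[P]_w (g k w)%:E)%E.

Let G_ge0 k : 0 <= G k.
Proof. by apply: fine_ge0; apply: integral_ge0 => w _; rewrite lee_fin. Qed.

Let GE k : (k <= K.+1)%N -> (\int[P]_w (g k w)%:E = (G k)%:E)%E.
Proof.
move=> kK; rewrite /G fineK// ge0_fin_numE; last first.
  by apply: integral_ge0 => w _; rewrite lee_fin.
have [M HM] := grad_iterate_bounded kK.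
apply: (@le_lt_trans _ _ (\int[P]__ M%:E)%E).
  by apply: integral_mono => w; rewrite lee_fin.
by rewrite integral_cst_probability ltry.
Qed.

Let beta_gt0 : 0 < beta. Proof. by rewrite subr_gt0. Qed.

Let measurable_V k : (k <= K.+1)%N -> measurable_fun setT (V k : Omega -> X).
Proof.
move=> kK; have [mx mm] := measurable_iterate kK.
have m00 := samples_init_meas indep.
apply: measurable_rVB.
  by apply: measurable_rVB => //; exact: measurable_grad_objective.
by apply: measurable_rVZ; exact: measurable_rVB.
Qed.

Let A0_ge0 c : 0 <= c -> 0 <= A0 c.
Proof.
move=> c0; have b0 : 0 <= 1 - alpha by rewrite subr_ge0 ltW.
have lr0 : 0 <= LL1 * rho_hi * sigma_g by rewrite !mulr_ge0// ltW.
apply: addr_ge0; first exact: mulr_ge0.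
apply: mulr_ge0 => //; apply: divr_ge0; last exact: ltW.
by apply: mulr_ge0; [exact: mulr_ge0|exact: addr_ge0].
Qed.

Let B0_ge0 c : 0 <= c -> 0 <= B0 c.
Proof.
move=> c0; have b0 : 0 <= 1 - alpha by rewrite subr_ge0 ltW.
apply: mulr_ge0 => //; apply: divr_ge0; last exact: ltW.
by apply: mulr_ge0 => //; exact: mulr_ge0.
Qed.

Section Recursion.
Variable c : R.
Hypotheses (c0 : 0 <= c) (cc : 1 + LL1 * eta * c <= c).

Lemma expectation_sqrt_V k C : (k <= K.+1)%N -> 0 <= C ->
  (\int[P]_w (Num.sqrt (norm2 (V k w) ^+ 2 + C))%:E <=
   (Num.sqrt ((A0 c) ^+ 2 * geo_acc (beta ^+ 2) (fun=> 1) k + C)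
     + B0 c * geo_acc beta G k)%:E)%E.
Proof.
elim: k C => [|k IH] C kK C0.
  under eq_integral do rewrite V0 norm20 expr0n add0r.
  by rewrite integral_cst_probability /= !mulr0 addr0 add0r.
apply: (le_trans (expectation_V_step c0 cc C0 kK)).
(* With this choice [beta ^+ 2 * r + A0 c ^+ 2 + C] equals [beta ^+ 2 * (r + C')]: the factor [beta]
   leaves the root and the induction hypothesis is used at [C']. *)
set C' := ((A0 c) ^+ 2 + C) / beta ^+ 2.
have b20 : 0 < beta ^+ 2 by rewrite exprn_gt0.
have C'0 : 0 <= C' by rewrite divr_ge0 ?addr_ge0 ?sqr_ge0.
have sqrtE r : 0 <= r + C' ->
    Num.sqrt (beta ^+ 2 * r + (A0 c) ^+ 2 + C) = beta * Num.sqrt (r + C').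
  move=> rC; rewrite -addrA.
  have -> : beta ^+ 2 * r + (A0 c ^+ 2 + C) = beta ^+ 2 * (r + C').
    by rewrite mulrDr /C' [_ * (_ / _)]mulrCA divff ?mulr1// gt_eqF.
  by rewrite sqrtrM ?sqr_ge0// sqrtr_sqr gtr0_norm.
under eq_integral => w _.
  rewrite norm2Z gtr0_norm// exprMn sqrtE; last by rewrite addr_ge0// sqr_ge0.
  rewrite EFinD EFinM [(B0 c * _)%:E]EFinM; over.
have mV2 : measurable_fun setT (fun w => (Num.sqrt (norm2 (V k w) ^+ 2 + C'))%:E).
  apply/measurable_EFinP.
  apply: (@measurableT_comp _ _ _ _ _ _ (Num.sqrt : R -> R)).
    by apply: continuous_measurable_fun; exact: sqrt_continuous.
  apply: measurable_funD => //; apply: measurable_funX; apply: measurable_norm2.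
  by apply: measurable_V; exact: ltnW.
have mg : measurable_fun setT (fun w => (g k w)%:E).
  by apply/measurable_EFinP; apply: measurable_grad_iterate; exact: ltnW.
rewrite ge0_integralD//; last 4 first.
- by move=> w _; rewrite mule_ge0// lee_fin ?sqrtr_ge0// ltW.
- exact: measurable_funeM.
- by move=> w _; apply: mule_ge0; rewrite lee_fin; [exact: (B0_ge0 c0)|exact: g_ge0].
- exact: measurable_funeM.
rewrite (ge0_integralZl _ measurableT mV2); last 2 first.
- by move=> w _; rewrite lee_fin sqrtr_ge0.
- by rewrite lee_fin ltW.
rewrite (ge0_integralZl _ measurableT mg); last 2 first.
- by move=> w _; rewrite lee_fin; exact: g_ge0.
- by rewrite lee_fin; exact: (B0_ge0 c0).
rewrite (GE (ltnW kK)) -EFinM.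
apply: (@le_trans _ _ ((beta * (Num.sqrt ((A0 c) ^+ 2 * geo_acc (beta ^+ 2) (fun=> 1) k + C')
     + B0 c * geo_acc beta G k) + B0 c * G k)%:E)).
  rewrite [leRHS]EFinD leeD2r// EFinM; apply: lee_wpmul2l; first by rewrite lee_fin ltW.
  exact: IH (ltnW kK) C'0.
rewrite lee_fin mulrDr -sqrtE; last first.
  by rewrite addr_ge0// mulr_ge0 ?sqr_ge0// geo_acc_ge0// sqr_ge0.
rewrite le_eqVlt; apply/orP; left; apply/eqP => /=.
rewrite -addrA; congr (Num.sqrt _ + _); last by ring.
by ring.
Qed.

End Recursion.

(** * Descent along the iterates and summation over the steps *)

Let e k w := m k w - grad f (x k w).

(** The error enters twice, in replacing the gradient by the momentum in the linear term and in
    comparing their dual norms; hence the factor 2. *)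
Lemma descent_step k w : (k <= K)%N ->
  f (x k.+1 w) <= f (x k w) - eta * g k w + 2 * eta * dual_norm N (e k w)
     + (L0 + L1 * g k w) / (1 - L1 * eta) * eta ^+ 2 / 2.
Proof.
move=> kK; set l := lmo k (m k w).
have lset : lmo_set N eta (m k w) l by exact: (mvr_lmo_argmin iter (m k w) kK).
have Nl0 : 0 <= N l by exact: (is_norm_ge0 normN).
have Lw := le_lt_trans (LNstep w kK) Leta.
have := descent normN lo0 hi0 rho (x k w) L00 L10 (ubv_obj_diff ubv) smf Lw.
rewrite -(mvr_x_step iter w kK) => /le_trans; apply; apply: lerD.
  have H1 := lmo_dual normN lo0 rho eta0 lset.
  have E1 : grad f (x k w) = m k w - e k w by rewrite /e opprB addrC subrK.
  have H2 : - dot (e k w) l <= eta * dual_norm N (e k w).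
    rewrite -dotNl; apply: (le_trans (dot_le_dual normN lo0 rho _ _)).
    rewrite (dual_normN normN lo0 rho) mulrC; apply: ler_wpM2r.
      exact: (dual_norm_ge0 lo0 rho).
    exact: Nstep.
  have H3 : g k w <= dual_norm N (m k w) + dual_norm N (e k w).
    rewrite /g E1; apply: (le_trans (dual_normD normN lo0 rho _ _)).
    by rewrite (dual_normN normN lo0 rho).
  have := ler_wpM2l eta0 H3.
  rewrite -addrA lerD2l {1}E1 dotBl -/l; lra.
have Nl := Nstep w kK; rewrite -/l in Nl Lw *.
have k0 : 0 <= L0 + L1 * g k w by rewrite addr_ge0// mulr_ge0.
apply: ler_wpM2r => //; apply: ler_pM.
- by rewrite divr_ge0// subr_ge0 ltW.
- exact: sqr_ge0.
- apply: ler_wpM2l => //; rewrite lef_pV2 ?posrE ?subr_gt0// lerD2l lerN2.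
  exact: LNstep.
- by apply: lerXn2r; rewrite ?nnegrE.
Qed.

Let d0 w := dual_norm N (m0 w - grad f x0).

Let error_le k w :
  dual_norm N (e k w) <= beta ^+ k * d0 w + rho_hi * norm2 (V k w).
Proof.
have -> : e k w = beta ^+ k *: (m0 w - grad f x0) + V k w.
  by rewrite /V addrC subrK.
apply: (le_trans (dual_normD normN lo0 rho _ _)); apply: lerD; last exact: (rho _).2.
by apply: (dual_normZ_le normN lo0 rho); rewrite exprn_ge0// ltW.
Qed.

(** The fraction of the decrease [eta * g k w] that survives the part of the quadratic term
    proportional to [g k w]. *)
Let kappa := 1 - L1 * eta / (2 * (1 - L1 * eta)).

Lemma descent_sum fl w j : (forall y, fl <= f y) -> (j <= K.+1)%N ->
  eta * kappa * \sum_(k < j) g k w <=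
    (f x0 - f (x j w)) + j%:R * (L0 / (1 - L1 * eta) * eta ^+ 2 / 2)
    + \sum_(k < j) 2 * eta * (beta ^+ k * d0 w + rho_hi * norm2 (V k w)).
Proof.
move=> flf; elim: j => [_|j IH jK].
  by rewrite !big_ord0 mulr0 (mvr_x0 iter) subrr mul0r !addr0.
rewrite !big_ord_recr /= mulrDr -natr1.
have := IH (ltnW jK); have := descent_step w jK.
have := ler_wpM2l (mulr_ge0 (ler0n R 2) eta0) (error_le j w).
have E : eta * kappa * g j w = eta * g j w
    - (L0 + L1 * g j w) / (1 - L1 * eta) * eta ^+ 2 / 2
    + L0 / (1 - L1 * eta) * eta ^+ 2 / 2.
  rewrite /kappa; field; apply/eqP => H.
  by move: Leta; rewrite -subr_gt0 H ltxx.
rewrite E; set t := (L0 + _) / _ * _ / 2; set q := L0 / _ * _ / 2; lra.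
Qed.

Lemma expectation_sum_grad c fl E0 : 0 <= c -> 1 + LL1 * eta * c <= c ->
  (forall y, fl <= f y) -> 0 <= kappa ->
  (\int[P]_w (d0 w)%:E = E0%:E)%E ->
  eta * kappa * \sum_(k < K.+1) G k <=
    (f x0 - fl) + K.+1%:R * (L0 / (1 - L1 * eta) * eta ^+ 2 / 2)
    + \sum_(k < K.+1) 2 * eta * (beta ^+ k * E0
        + rho_hi * (A0 c * Num.sqrt (geo_acc (beta ^+ 2) (fun=> 1) k)
                      + B0 c * geo_acc beta G k)).
Proof.
move=> c0 cc flf kap0 HE0.
set Dl := (f x0 - fl) + _.
have L1e : 0 < 1 - L1 * eta by rewrite subr_gt0.
have Dl0 : 0 <= Dl.
  rewrite addr_ge0 ?subr_ge0// mulr_ge0// divr_ge0// mulr_ge0 ?sqr_ge0//.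
  by rewrite divr_ge0// ltW.
(* The last value of [f] is replaced by its lower bound before integrating, so that only nonnegative
   functions are integrated. *)
have path w : eta * kappa * \sum_(k < K.+1) g k w <=
    Dl + \sum_(k < K.+1) 2 * eta * (beta ^+ k * d0 w + rho_hi * norm2 (V k w)).
  apply: (le_trans (descent_sum w flf (leqnn _))); rewrite lerD2r lerD2r.
  by rewrite lerD2l lerN2.
have d0_ge0 w : 0 <= d0 w by exact: (dual_norm_ge0 lo0 rho).
have mg (k : 'I_K.+1) : measurable_fun setT (fun w => (g k w)%:E).
  by apply/measurable_EFinP/measurable_grad_iterate; exact: ltnW.
have md : measurable_fun setT (fun w => (d0 w)%:E).
  apply/measurable_EFinP/measurable_dual_norm; apply: measurable_rVB => //.
  exact: (samples_init_meas indep).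
have mV (k : 'I_K.+1) : measurable_fun setT (fun w => (norm2 (V k w))%:E).
  by apply/measurable_EFinP/measurable_norm2/measurable_V; exact: ltnW.
have ek0 : 0 <= eta * kappa by exact: mulr_ge0.
have bk0 k : 0 <= beta ^+ k by rewrite exprn_ge0// ltW.
have e20 : 0 <= 2 * eta by exact: mulr_ge0.
have EV (k : 'I_K.+1) : (\int[P]_w (norm2 (V k w))%:E <=
    (A0 c * Num.sqrt (geo_acc (beta ^+ 2) (fun=> 1) k) + B0 c * geo_acc beta G k)%:E)%E.
  have := expectation_sqrt_V c0 cc (ltnW (ltn_ord k)) (lexx 0).
  under eq_integral do rewrite addr0 sqrtr_sqr (ger0_norm (norm2_ge0 _)).
  move=> /le_trans; apply; rewrite addr0 sqrtrM ?sqr_ge0// sqrtr_sqr.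
  by rewrite (ger0_norm (A0_ge0 c0)).
have Eterm (k : 'I_K.+1) :
    (\int[P]_w (2 * eta * (beta ^+ k * d0 w + rho_hi * norm2 (V k w)))%:E <=
    (2 * eta * (beta ^+ k * E0
        + rho_hi * (A0 c * Num.sqrt (geo_acc (beta ^+ 2) (fun=> 1) k)
                      + B0 c * geo_acc beta G k)))%:E)%E.
  under eq_integral => w _ do rewrite EFinM EFinD 2![in X in (_ * X)%E]EFinM.
  have n1 w : (0 <= (beta ^+ k)%:E * (d0 w)%:E)%E by rewrite mule_ge0// lee_fin.
  have n2 w : (0 <= rho_hi%:E * (norm2 (V k w))%:E)%E.
    by rewrite mule_ge0// lee_fin ?norm2_ge0// ltW.
  have m1 : measurable_fun setT (fun w => (beta ^+ k)%:E * (d0 w)%:E)%E.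
    exact: measurable_funeM.
  have m2 : measurable_fun setT (fun w => rho_hi%:E * (norm2 (V k w))%:E)%E.
    exact: measurable_funeM.
  rewrite (ge0_integralZl _ measurableT (emeasurable_funD m1 m2)); last 2 first.
  - by move=> w _; exact: adde_ge0.
  - by rewrite lee_fin.
  rewrite (ge0_integralD _ measurableT (fun w _ => n1 w) m1 (fun w _ => n2 w) m2).
  rewrite (ge0_integralZl _ measurableT md); last 2 first.
  - by move=> w _; rewrite lee_fin.
  - by rewrite lee_fin.
  rewrite (ge0_integralZl _ measurableT (mV k)); last 2 first.
  - by move=> w _; rewrite lee_fin norm2_ge0.
  - by rewrite lee_fin ltW.
  rewrite HE0 [leRHS]EFinM; apply: lee_wpmul2l; first by rewrite lee_fin.
  rewrite [leRHS]EFinD EFinM leeD2l// [leRHS]EFinM; apply: lee_wpmul2l => //.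
  by rewrite lee_fin ltW.
rewrite -lee_fin.
have -> : ((eta * kappa * \sum_(k < K.+1) G k)%:E =
    \int[P]_w (eta * kappa * \sum_(k < K.+1) g k w)%:E)%E.
  under eq_integral do rewrite EFinM -sumEFin.
  rewrite ge0_integralZl//; last 2 first.
  - exact: emeasurable_sum.
  - by move=> w _; apply: sume_ge0 => k _; rewrite lee_fin; exact: g_ge0.
  rewrite ge0_integral_sum//; last by move=> k w _; rewrite lee_fin; exact: g_ge0.
  rewrite EFinM -sumEFin; congr (_ * _)%E; apply: eq_bigr => k _.
  by rewrite GE// ltnW.
apply: (@le_trans _ _ (\int[P]_w (Dl%:E + \sum_(k < K.+1)
   (2 * eta * (beta ^+ k * d0 w + rho_hi * norm2 (V k w)))%:E))%E).
  apply: integral_mono => w.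
    by rewrite lee_fin mulr_ge0// sumr_ge0// => k _; exact: g_ge0.
  by rewrite sumEFin -EFinD lee_fin.
have t0 (k : 'I_K.+1) w : (0 <= (2 * eta * (beta ^+ k * d0 w + rho_hi * norm2 (V k w)))%:E)%E.
  by rewrite lee_fin mulr_ge0// addr_ge0// mulr_ge0 ?norm2_ge0// ltW.
have mt (k : 'I_K.+1) : measurable_fun setT
    (fun w => (2 * eta * (beta ^+ k * d0 w + rho_hi * norm2 (V k w)))%:E).
  apply/measurable_EFinP; apply: measurable_funM => //.
  apply: measurable_funD; apply: measurable_funM => //; first exact/measurable_EFinP.
  exact/measurable_EFinP/mV.
rewrite ge0_integralD//; last 2 first.
- by move=> w _; apply: sume_ge0 => k _; exact: t0.
- exact: emeasurable_sum.
rewrite integral_cst_probability ge0_integral_sum//.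
rewrite [leRHS]EFinD leeD2l// -[leRHS]sumEFin.
by apply: lee_sum => k _; exact: Eterm.
Qed.

(** The initial error and the slopes are summed with geometric weights and cost 1 / alpha; the
    constant noise costs only 1 / sqrt(alpha) per step. The sum of the [G k] remains on both sides,
    to be absorbed once the constants are fixed. *)
Lemma sum_grad_bound c fl E0 : 0 < alpha -> 0 <= c -> 1 + LL1 * eta * c <= c ->
  (forall y, fl <= f y) -> 0 <= kappa ->
  (\int[P]_w (d0 w)%:E = E0%:E)%E ->
  eta * kappa * \sum_(k < K.+1) G k <=
    (f x0 - fl) + K.+1%:R * (L0 / (1 - L1 * eta) * eta ^+ 2 / 2)
    + 2 * eta * (E0 / alpha + K.+1%:R * rho_hi * A0 c / Num.sqrt alpha
                   + rho_hi * B0 c / alpha * \sum_(k < K.+1) G k).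
Proof.
move=> al0 c0 cc flf kap0 HE0.
apply: (le_trans (expectation_sum_grad c0 cc flf kap0 HE0)); rewrite lerD2l.
have E0_ge0 : 0 <= E0.
  rewrite -lee_fin -HE0; apply: integral_ge0 => w _.
  by rewrite lee_fin; exact: (dual_norm_ge0 lo0 rho).
rewrite -mulr_sumr; apply: ler_wpM2l; first exact: mulr_ge0.
rewrite big_split /= -addrA; apply: lerD.
  rewrite -mulr_suml mulrC ler_wpM2l// -[leRHS]mul1r ler_pdivlMr// mulrC.
  have -> : alpha = 1 - beta by rewrite /beta; ring.
  by apply: sum_exp_le; exact: ltW.
rewrite -mulr_sumr big_split /= mulrDr; apply: lerD.
  rewrite -mulr_sumr.
  have sa0 : 0 < Num.sqrt alpha by rewrite sqrtr_gt0.
  have Ssum : \sum_(k < K.+1) Num.sqrt (geo_acc (beta ^+ 2) (fun=> 1) k)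
      <= K.+1%:R / Num.sqrt alpha.
    apply: (@le_trans _ _ (\sum_(k < K.+1) (Num.sqrt alpha)^-1)); last first.
      by rewrite sumr_const card_ord mulr_natl.
    apply: ler_sum => k _; rewrite -[leRHS]mul1r ler_pdivlMr// -sqrtrM; last first.
      by apply: geo_acc_ge0 => //; exact: sqr_ge0.
    rewrite -[leRHS]sqrtr1 ler_sqrt// mulrC.
    have {1}-> : alpha = 1 - beta by rewrite /beta; ring.
    by apply: geo_acc_sqr_le; [exact: ltW|rewrite gerBl].
  have := ler_wpM2l (mulr_ge0 (ltW hi0) (A0_ge0 c0)) Ssum.
  by rewrite mulrA => /le_trans; apply; rewrite le_eqVlt; apply/orP; left; apply/eqP; ring.
have Tsum : \sum_(k < K.+1) geo_acc beta G k <= alpha^-1 * \sum_(k < K.+1) G k.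
  rewrite mulrC ler_pdivlMr// mulrC.
  have {1}-> : alpha = 1 - beta by rewrite /beta; ring.
  by apply: sum_geo_acc_le; [exact: ltW|exact: G_ge0].
rewrite -mulr_sumr.
have := ler_wpM2l (mulr_ge0 (ltW hi0) (B0_ge0 c0)) Tsum.
by rewrite !mulrA.
Qed.

Lemma min_expectation_grad :
  (\big[mine/+oo]_(k < K.+1) \int[P]_w (g k w)%:E <=
     (K.+1%:R^-1 * \sum_(k < K.+1) G k)%:E)%E.
Proof.
set mn := (X in (X <= _)%E).
have H (k : 'I_K.+1) : (mn <= (G k)%:E)%E.
  rewrite -(GE (ltnW (ltn_ord k))).
  exact: (bigmin_le +oo%E k (fun i : 'I_K.+1 => \int[P]_w (g i w)%:E)%E).
have [r mr] : exists r, mn = r%:E \/ mn = -oo%E.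
  case: mn H => [r H|H|H]; [by exists r; left|by have := H ord0|by exists 0; right].
case: mr => mr; last by rewrite mr leNye.
rewrite mr lee_fin ler_pdivlMl// mulr_natl.
rewrite -[K.+1 in X in X <= _]card_ord -sumr_const.
by apply: ler_sum => k _; rewrite -lee_fin -mr.
Qed.

End Algorithm.

(** * The rate *)

(* [kap], [A0] and [B0] stand for [K1 `^ (1 / 3)] and for the constant part and
   the slope of the noise level; 11/8 is any [c] with [1 + c / 33 <= c] that is
   small enough for the final constants. *)
Lemma rate_arith (R : realType)
    (kap etah L0 L1 LL0 LL1 rl rh sg Dl E0 SG A0 B0 X X2 : R) :
  1 < kap -> 0 < etah -> 0 <= L0 -> 0 <= L1 -> 0 <= LL0 -> 0 <= LL1 ->
  0 < rl -> 0 < rh -> 0 <= sg -> 0 <= Dl -> 0 <= E0 -> 0 <= SG ->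
  L1 * etah <= 3^-1 -> rh / rl * LL1 * etah <= 33^-1 ->
  1 + L1 * etah <= X -> 1 <= X2 ->
  let eta := etah / kap ^+ 2 in
  A0 <= sg / kap ^+ 2 + 11 / 8 * eta * (LL0 + LL1 * rh * sg) / rl ->
  B0 <= 11 / 8 * eta * LL1 / rl ->
  eta * (1 - L1 * eta / (2 * (1 - L1 * eta))) * SG <=
    Dl + kap ^+ 3 * (L0 / (1 - L1 * eta) * eta ^+ 2 / 2)
    + 2 * eta * (E0 * kap ^+ 2 + kap ^+ 3 * rh * A0 * kap
                  + rh * B0 * kap ^+ 2 * SG) ->
  SG / kap ^+ 3 <= 2 * Dl / (etah * kap) + 4 * (E0 + rh * sg) / kap
    + etah * L0 * X / kap ^+ 2
    + 8 * (rh / rl) * (LL0 + 2 * LL1 * rh * sg) * X2 * (etah / kap).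
Proof.
move=> kap1 eh0 L00 L10 LL00 LL10 rl0 rh0 sg0 Dl0 E00 SG0 Lh LLh HX HX2 eta HA HB H.
have kap0 : 0 < kap by lra.
have k20 : 0 < kap ^+ 2 by rewrite exprn_gt0.
have eta0 : 0 < eta by rewrite divr_gt0.
have eta_le : eta <= etah.
  rewrite /eta ler_pdivrMr// ler_peMr//; first exact: ltW.
  by rewrite exprn_ege1// ltW.
set u := L1 * eta in H.
have u0 : 0 <= u by rewrite mulr_ge0// ltW.
have uLh : u <= L1 * etah by exact: ler_wpM2l.
have u3 : u <= 3^-1 by exact: le_trans Lh.
(* Valid for [u <= 3^-1]; with the final factor 3/4 it stays below [1 + u], hence below [X]. *)
have iu : (1 - u)^-1 <= 1 + 3 / 2 * u.
  rewrite -[leLHS]mul1r ler_pdivrMr; last by lra.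
  by nra.
have kp : 3 / 4 <= 1 - u / (2 * (1 - u)).
  have : u / (2 * (1 - u)) <= 4^-1 by rewrite ler_pdivrMr; lra.
  by lra.
(* This is 11/8 times 1/33. Doubled, it takes 1/12 off the coefficient 3/4 of [SG] and leaves
   2/3. *)
have HB' : rh * B0 * kap ^+ 2 <= 24^-1.
  apply: (@le_trans _ _ (rh * (11 / 8 * eta * LL1 / rl) * kap ^+ 2)).
    by rewrite ler_wpM2r ?(ltW k20)// ler_wpM2l// ltW.
  have -> : rh * (11 / 8 * eta * LL1 / rl) * kap ^+ 2 = 11 / 8 * (rh / rl * LL1 * etah).
    by rewrite /eta; field; rewrite !gt_eqF.
  by lra.
set Y := LL0 + LL1 * rh * sg in HA.
have HA' : kap ^+ 2 * A0 <= sg + 11 / 8 * etah * Y / rl.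
  have := ler_wpM2l (ltW k20) HA.
  have -> // : kap ^+ 2 * (sg / kap ^+ 2 + 11 / 8 * eta * Y / rl) =
    sg + 11 / 8 * etah * Y / rl.
  by rewrite /eta; field; rewrite !gt_eqF.
set q := (1 - u)^-1 in iu.
have q0 : 0 <= q by rewrite invr_ge0; lra.
have SGb : 2 / 3 * SG <= Dl * kap ^+ 2 / etah + kap * L0 * q * etah / 2
    + 2 * E0 * kap ^+ 2 + 2 * kap ^+ 2 * rh * (sg + 11 / 8 * etah * Y / rl).
  rewrite -(ler_pM2l eta0).
  have E1 : eta * (Dl * kap ^+ 2 / etah + kap * L0 * q * etah / 2
    + 2 * E0 * kap ^+ 2 + 2 * kap ^+ 2 * rh * (sg + 11 / 8 * etah * Y / rl)) =
    Dl + kap ^+ 3 * (L0 * q * eta ^+ 2 / 2) +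
    2 * eta * (E0 * kap ^+ 2 + kap ^+ 2 * rh * (sg + 11 / 8 * etah * Y / rl)).
    by rewrite /eta; field; rewrite !gt_eqF.
  rewrite E1.
  have e20 : 0 <= 2 * eta by apply: mulr_ge0 => //; exact: ltW.
  have T1 : eta * (3 / 4 * SG) <= eta * (1 - u / (2 * (1 - u))) * SG.
    by rewrite -[leRHS]mulrA ler_wpM2l ?(ltW eta0)// ler_wpM2r.
  have T2 : 2 * eta * (rh * B0 * kap ^+ 2 * SG) <= 2 * eta * (24^-1 * SG).
    by apply: ler_wpM2l => //; exact: ler_wpM2r.
  have T3 : 2 * eta * (kap ^+ 3 * rh * A0 * kap) <=
      2 * eta * (kap ^+ 2 * rh * (sg + 11 / 8 * etah * Y / rl)).
    apply: ler_wpM2l => //.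
    have -> : kap ^+ 3 * rh * A0 * kap = kap ^+ 2 * rh * (kap ^+ 2 * A0) by ring.
    by rewrite ler_wpM2l// mulr_ge0 ?(ltW k20)// ltW.
  rewrite -/q in H.
  move: H; rewrite 2![2 * eta * (_ + _)]mulrDr => H.
  have : eta * (2 / 3 * SG) = eta * (3 / 4 * SG) - 2 * eta * (24^-1 * SG) by field.
  rewrite [2 * eta * (_ + _)]mulrDr; lra.
have k30 : 0 < kap ^+ 3 by rewrite exprn_gt0.
rewrite ler_pdivrMr//.
have -> : (2 * Dl / (etah * kap) + 4 * (E0 + rh * sg) / kap
    + etah * L0 * X / kap ^+ 2
    + 8 * (rh / rl) * (LL0 + 2 * LL1 * rh * sg) * X2 * (etah / kap)) * kap ^+ 3 =
  2 * (Dl * kap ^+ 2 / etah) + 4 * (E0 * kap ^+ 2 + kap ^+ 2 * rh * sg)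
   + kap * L0 * etah * X
   + 8 * (kap ^+ 2 * rh * (etah * (LL0 + 2 * LL1 * rh * sg) / rl)) * X2.
  by field; rewrite !gt_eqF.
have Q1 : 0 <= Dl * kap ^+ 2 / etah by rewrite divr_ge0 ?mulr_ge0// ltW.
have Q2 : 0 <= E0 * kap ^+ 2 by rewrite mulr_ge0// ltW.
have Q3 : 0 <= kap ^+ 2 * rh * sg by rewrite !mulr_ge0// ltW.
have lrs : 0 <= LL1 * rh * sg by rewrite !mulr_ge0// ltW.
have Q4 : kap * L0 * q * etah * (3 / 4) <= kap * L0 * etah * X.
  have -> : kap * L0 * q * etah * (3 / 4) = kap * L0 * etah * (q * (3 / 4)) by ring.
  rewrite ler_wpM2l ?mulr_ge0 ?(ltW kap0) ?(ltW eh0)//; lra.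
set Y2 := LL0 + 2 * LL1 * rh * sg.
have YY2 : Y <= Y2 by rewrite /Y /Y2 lerD2l -!mulrA [2 * _]mulr_natl mulr2n lerDl mulrA.
have Y0 : 0 <= Y by rewrite /Y addr_ge0.
have kr0 : 0 <= kap ^+ 2 * rh by apply: mulr_ge0; exact: ltW.
have Q6 : 0 <= kap ^+ 2 * rh * (etah * Y / rl).
  by apply: mulr_ge0 => //; apply: divr_ge0; [apply: mulr_ge0 => //|]; exact: ltW.
have Q5 : kap ^+ 2 * rh * (etah * Y / rl) <= kap ^+ 2 * rh * (etah * Y2 / rl) * X2.
  have Q7 : kap ^+ 2 * rh * (etah * Y / rl) <= kap ^+ 2 * rh * (etah * Y2 / rl).
    apply: ler_wpM2l => //; apply: ler_wpM2r; first by rewrite invr_ge0 ltW.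
    by apply: ler_wpM2l => //; exact: ltW.
  apply: (le_trans Q7); rewrite ler_peMr//; exact: le_trans Q7.
(* Multiplying by 3/2 gives the coefficients 3/2 for [Dl], 3/4 for the [L0] term, 3 for [E0] and for
   [sg], and 33/8 for the [Y] term, within the 2, 1, 4, 4 and 8 of the claim. *)
have SGb' : 2 / 3 * SG <= Dl * kap ^+ 2 / etah + kap * L0 * q * etah / 2
    + 2 * (E0 * kap ^+ 2) + 2 * (kap ^+ 2 * rh * sg)
    + 11 / 4 * (kap ^+ 2 * rh * (etah * Y / rl)).
  apply: (le_trans SGb); rewrite le_eqVlt; apply/orP; left; apply/eqP.
  by field; rewrite !gt_eqF.
lra.
Qed.

Theorem theorem4 (R : realType) (n : nat)
    (N : 'rV[R]_n -> R) (rho_lo rho_hi : R)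
    (dS dO : measure_display)
    (S : measurableType dS) (Omega : measurableType dO)
    (D : probability S R) (P : probability Omega R)
    (F : S -> 'rV[R]_n -> R)
    (sigma_g sigma_H L0 L1 LL0 LL1 : R)
    (K : nat) (lmo : nat -> 'rV[R]_n -> 'rV[R]_n)
    (xi : nat -> Omega -> S)
    (x0 : 'rV[R]_n) (m0 : Omega -> 'rV[R]_n)
    (x m : nat -> Omega -> 'rV[R]_n) :
  let f := objective D F in
  let f_inf := inf (range f) in
  let K1 : R := K.+1%:R in
  let hat_eta := 3^-1 * Num.min (L1^-1)
                   ((11 * LL1)^-1 * (rho_hi / rho_lo)^-1) in
  let alpha := 1 / (K1 `^ (2 / 3)) in
  let eta := hat_eta / (K1 `^ (2 / 3)) in
  is_norm N ->
  0 < rho_lo -> 0 < rho_hi ->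
  (forall v : 'rV[R]_n, rho_lo * norm2 v <= dual_norm N v /\
                        dual_norm N v <= rho_hi * norm2 v) ->
  0 <= sigma_g -> 0 <= sigma_H ->
  0 <= L0 -> 0 < L1 -> 0 <= LL0 -> 0 < LL1 ->
  (forall v, D.-integrable setT (fun s => (F s v)%:E)) ->
  unbiased_bounded_variance D F sigma_g sigma_H ->
  has_lbound (range f) ->
  symmetric_smooth N L0 L1 f ->
  mean_squared_symmetric_smooth D N LL0 LL1 F ->
  (1 <= K)%N ->
  independent_samples D P m0 xi ->
  lmo_mvr_iterates N F K (fun=> alpha) (fun=> eta) lmo xi x0 m0 x m ->
  (\big[mine/+oo]_(k < K.+1) 'E_P[fun w => dual_norm N (grad f (x k w))]
   <= (2 * (f x0 - f_inf) / (hat_eta * K1 `^ (1 / 3)))%:E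
      + 4%:E * ('E_P[fun w => dual_norm N (m0 w - grad f x0)%R]
                  + (rho_hi * sigma_g)%:E)
        * ((K1 `^ (1 / 3))^-1)%:E
      + (hat_eta * L0 * expR (L1 * hat_eta) / K1 `^ (2 / 3))%:E
      + (8 * (rho_hi / rho_lo) * (LL0 + 2 * LL1 * rho_hi * sigma_g)
           * expR (6 * LL1 ^+ 2 * hat_eta ^+ 2)
           * (hat_eta / K1 `^ (1 / 3)))%:E)%E.
Proof.
move=> f f_inf K1 hat_eta alpha eta normN lo0 hi0 rho sg0 sH0 L00 L10 LL00 LL10
  intF ubv lbf smf mss K1_ge1 indep iter.
pose kap := K1 `^ (1 / 3).
have K1_gt0 : 0 < K1 by rewrite ltr0n.
have kap0 : 0 < kap by rewrite powR_gt0.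
have kap2 : K1 `^ (2 / 3) = kap ^+ 2.
  rewrite /kap -powR_mulrn ?powR_ge0// -powRrM; congr (_ `^ _).
  by field.
have kap3 : K1 = kap ^+ 3.
  rewrite /kap -powR_mulrn ?powR_ge0// -powRrM.
  have -> : 1 / 3 * 3%:R = 1 :> R by field.
  by rewrite powRr1// ltW.
(* Here [1 <= K] enters: it makes [alpha < 1], so that the recursion can divide by [1 - alpha]. *)
have kap1 : 1 < kap.
  rewrite ltNge; apply/negP => k1.
  have : K1 <= 1 by rewrite kap3 exprn_ile1// ltW.
  by rewrite /K1 lern1 ltnS leqn0 => /eqP K0; move: K1_ge1; rewrite K0.
have r0 : 0 < rho_hi / rho_lo by rewrite divr_gt0.
have hat0 : 0 < hat_eta.
  by rewrite mulr_gt0// lt_min !invr_gt0 L10 mulr_gt0// ?invr_gt0// mulr_gt0.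
have Lh : L1 * hat_eta <= 3^-1.
  have : hat_eta <= 3^-1 * L1^-1 by rewrite ler_wpM2l// ge_min lexx.
  by move=> /(ler_wpM2l (ltW L10)); rewrite [leRHS]mulrCA divff ?mulr1// gt_eqF.
have LLh : rho_hi / rho_lo * LL1 * hat_eta <= 33^-1.
  have : hat_eta <= 3^-1 * ((11 * LL1)^-1 * (rho_hi / rho_lo)^-1).
    by rewrite ler_wpM2l// ge_min lexx orbT.
  move=> /(ler_wpM2l (ltW (mulr_gt0 r0 LL10))) /le_trans; apply.
  by rewrite le_eqVlt; apply/orP; left; apply/eqP; field; rewrite !gt_eqF.
have f_inf_le y : f_inf <= f y by apply: ge_inf => //; exists y.
have Dl0 : 0 <= f x0 - f_inf by rewrite subr_ge0.
have dn0 v : 0 <= dual_norm N v by exact: (dual_norm_ge0 lo0 rho).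
rewrite kap2 -/kap.
have X1 : 1 + L1 * hat_eta <= expR (L1 * hat_eta) by exact: expR_ge1Dx.
have X2 : 1 <= expR (6 * LL1 ^+ 2 * hat_eta ^+ 2).
  apply: le_trans (expR_ge1Dx _); rewrite lerDl.
  by apply: mulr_ge0; [apply: mulr_ge0 => //|]; exact: sqr_ge0.
have lrs : 0 <= LL0 + 2 * LL1 * rho_hi * sigma_g.
  by rewrite addr_ge0// !mulr_ge0// ltW.
rewrite expectation.unlock.
set Ed0 := (\int[P]_w (dual_norm N (m0 w - grad f x0))%:E)%E.
have Ed00 : (0 <= Ed0)%E by apply: integral_ge0 => w _; rewrite lee_fin.
(* The initial momentum need not be integrable; the right-hand side is then +oo. *)
have [Edoo|Edfin] := eqVneq Ed0 +oo%E.
  rewrite Edoo addye// gt0_muley ?lte_fin// gt0_mulye ?lte_fin ?invr_gt0//.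
  by rewrite addey// !addye// leey.
have EdE : Ed0 = (fine Ed0)%:E by rewrite fineK// ge0_fin_numE// ltey.
set E0 := fine Ed0 in EdE.
have E00 : 0 <= E0 by rewrite -lee_fin -EdE.
set rhs := (X in (_ <= X)%E).
pose RHS := 2 * (f x0 - f_inf) / (hat_eta * kap) + 4 * (E0 + rho_hi * sigma_g) / kap
    + hat_eta * L0 * expR (L1 * hat_eta) / kap ^+ 2
    + 8 * (rho_hi / rho_lo) * (LL0 + 2 * LL1 * rho_hi * sigma_g)
      * expR (6 * LL1 ^+ 2 * hat_eta ^+ 2) * (hat_eta / kap).
have -> : rhs = RHS%:E by rewrite /rhs EdE.
(* Only possible in dimension 0. *)
have [lohi|hilo] := leP rho_lo rho_hi; last first.
  have dn_eq0 v : dual_norm N v = 0.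
    have [v1 v2] := rho v; have v0 := norm2_ge0 v.
    have : norm2 v = 0.
      apply/le_anti; rewrite v0 andbT.
      have : (rho_lo - rho_hi) * norm2 v <= 0.
        by rewrite mulrBl subr_le0; exact: le_trans v2.
      by rewrite pmulr_rle0// subr_gt0.
    by move=> n0; apply/le_anti; rewrite dn0 (le_trans v2)// n0 mulr0.
  apply: (@le_trans _ _ 0%E).
    apply: (le_trans (bigmin_le +oo%E (@ord0 K) (fun k : 'I_K.+1 =>
      \int[P]_w (dual_norm N (grad f (x k w)))%:E)%E)).
    by under eq_integral do rewrite dn_eq0; rewrite integral0.
  have h0 := ltW hat0; have k0 := ltW kap0; have hi0' := ltW hi0; have lo0' := ltW lo0.
  rewrite lee_fin /RHS; apply: addr_ge0; [apply: addr_ge0; [apply: addr_ge0|]|].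
  - by apply: divr_ge0; exact: mulr_ge0.
  - apply: divr_ge0 => //; apply: mulr_ge0 => //; apply: addr_ge0 => //.
    exact: mulr_ge0.
  - apply: divr_ge0; last exact: exprn_ge0.
    by apply: mulr_ge0; [exact: mulr_ge0|exact: expR_ge0].
  - apply: mulr_ge0; last exact: divr_ge0.
    apply: mulr_ge0; last exact: expR_ge0.
    by apply: mulr_ge0 => //; apply: mulr_ge0 => //; exact: divr_ge0.
have k21 : 1 < kap ^+ 2 by rewrite exprn_egt1.
have al0 : 0 < alpha by rewrite /alpha kap2 divr_gt0// exprn_gt0.
have al1 : alpha < 1.
  by rewrite /alpha kap2 ltr_pdivrMr ?mul1r// exprn_gt0.
have etaE : eta = hat_eta / kap ^+ 2 by rewrite /eta kap2.
have eta0 : 0 < eta by rewrite etaE divr_gt0// exprn_gt0.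
have eta_le : eta <= hat_eta.
  by rewrite etaE ler_pdivrMr ?exprn_gt0// ler_peMr// ltW.
have Le3 : L1 * eta <= 3^-1.
  by apply: le_trans Lh; rewrite ler_wpM2l// ltW.
have Le1 : L1 * eta < 1 by apply: (le_lt_trans Le3); lra.
(* The step size bounds [LL1 * eta] multiplied by [rho_hi / rho_lo]; this ratio is at least 1 here,
   so the bound 1/33 passes to [LL1 * eta] itself. *)
have cc : 1 + LL1 * eta * (11 / 8) <= 11 / 8.
  have : LL1 * eta <= 33^-1.
    apply: le_trans LLh; apply: (@le_trans _ _ (LL1 * hat_eta)).
      by rewrite ler_wpM2l// ltW.
    have r1 : 1 <= rho_hi / rho_lo by rewrite ler_pdivlMr// mul1r.
    have := ler_wpM2r (mulr_ge0 (ltW LL10) (ltW hat0)) r1.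
    by rewrite mul1r mulrA.
  lra.
have c0 : 0 <= 11 / 8 :> R by lra.
have kp0 : 0 <= 1 - L1 * eta / (2 * (1 - L1 * eta)).
  have : L1 * eta / (2 * (1 - L1 * eta)) <= 4^-1 by rewrite ler_pdivrMr; lra.
  by lra.
have := min_expectation_grad P normN lo0 hi0 rho ubv L00 (ltW L10) smf iter
  (ltW eta0) Le1.
move=> /le_trans; apply; rewrite lee_fin /RHS.
have := sum_grad_bound normN lo0 hi0 rho ubv sg0 L00 (ltW L10) LL00 (ltW LL10)
  smf mss indep iter (ltW al0) al1 (ltW eta0) Le1 al0 c0 cc f_inf_le kp0 EdE.
set SG := \sum_(k < K.+1) _.
set A0 := alpha * sigma_g + _; set B0 := (1 - alpha) * (11 / 8 * eta * LL1 / rho_lo).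
have sa : Num.sqrt alpha = kap^-1.
  rewrite /alpha kap2 div1r -exprVn sqrtr_sqr ger0_norm// invr_ge0 ltW//.
have iaE : alpha^-1 = kap ^+ 2 by rewrite /alpha kap2 div1r invrK.
rewrite -/K1 kap3 sa invrK iaE => H.
rewrite [_^-1 * _]mulrC.
have SG0 : 0 <= SG.
  apply: sumr_ge0 => k _; apply: fine_ge0; apply: integral_ge0 => w _.
  by rewrite lee_fin.
have b1 : 1 - alpha <= 1 by rewrite gerBl ltW.
have HA : A0 <= sigma_g / kap ^+ 2
    + 11 / 8 * (hat_eta / kap ^+ 2) * (LL0 + LL1 * rho_hi * sigma_g) / rho_lo.
  rewrite /A0 -etaE; apply: lerD; first by rewrite /alpha kap2 mulrC div1r.
  apply: ler_piMl => //; apply: divr_ge0; last exact: ltW.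
  apply: mulr_ge0; first by apply: mulr_ge0 => //; exact: ltW.
  by apply: addr_ge0 => //; rewrite !mulr_ge0// ltW.
have HB : B0 <= 11 / 8 * (hat_eta / kap ^+ 2) * LL1 / rho_lo.
  rewrite /B0 -etaE; apply: ler_piMl => //; apply: divr_ge0; last exact: ltW.
  by apply: mulr_ge0; [apply: mulr_ge0 => //|]; exact: ltW.
apply: (rate_arith kap1 hat0 L00 (ltW L10) LL00 (ltW LL10) lo0 hi0 sg0 Dl0 E00 SG0
  Lh LLh X1 X2 HA HB).
by rewrite -etaE.
Qed.
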